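(* For instances in which all attributes are binary, the problem of deciding whether there exists a perfect committee is fixed-parameter tractable when parameterized by the number of attributes $p$, i.e. it can be solved in time $f(p)\cdot\mathrm{poly}(|I|)$ for some computable function $f$, where $|I|$ is the input size.
   Context: An instance consists of attributes $X_1,\dots,X_p$, each with domain of size $2$, a candidate database $C$ (a finite set in which each candidate $c$ has a value vector $(X_1(c),\dots,X_p(c))$, different candidates may share a vector), a target distribution $\pi=(\pi_1,\dots,\pi_p)$ with $\pi_i=(\pi_i^1,\pi_i^2)$ nonnegative rationals summing to $1$, and an integer $k$. For $A\subseteq C$ with $|A|=k$, $r_i^j(A)=|\{c\in A: X_i(c)=x_i^j\}|/k$. A committee $A$ with $|A|=k$ is perfect if $r_i^j(A)=\pi_i^j$ for all $i,j$. The question is whether a perfect committee exists. *)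

(* Defs.v *)
From HB Require Import structures.
From mathcomp Require Import all_boot all_order all_algebra.
Unset Implicit Arguments. Unset Strict Implicit. Unset Printing Implicit Defensive.
Import Order.TTheory GRing.Theory Num.Theory.

(* An attribute value X_i(c) is a bool: true = x_i^1, false = x_i^2.   *)
(* The candidate database is a list of value vectors (so different     *)
(* candidates may share a vector); candidate c is the index c.         *)
Record instance := Instance {
  inst_p  : nat;
  inst_k  : nat;
  inst_C  : seq (seq bool);
  inst_pi : seq (rat * rat)
}.

Definition valid_instance (I : instance) : bool :=
  [&& all (fun v => size v == inst_p I) (inst_C I),
      size (inst_pi I) == inst_p I &
      all (fun q : rat * rat => [&& 0 <= q.1, 0 <= q.2 & q.1 + q.2 == 1]%R)
          (inst_pi I)].

Definition attr (I : instance) (c : 'I_(size (inst_C I))) (i : nat) : bool :=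
  nth false (nth [::] (inst_C I) c) i.

Definition target (I : instance) (i : nat) : rat * rat :=
  nth (0%R, 0%R) (inst_pi I) i.

Definition ratio (I : instance) (A : {set 'I_(size (inst_C I))}) (i : nat)
    (b : bool) : rat :=
  ((#|[set c in A | attr I c i == b]|)%:R / (inst_k I)%:R)%R.

Arguments ratio I A i b : clear implicits.
Definition perfect (I : instance) (A : {set 'I_(size (inst_C I))}) : Prop :=
  #|A| = inst_k I /\
  forall i, i < inst_p I ->
    ratio I A i true = (target I i).1 /\ ratio I A i false = (target I i).2.

Definition perfect_committee_exists (I : instance) : Prop :=
  exists A : {set 'I_(size (inst_C I))}, perfect I A.

(* Binary encoding of instances over the input alphabet {1,2,3}:       *)
(*   1 = bit 0, 2 = bit 1, 3 = separator '#'.                          *)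
Definition enc_bit (b : bool) : nat := if b then 2 else 1.

Fixpoint bits_of (fuel n : nat) : seq bool :=
  match fuel with
  | 0 => [::]
  | fuel'.+1 => if n == 0 then [::] else odd n :: bits_of fuel' n./2
  end.

(* binary (LSB first, no leading zeros) followed by '#' *)
Definition enc_nat (n : nat) : seq nat := map enc_bit (bits_of n n) ++ [:: 3].

Definition enc_rat (q : rat) : seq nat :=
  enc_nat `|numq q|%N ++ enc_nat `|denq q|%N.

Definition enc_instance (I : instance) : seq nat :=
  enc_nat (inst_p I) ++ enc_nat (inst_k I) ++ enc_nat (size (inst_C I)) ++
  flatten (map (map enc_bit) (inst_C I)) ++
  flatten (map (fun q : rat * rat => enc_rat q.1 ++ enc_rat q.2) (inst_pi I)).

(* Deterministic single-tape Turing machines (two-way infinite tape).  *)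
(* States 'I_nq.+1 (start state ord0), symbols 'I_ns.+4 with blank     *)
(* ord0 and input symbols 1,2,3.                                       *)
Inductive move := MoveL | MoveR | MoveS.

Record TM := mkTM {
  tm_nq : nat;
  tm_ns : nat;
  tm_delta : 'I_tm_nq.+1 -> 'I_tm_ns.+4 -> 'I_tm_nq.+1 * 'I_tm_ns.+4 * move;
  tm_acc : 'I_tm_nq.+1;
  tm_rej : 'I_tm_nq.+1
}.

Section TMSem.
Variable M : TM.
Notation Q := 'I_(tm_nq M).+1.
Notation S := 'I_(tm_ns M).+4.

Record config := Config {
  cf_state : Q;
  cf_left  : seq S;   (* cells left of the head, nearest first *)
  cf_head  : S;
  cf_right : seq S    (* cells right of the head, nearest first *)
}.

Definition blank : S := ord0.

Definition halted (c : config) : bool :=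
  (cf_state c == tm_acc M) || (cf_state c == tm_rej M).

Definition step (c : config) : config :=
  if halted c then c else
  let: (q', w, d) := tm_delta M (cf_state c) (cf_head c) in
  match d with
  | MoveS => Config q' (cf_left c) w (cf_right c)
  | MoveL => Config q' (behead (cf_left c)) (head blank (cf_left c))
                    (w :: cf_right c)
  | MoveR => Config q' (w :: cf_left c) (head blank (cf_right c))
                    (behead (cf_right c))
  end.

Definition run (t : nat) (c : config) : config := iter t (step) c.

Definition init (w : seq nat) : config :=
  let s := map (fun n => inord n : S) w in
  Config ord0 [::] (head blank s) (behead s).

Fixpoint take_nonblank (s : seq S) : seq S :=
  match s with
  | [::] => [::]
  | x :: s' => if x == blank then [::] else x :: take_nonblank s'
  end.

Definition output (c : config) : seq S := take_nonblank (cf_head c :: cf_right c).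
End TMSem.

Definition tm_computable (f : nat -> nat) : Prop :=
  exists M : TM, forall n, exists t,
    halted M (run M t (init M (nseq n 2))) /\
    output M (run M t (init M (nseq n 2))) = nseq (f n) (inord 2).

Definition FPT_in_p (P : instance -> Prop) : Prop :=
  exists (f : nat -> nat) (c : nat) (M : TM),
    tm_computable f /\
    forall I, valid_instance I ->
      exists t, t <= f (inst_p I) * (size (enc_instance I)).+1 ^ c /\
        let cf := run M t (init M (enc_instance I)) in
        halted M cf /\ (cf_state M cf = tm_acc M <-> P I).

(* Main.v *)
(* Let S be a committee. If Z is a perfect one, the attribute vectors (extended
   by a coordinate 1) of the candidates in which S and Z differ, signed by
   insertion or removal, together with unit slack vectors accounting for the
   constraints violated by S, form a zero-sum family in {-1,0,1}^(p+1). Such a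
   family splits into zero-sum blocks whose size is bounded in terms of p: for
   one coordinate, a greedy reordering keeps the partial sums in a short window,
   so two of them soon coincide and delimit a block; then treat the blocks as
   new items for the next coordinate. A block that contains slack is a set of
   boundedly many flips of S which decreases the total violation. Since
   candidates with equal value vectors are interchangeable, the number of
   flip sequences to try is bounded in terms of p, and as the violation is
   polynomial in the input size, local search ends after polynomially many
   improvements at a perfect committee, if there is one.

   To run this on a Turing machine, all numbers are kept in unary and saturate
   at a cap W, which bounds the time of every fixed program by a polynomial in
   W. The machine first raises W from the input size by the number of flip
   sequences and then squares it, which makes room for all the numbers needed.
   The function f is computed by a machine that runs the same growth on p. *)
Require Import Defs.
From mathcomp Require Import all_boot all_order all_algebra.
From mathcomp Require Import zify.
Set Implicit Arguments. Unset Strict Implicit. Unset Printing Implicit Defensive.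
Import Order.TTheory GRing.Theory Num.Theory.

(** The question is an integer program with one variable per value vector, that is 2^p variables.
    Local search is used in place of an algorithm for integer programs of fixed dimension, because
    its steps need nothing but counting. Three obstacles shape the rest. One machine must serve all
    p, so neither the number of flips nor the number of sequences may be visible in its code: a flip
    sequence is a single number written with G digits in radix G, and p enters the running time only
    through the cap, while the exponent of the cap is fixed by the text of the program. The targets
    are binary fractions whose denominators may be exponential: a reduced denominator above n makes
    a target unreachable, so such a constraint counts as one constant unit of violation and is never
    evaluated. Finally, f itself must be computed by a machine, so it is chosen as an expression
    that the same growth routines can produce, rather than as the sharpest bound. *)

(** * Register programs on a single tape *)

Fixpoint pack (T : nat) (f : nat -> bool) : nat :=
  if T is T'.+1 then f 0 + (pack T' (fun t => f t.+1)).*2 else 0.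

Definition bitn (t x : nat) : bool := odd (iter t half x).

Lemma pack_ext T f g : (forall t, t < T -> f t = g t) -> pack T f = pack T g.
Proof.
elim: T f g => //= T IH f g fg; rewrite fg //; congr (_ + _.*2).
by apply: IH => t tT; apply: fg.
Qed.

Lemma pack_lt T f : pack T f < 2 ^ T.
Proof.
elim: T f => //= T IH f; have := IH (fun t => f t.+1).
rewrite expnS; case: (f 0); lia.
Qed.

Lemma bitn_pack T f t : t < T -> bitn t (pack T f) = f t.
Proof.
elim: T f t => //= T IH f [|t] tT.
  by rewrite /bitn /= oddD odd_double addbF oddb.
rewrite /bitn iterSr half_bit_double.
exact: (IH (fun t => f t.+1)).
Qed.

Lemma pack0 T : pack T (fun=> false) = 0.
Proof. by elim: T => //= T ->. Qed.

Lemma bitn0 t : bitn t 0 = false.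
Proof. by rewrite /bitn; elim: t => // t IH; rewrite iterSr. Qed.

Definition put (T t : nat) (b : bool) (x : nat) : nat :=
  pack T (fun u => if u == t then b else bitn u x).

Lemma put_pack T t b f :
  put T t b (pack T f) = pack T (fun u => if u == t then b else f u).
Proof. by apply: pack_ext => u uT; rewrite bitn_pack. Qed.

(* A tape cell is read as a vector of bits, one per track. Tracks below [narr]
   are arrays: 0 and 1 hold the two bits of the input symbols, 2 the current
   committee and 3 a trial committee. Track narr + r carries a single mark,
   whose position is the value of register r. Register 0 is constantly 0 and
   marks the home cell; register 1 is the cap W. *)
Definition narr := 4.
Definition rtrk (r : nat) := narr + r.

Record store := Store { reg : nat -> nat; arr : nat -> nat -> bool }.

Definition trk (s : store) (t j : nat) : bool :=
  if t < narr then arr s t j else j == reg s (t - narr).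

Definition setr (s : store) (r v : nat) : store :=
  Store (fun x => if x == r then v else reg s x) (arr s).

Definition seta (s : store) (a x : nat) (b : bool) : store :=
  Store (reg s) (fun a' x' => if (a' == a) && (x' == x) then b else arr s a' x').

(* [ITest r t off] falls through if track [t] is set at the position of register
   [r] and otherwise jumps [off] ahead; [IInc r] does nothing if [r] is at the cap,
   unless [r] is the cap itself. *)
Inductive instr :=
| ITest of nat & nat & nat
| IWrite of nat & nat & bool
| IInc of nat
| IZero of nat
| IJmp of nat
| IBack of nat
| IHalt of bool.

Definition stq (pc ph : nat) : nat := 5 + (4 * pc + ph).

Section Machine.

Variable NR : nat.
Hypothesis NR2 : 2 <= NR.
Notation T := (narr + NR).
Notation home := (rtrk 0).
Notation cap := (rtrk 1).

Definition target_reg (i : instr) : nat :=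
  match i with IInc r | IZero r => r | _ => 0 end.

(* States 0-2 initialize the tape, 3 and 4 are the halting states, and
   [stq pc ph] executes instruction [pc]: in phase 0 the head goes right to the
   mark of the register, in phase 1 it returns to the home cell, phases 2 and 3
   set the new mark of an incremented or zeroed register. *)
Definition delta (code : seq instr) (q x : nat) : nat * nat * move :=
  match q with
  | 0 => (1, x, MoveL)
  | 1 => (2, pack T (fun t => (narr <= t) && (t != cap)), MoveR)
  | 2 => if x == 0 then (stq 0 1, pack T (pred1 cap), MoveS) else (2, x, MoveR)
  | 3 | 4 => (q, x, MoveS)
  | q'.+4.+1 =>
    let pc := q' %/ 4 in
    let i := nth (IJmp 0) code pc in
    match q' %% 4 with
    | 0 => match i with
      | ITest r t off =>
        if bitn (rtrk r) x then (stq (if bitn t x then pc.+1 else pc + off) 1, x, MoveS)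
        else (q, x, MoveR)
      | IWrite r a b =>
        if bitn (rtrk r) x then (stq pc.+1 1, put T a b x, MoveS)
        else (q, x, MoveR)
      | IInc r =>
        if bitn (rtrk r) x then
          if bitn cap x && (r != 1) then (stq pc.+1 1, x, MoveS)
          else (stq pc 2, put T (rtrk r) false x, MoveR)
        else (q, x, MoveR)
      | IZero r =>
        if bitn (rtrk r) x then (stq pc 3, put T (rtrk r) false x, MoveS)
        else (q, x, MoveR)
      | IJmp off => (stq (pc + off) 0, x, MoveS)
      | IBack off => (stq (pc - off) 0, x, MoveS)
      | IHalt b => (if b then 3 else 4, x, MoveR)
      end
    | 1 => if bitn home x then (stq pc 0, x, MoveS) else (q, x, MoveL)
    | 2 => (stq pc.+1 1, put T (rtrk (target_reg i)) true x, MoveS)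
    | _ => if bitn home x then (stq pc.+1 0, put T (rtrk (target_reg i)) true x, MoveS)
           else (q, x, MoveL)
    end
  end.

Lemma stqE pc ph : ph < 4 -> (4 * pc + ph) %/ 4 = pc /\ (4 * pc + ph) %% 4 = ph.
Proof. by move=> h; rewrite mulnC divnMDl // modnMDl divn_small // modn_small // addn0. Qed.

Definition nst (code : seq instr) := 4 * (size code) + 12.

Definition machine (code : seq instr) : TM :=
  @mkTM (nst code) (2 ^ T - 4)
    (fun q x => let: (q', w, m) := delta code q x in (inord q', inord w, m))
    (inord 3) (inord 4).

Lemma symE : (2 ^ T - 4).+4 = 2 ^ T.
Proof.
have : 2 ^ 2 <= 2 ^ T by rewrite leq_exp2l // /narr; lia.
rewrite -[2 ^ 2]/4; lia.
Qed.

Section Run.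

Variable code : seq instr.
Notation M := (machine code).

Definition upd (tp : nat -> nat) (pos x j : nat) : nat :=
  if j == pos then x else tp j.

(** Position 0 is the blank cell just left of the input. Nothing is said about cells further left:
    the head never enters them, which is why [rep_step] asks for a positive position when moving
    left. *)
Definition rep (q pos : nat) (tp : nat -> nat) (cf : config M) : Prop :=
  [/\ cf_state M cf = q :> nat,
      forall j, j < pos -> nth (blank M) (cf_left M cf) j = tp (pos - j.+1) :> nat,
      cf_head M cf = tp pos :> nat &
      forall j, nth (blank M) (cf_right M cf) j = tp (pos + j.+1) :> nat].

Lemma rep_ext q pos tp tp' cf : (forall j, tp j = tp' j) -> rep q pos tp cf -> rep q pos tp' cf.
Proof.
move=> E [h1 h2 h3 h4]; split=> // [j|//|j]; rewrite -?E //; first exact: h2.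
Qed.

Lemma rep_step q pos tp q' x' m cf :
  rep q pos tp cf -> q != 3 -> q != 4 -> delta code q (tp pos) = (q', x', m) ->
  q' < (nst code).+1 -> x' < 2 ^ T -> (m = MoveL -> 0 < pos) ->
  rep q' (match m with MoveL => pos.-1 | MoveR => pos.+1 | MoveS => pos end)
      (upd tp pos x') (step M cf).
Proof.
case=> h1 h2 h3 h4 q3 q4 dE q'n x'n mpos.
have nh : halted M cf = false.
  apply/negbTE; rewrite /halted negb_or /=; apply/andP; split.
    by apply/eqP => e; move: q3; rewrite -h1 e inordK //= /nst; lia.
  by apply/eqP => e; move: q4; rewrite -h1 e inordK //= /nst; lia.
rewrite /step nh /= h1 h3 dE.
have q'E : (inord q' : 'I_(nst code).+1) = q' :> nat by rewrite inordK.
have x'E : (inord x' : 'I_(2 ^ T - 4).+4) = x' :> nat by rewrite inordK // symE.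
have updN j : j != pos -> upd tp pos x' j = tp j by move=> /negbTE h; rewrite /upd h.
have updE : upd tp pos x' pos = x' by rewrite /upd eqxx.
case: m mpos {dE} => mpos /=; split => //=.
- move=> j jp; rewrite nth_behead h2; last by lia.
  by rewrite updN; [congr tp | ]; lia.
- by have p0 := mpos erefl; rewrite -nth0 h2 // subn1 updN //; lia.
- have p0 := mpos erefl; case=> [|j] /=.
    by rewrite x'E addn1 prednK.
  by rewrite h4 updN; [congr tp | ]; lia.
- case=> [|j] jp /=; first by rewrite x'E subn1.
  by rewrite h2 // updN ?subSS //; lia.
- by rewrite -nth0 h4 addn1 updN //; lia.
- by move=> j; rewrite nth_behead h4 updN; [congr tp | ]; lia.
- by move=> j jp; rewrite h2 // updN //; lia.
- by rewrite x'E.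
- by move=> j; rewrite h4 updN //; lia.
Qed.

Lemma run_add a b cf : run M (a + b) cf = run M b (run M a cf).
Proof. by rewrite /run addnC iterD. Qed.

Lemma runS a cf : run M a.+1 cf = run M a (step M cf).
Proof. exact: iterSr. Qed.

Lemma rep_id q pos tp x' cf : x' = tp pos -> rep q pos (upd tp pos x') cf -> rep q pos tp cf.
Proof. by move=> ->; apply: rep_ext => j; rewrite /upd; case: eqP => // ->. Qed.

Lemma sweepR q a b tp cf :
  rep q a tp cf -> q != 3 -> q != 4 -> q < (nst code).+1 -> (forall j, tp j < 2 ^ T) ->
  (forall j, a <= j < a + b -> delta code q (tp j) = (q, tp j, MoveR)) ->
  rep q (a + b) tp (run M b cf).
Proof.
move=> r0 q3 q4 qn tpn; elim: b => [|b IH] h; first by rewrite addn0.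
have r1 := IH (fun j hj => h j ltac:(lia)).
have := rep_step r1 q3 q4 (h (a + b) ltac:(lia)) qn (tpn _) ltac:(by []).
rewrite addnS; apply: rep_ext => j.
by rewrite /upd; case: eqP => // ->.
Qed.

Lemma sweepL q a b tp cf :
  rep q (a + b) tp cf -> q != 3 -> q != 4 -> q < (nst code).+1 -> (forall j, tp j < 2 ^ T) ->
  (forall j, a < j <= a + b -> delta code q (tp j) = (q, tp j, MoveL)) ->
  rep q a tp (run M b cf).
Proof.
move=> r0 q3 q4 qn tpn; elim: b cf r0 => [|b IH] cf r0 h; first by rewrite addn0 in r0.
have := rep_step r0 q3 q4 (h (a + b.+1) ltac:(lia)) qn (tpn _) ltac:(lia).
rewrite runS addnS => r1.
apply: IH => [|j hj]; last by apply: h; lia.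
by apply: rep_ext r1 => j; rewrite /upd; case: eqP => // ->.
Qed.

Definition tape (s : store) (j : nat) : nat := pack T (fun t => trk s t j).

Lemma tape_lt s j : tape s j < 2 ^ T. Proof. exact: pack_lt. Qed.

Lemma bitn_reg s r j : r < NR -> bitn (rtrk r) (tape s j) = (j == reg s r).
Proof.
move=> rN; rewrite bitn_pack /rtrk ?ltn_add2l // /trk ltnNge leq_addr /=.
by rewrite addKn.
Qed.

Lemma bitn_trk s t j : t < T -> bitn t (tape s j) = trk s t j.
Proof. by move=> tT; rewrite bitn_pack. Qed.

Definition at_home (pc : nat) (s : store) (cf : config M) := rep (stq pc 0) 0 (tape s) cf.

Lemma deltaq pc ph x : ph < 4 -> delta code (stq pc ph) x =
    let i := nth (IJmp 0) code pc in
    match ph with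
    | 0 => match i with
      | ITest r t off =>
        if bitn (rtrk r) x then (stq (if bitn t x then pc.+1 else pc + off) 1, x, MoveS)
        else (stq pc ph, x, MoveR)
      | IWrite r a b =>
        if bitn (rtrk r) x then (stq pc.+1 1, put T a b x, MoveS)
        else (stq pc ph, x, MoveR)
      | IInc r =>
        if bitn (rtrk r) x then
          if bitn cap x && (r != 1) then (stq pc.+1 1, x, MoveS)
          else (stq pc 2, put T (rtrk r) false x, MoveR)
        else (stq pc ph, x, MoveR)
      | IZero r =>
        if bitn (rtrk r) x then (stq pc 3, put T (rtrk r) false x, MoveS)
        else (stq pc ph, x, MoveR)
      | IJmp off => (stq (pc + off) 0, x, MoveS)
      | IBack off => (stq (pc - off) 0, x, MoveS)
      | IHalt b => (if b then 3 else 4, x, MoveR)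
      end
    | 1 => if bitn home x then (stq pc 0, x, MoveS) else (stq pc ph, x, MoveL)
    | 2 => (stq pc.+1 1, put T (rtrk (target_reg i)) true x, MoveS)
    | _ => if bitn home x then (stq pc.+1 0, put T (rtrk (target_reg i)) true x, MoveS)
           else (stq pc ph, x, MoveL)
    end.
Proof.
move=> hph; rewrite /stq; have [e1 e2] := stqE pc hph.
rewrite -[5 + _]/((4 * pc + ph).+4.+1) /delta e1 e2.
by case: ph hph e1 e2 => [|[|[|[|]]]].
Qed.

Lemma stq_lt pc ph : pc <= size code -> ph < 4 -> stq pc ph < (nst code).+1.
Proof. rewrite /stq /nst; lia. Qed.

Lemma stq34 pc ph : (stq pc ph != 3) * (stq pc ph != 4).
Proof. by split; rewrite /stq; lia. Qed.

Lemma go_home pc s pos cf : reg s 0 = 0 -> pc <= size code ->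
  rep (stq pc 1) pos (tape s) cf -> at_home pc s (run M (pos + 1) cf).
Proof.
move=> s0 pcn r0; rewrite run_add.
have NR0 : 0 < NR by lia.
have r1 : rep (stq pc 1) 0 (tape s) (run M pos cf).
  apply: (sweepL _ (stq34 _ _).1 (stq34 _ _).2 (stq_lt _ _) (tape_lt s)) => // j jp.
  by rewrite deltaq //= bitn_reg // s0 (_ : (j == 0) = false) //; lia.
have := rep_step r1 (stq34 _ _).1 (stq34 _ _).2; rewrite deltaq //= bitn_reg // s0 /=.
move=> /(_ _ _ _ erefl); rewrite stq_lt // tape_lt => /(_ isT isT) h.
by apply: rep_id (h _).
Qed.

Lemma go_reg pc s r cf : r < NR -> pc < size code ->
  (forall x, bitn (rtrk r) x = false -> delta code (stq pc 0) x = (stq pc 0, x, MoveR)) ->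
  at_home pc s cf -> rep (stq pc 0) (reg s r) (tape s) (run M (reg s r) cf).
Proof.
move=> rN pcn h r0.
apply: (sweepR r0 (stq34 _ _).1 (stq34 _ _).2 (stq_lt (ltnW pcn) _) (tape_lt s)) => // j jp.
by rewrite h // bitn_reg //; lia.
Qed.

Definition reach (pc : nat) (s : store) (pc' : nat) (s' : store) (t : nat) : Prop :=
  forall cf, at_home pc s cf -> at_home pc' s' (run M t cf).

Lemma reach_trans pc1 pc2 pc3 s1 s2 s3 t1 t2 :
  reach pc1 s1 pc2 s2 t1 -> reach pc2 s2 pc3 s3 t2 -> reach pc1 s1 pc3 s3 (t1 + t2).
Proof. by move=> h1 h2 cf c; rewrite run_add; apply/h2/h1. Qed.

Lemma reach_test pc s r t off pc' :
  nth (IJmp 0) code pc = ITest r t off -> pc < size code -> r < NR -> t < T -> reg s 0 = 0 ->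
  pc' = (if trk s t (reg s r) then pc.+1 else pc + off) -> pc' <= size code ->
  reach pc s pc' s (reg s r + 1 + (reg s r + 1)).
Proof.
move=> iE pcn rN tT s0 pc'E pc'n cf c; rewrite -addnA !run_add -run_add.
have {c} := go_reg rN pcn _ c.
move=> /(_ ltac:(by move=> x xr; rewrite deltaq //= iE xr)) r1.
have := rep_step r1 (stq34 _ _).1 (stq34 _ _).2; rewrite deltaq //= iE bitn_reg // eqxx bitn_trk // -pc'E.
move=> /(_ _ _ _ erefl); rewrite stq_lt // tape_lt => /(_ isT isT) h.
by apply: go_home => //; apply: rep_id (h _).
Qed.

Lemma tape_seta s a x b j : a < narr ->
  upd (tape s) x (put T a b (tape s x)) j = tape (seta s a x b) j.
Proof.
move=> an; rewrite /upd; case: eqP => [->|/eqP /negbTE jx].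
  rewrite put_pack; apply: pack_ext => t tT; rewrite /trk /seta /= eqxx andbT.
  by case: (t =P a) => [->|//]; rewrite an.
by apply: pack_ext => t tT; rewrite /trk /seta /= jx andbF.
Qed.

Lemma tape_setr s r v j :
  let tp := upd (tape s) (reg s r) (put T (rtrk r) false (tape s (reg s r))) in
  upd tp v (put T (rtrk r) true (tp v)) j = tape (setr s r v) j.
Proof.
have rtE t : (t == rtrk r) = ~~ (t < narr) && (t - narr == r).
  by rewrite /rtrk; case: ltnP => /= h; lia.
have tpE i : upd (tape s) (reg s r) (put T (rtrk r) false (tape s (reg s r))) i =
    pack T (fun t => if t == rtrk r then false else trk s t i).
  rewrite /upd; case: eqP => [->|/eqP ir]; first exact: put_pack.
  apply: pack_ext => t tT; case: eqP => // ->.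
  by rewrite /trk /rtrk ltnNge leq_addr /= addKn (negbTE ir).
rewrite /= [LHS]/upd; case: eqP => [->|/eqP jv].
  rewrite tpE put_pack; apply: pack_ext => t tT; rewrite rtE /trk /setr /=.
  by case: ltnP => //= _; case: (_ == r); rewrite ?eqxx.
rewrite tpE; apply: pack_ext => t tT; rewrite rtE /trk /setr /=.
by case: ltnP => //= _; case: (_ == r); rewrite ?(negbTE jv).
Qed.

Lemma reach_write pc s r a b :
  nth (IJmp 0) code pc = IWrite r a b -> pc < size code -> r < NR -> a < narr -> reg s 0 = 0 ->
  reach pc s pc.+1 (seta s a (reg s r) b) (reg s r + 1 + (reg s r + 1)).
Proof.
move=> iE pcn rN an s0 cf c; rewrite -addnA !run_add -run_add.
have {c} := go_reg rN pcn _ c.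
move=> /(_ ltac:(by move=> x xr; rewrite deltaq //= iE xr)) r1.
have := rep_step r1 (stq34 _ _).1 (stq34 _ _).2; rewrite deltaq //= iE bitn_reg // eqxx.
move=> /(_ _ _ _ erefl); rewrite stq_lt // pack_lt => /(_ isT isT) h.
by apply: go_home => //; apply: rep_ext (h _) => // j; apply: tape_seta.
Qed.

Lemma reach_inc_sat pc s r :
  nth (IJmp 0) code pc = IInc r -> pc < size code -> r < NR -> reg s 0 = 0 ->
  r != 1 -> reg s r == reg s 1 ->
  reach pc s pc.+1 s (reg s r + 1 + (reg s r + 1)).
Proof.
move=> iE pcn rN s0 r1' rc cf c; rewrite -addnA !run_add -run_add.
have {c} := go_reg rN pcn _ c.
move=> /(_ ltac:(by move=> x xr; rewrite deltaq //= iE xr)) r1.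
have := rep_step r1 (stq34 _ _).1 (stq34 _ _).2.
rewrite deltaq //= iE !bitn_reg // eqxx r1' rc /=.
move=> /(_ _ _ _ erefl); rewrite stq_lt // pack_lt => /(_ isT isT) h.
by apply: go_home => //; apply: rep_id (h _).
Qed.

Lemma reach_inc pc s r :
  nth (IJmp 0) code pc = IInc r -> pc < size code -> 0 < r < NR -> reg s 0 = 0 ->
  (r == 1) || (reg s r != reg s 1) ->
  reach pc s pc.+1 (setr s r (reg s r).+1) (reg s r + 1 + (1 + ((reg s r).+1 + 1))).
Proof.
move=> iE pcn /andP[r0 rN] s0 rc cf c; rewrite -addnA 3!run_add.
have {c} := go_reg rN pcn _ c.
move=> /(_ ltac:(by move=> x xr; rewrite deltaq //= iE xr)) r1.
have := rep_step r1 (stq34 _ _).1 (stq34 _ _).2.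
rewrite deltaq //= iE !bitn_reg // eqxx.
have -> : (reg s r == reg s 1) && (r != 1) = false.
  by case/orP: rc => [/eqP ->|/negbTE ->]; rewrite ?andbF.
move=> /(_ _ _ _ erefl); rewrite (stq_lt (ltnW pcn)) ?pack_lt // => /(_ isT isT) h.
have {h} r2 := h ltac:(by []).
have := rep_step r2 (stq34 _ _).1 (stq34 _ _).2; rewrite deltaq //= iE.
move=> /(_ _ _ _ erefl); rewrite stq_lt ?pack_lt // => /(_ isT isT) h.
have {h} r3 := h ltac:(by []).
apply: (@go_home _ _ (reg s r).+1) => //; first by rewrite /setr /=; case: eqP r0 => // <-.
by apply: rep_ext r3 => j; apply: tape_setr.
Qed.

(** The old mark is erased before the return sweep. Since [r] is not register 0, the home track
    stays intact, so the head still recognizes cell 0 and sets the new mark there. *)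
Lemma reach_zero pc s r :
  nth (IJmp 0) code pc = IZero r -> pc < size code -> 0 < r < NR -> reg s 0 = 0 ->
  reach pc s pc.+1 (setr s r 0) (reg s r + 1 + (reg s r + 1)).
Proof.
move=> iE pcn /andP[r0 rN] s0 cf c; rewrite -addnA 3!run_add.
have NR0 : 0 < NR by lia.
have {c} := go_reg rN pcn _ c.
move=> /(_ ltac:(by move=> x xr; rewrite deltaq //= iE xr)) r1.
have := rep_step r1 (stq34 _ _).1 (stq34 _ _).2.
rewrite deltaq //= iE !bitn_reg // eqxx.
move=> /(_ _ _ _ erefl); rewrite (stq_lt (ltnW pcn)) ?pack_lt // => /(_ isT isT) h.
have {h} r2 := h ltac:(by []).
set tp := upd _ _ _ in r2.
have tpn j : tp j < 2 ^ T by rewrite /tp /upd; case: eqP => _; rewrite ?pack_lt ?tape_lt.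
have bh j : bitn home (tp j) = (j == 0).
  rewrite /tp /upd; case: eqP => [->|_]; last by rewrite bitn_reg // s0.
  rewrite put_pack bitn_pack; last by rewrite /rtrk; lia.
  rewrite (_ : (home == _) = false); last by rewrite /rtrk; lia.
  by rewrite /trk /rtrk /= s0.
have r3 : rep (stq pc 3) 0 tp (run M (reg s r) (run M 1 (run M (reg s r) cf))).
  apply: (sweepL _ (stq34 _ _).1 (stq34 _ _).2 (stq_lt _ _) tpn) => // [|j jp]; first exact: ltnW.
  by rewrite deltaq //= bh (_ : (j == 0) = false) //; lia.
have := rep_step r3 (stq34 _ _).1 (stq34 _ _).2; rewrite deltaq //= iE bh /=.
move=> /(_ _ _ _ erefl); rewrite stq_lt ?pack_lt // => /(_ isT isT) h.
by apply: rep_ext (h _) => // j; apply: tape_setr.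
Qed.

Lemma reach_jmp pc s off :
  nth (IJmp 0) code pc = IJmp off -> pc < size code -> pc + off <= size code ->
  reach pc s (pc + off) s 1.
Proof.
move=> iE pcn pcn' cf c.
have := rep_step c (stq34 _ _).1 (stq34 _ _).2; rewrite deltaq //= iE.
move=> /(_ _ _ _ erefl); rewrite stq_lt ?pack_lt // => /(_ isT isT) h.
by apply: rep_id (h _).
Qed.

Lemma reach_back pc s off :
  nth (IJmp 0) code pc = IBack off -> pc < size code -> reach pc s (pc - off) s 1.
Proof.
move=> iE pcn cf c.
have := rep_step c (stq34 _ _).1 (stq34 _ _).2; rewrite deltaq //= iE.
have pcn' : pc - off <= size code by lia.
move=> /(_ _ _ _ erefl); rewrite stq_lt ?pack_lt // => /(_ isT isT) h.
by apply: rep_id (h _).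
Qed.

(** The halting step moves right so that the head ends on cell 1: [output] reads from the head, and
    the home cell, which carries register marks, must not belong to the result. *)
Lemma reach_halt pc s b cf :
  nth (IJmp 0) code pc = IHalt b -> pc < size code -> at_home pc s cf ->
  rep (if b then 3 else 4) 1 (tape s) (step M cf).
Proof.
move=> iE pcn c.
have := rep_step c (stq34 _ _).1 (stq34 _ _).2; rewrite deltaq //= iE.
move=> /(_ _ _ _ erefl); rewrite pack_lt (_ : (_ < _) = true); last by case: b {iE}; rewrite /nst; lia.
move=> /(_ isT isT ltac:(by [])); apply: rep_ext => j.
by rewrite /upd; case: eqP => // ->.
Qed.

(** Input symbols sit one cell further right than their index because of the home cell. The cap
    marks the first blank after the input, which state 2 can detect because input symbols are
    nonzero. *)
Definition init_store (w : seq nat) : store :=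
  Store (fun r => if r == 1 then (size w).+1 else 0)
    (fun a j => if a < 2 then (0 < j) && bitn a (nth 0 w j.-1) else false).

Lemma pack_input x : x < 4 -> pack T (fun t => (t < 2) && bitn t x) = x.
Proof.
have pk T' f : pack (2 + T') f = f 0 + (f 1 + (pack T' (fun t => f t.+2)).*2).*2 by [].
rewrite (_ : T = 2 + (2 + NR)) // pk pack0 /bitn /=.
by case: x => [|[|[|[|]]]].
Qed.

Lemma reach_init w : all (fun x => 0 < x < 4) w ->
  at_home 0 (init_store w) (run M (2 + (size w + 1 + ((size w).+1 + 1))) (init M w)).
Proof.
move=> /allP wP; rewrite 2!run_add [run M (size w + 1) _]run_add.
have T4 : 4 <= 2 ^ T by rewrite -symE.
have wlt j : nth 0 w j < 4.
  case: (ltnP j (size w)) => jw; last by rewrite nth_default.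
  by have /andP[] := wP _ (mem_nth 0 jw).
have nE j : nth (blank M) [seq inord n | n <- w] j = nth 0 w j :> nat.
  case: (ltnP j (size w)) => jw; last by rewrite !nth_default ?size_map.
  by rewrite (nth_map 0) // inordK // symE (leq_trans (wlt j)).
set tp0 := fun j => if j is j'.+1 then nth 0 w j' else 0.
have tp0n j : tp0 j < 2 ^ T.
  by case: j => [|j] /=; [lia | rewrite (leq_trans (wlt j))].
have s1 : run M 1 (init M w) = Config M (inord 1) [::] (blank M)
    (head (blank M) [seq inord n | n <- w] :: behead [seq inord n | n <- w]).
  rewrite /run /= /step /halted /init /=.
  have inj a b : a < 5 -> b < 5 -> (inord a == inord b :> 'I_(nst code).+1) = (a == b).
    by move=> a5 b5; rewrite -val_eqE /= !inordK //; rewrite /nst; lia.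
  have z : (ord0 : 'I_(nst code).+1) = inord 0 by apply: val_inj; rewrite /= inordK.
  by rewrite z !inj //= inord_val.
have r1 : rep 1 0 tp0 (run M 1 (init M w)).
  rewrite s1; split => //=; first by rewrite inordK //= /nst; lia.
  by case=> [|j] /=; rewrite ?nth_behead -?nth0 nE.
have n2 : 2 < (nst code).+1 by rewrite /nst; lia.
have := rep_step r1 isT isT erefl; rewrite pack_lt n2.
move=> /(_ isT isT ltac:(by [])); rewrite -[step _ _]/(run M 2 (init M w)).
set tp1 := upd _ _ _ => r2.
have tp1n j : tp1 j < 2 ^ T by rewrite /tp1 /upd; case: eqP => _ //; apply: pack_lt.
have r3 : rep 2 (1 + size w) tp1 (run M (size w) (run M 2 (init M w))).
  apply: (sweepR r2 isT isT n2 tp1n) => j /andP[j1 j2]; rewrite /delta /tp1 /upd (_ : (j == 0) = false); last lia.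
  have jw : j.-1 < size w by lia.
  have := wP _ (mem_nth 0 jw); rewrite -[in tp0 _](prednK j1) /=.
  by case: (nth 0 w j.-1).
have tpe : tp1 (1 + size w) = 0 by rewrite /tp1 /upd /= nth_default.
have dE : delta code 2 (tp1 (1 + size w)) = (stq 0 1, pack T (pred1 cap), MoveS) by rewrite tpe.
have := rep_step r3 isT isT dE.
rewrite stq_lt // pack_lt => /(_ isT isT ltac:(by [])) r4.
apply: (@go_home _ _ (size w).+1) => //; apply: rep_ext r4 => j.
have regE t : narr <= t -> (t - narr == 1) = (t == cap).
  by rewrite /rtrk => nt; rewrite -(eqn_add2l narr) subnKC.
rewrite /upd add1n; case: (j =P (size w).+1) => [->|/eqP jw].
  apply: pack_ext => t tT; rewrite /trk /=; case: ltnP => nt.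
    by rewrite nth_default // bitn0 if_same; apply: negbTE; move: nt; rewrite /rtrk /narr; lia.
  by rewrite regE //; case: eqP; rewrite ?eqxx.
rewrite /tp1 /upd; case: (j =P 0) => [->|/eqP j0].
  apply: pack_ext => t tT; rewrite /trk /=; case: ltnP => nt; first by rewrite if_same.
  by rewrite regE //; case: eqP.
rewrite -(prednK (n := j)) ?lt0n //= -[LHS]pack_input //.
apply: pack_ext => t tT; rewrite /trk /=; case: (ltnP t narr) => nt; first by case: (t < 2).
rewrite (_ : t < 2 = false); last by move: nt; rewrite /narr; lia.
by rewrite regE //; case: ifP => _; move: jw j0; lia.
Qed.

End Run.
End Machine.

(** * Relocatable code fragments and their running times *)

(** The base is at least 2, so the product of the powers with one more factor dominates their sum.
    The cost of consecutive fragments thus remains a single power, whose exponent depends on the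
    code only. *)
Lemma pow_add w a b : (w + 2) ^ a + (w + 2) ^ b <= (w + 2) ^ (a + b).+1.
Proof.
have h n : 0 < (w + 2) ^ n by rewrite expn_gt0 addn2.
rewrite expnS expnD; have := h a; have := h b.
by case: ((w + 2) ^ a) => // x; case: ((w + 2) ^ b) => // y; nia.
Qed.

Lemma pow_mono w w' a a' : w <= w' -> a <= a' -> (w + 2) ^ a <= (w' + 2) ^ a'.
Proof.
move=> ww aa; apply: leq_trans (_ : (w + 2) ^ a' <= _).
  by apply: leq_pexp2l; rewrite ?addn2.
by case: a' {aa} => // a'; rewrite leq_exp2r // leq_add2r.
Qed.

Lemma lin_pow3 w t : 0 < w -> t <= 2 * w + 5 -> t <= (w + 2) ^ 3.
Proof.
move=> w0 h; apply: leq_trans h _; rewrite expnSr.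
have : 3 ^ 2 <= (w + 2) ^ 2 by rewrite leq_exp2r //; lia.
rewrite -[3 ^ 2]/9; case: ((w + 2) ^ 2) => // x; nia.
Qed.

Section Segments.

Variable NR : nat.
Hypothesis NR2 : 2 <= NR.
Notation T := (narr + NR).

(** Jumps are relative, so a fragment behaves the same wherever it is placed; quantifying over the
    surrounding code is what makes fragments composable. *)
Definition seg (c : seq instr) (s s' : store) (t : nat) : Prop :=
  forall pre post, reach NR (pre ++ c ++ post) (size pre) s (size pre + size c) s' t.

Definition ok (s : store) : Prop :=
  [/\ reg s 0 = 0, 0 < reg s 1 & forall r, r < NR -> reg s r <= reg s 1].

Lemma seg_nil s : seg [::] s s 0.
Proof. by move=> pre post cf; rewrite addn0. Qed.

Lemma seg_cat c1 c2 s1 s2 s3 t1 t2 :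
  seg c1 s1 s2 t1 -> seg c2 s2 s3 t2 -> seg (c1 ++ c2) s1 s3 (t1 + t2).
Proof.
move=> h1 h2 pre post; apply: (@reach_trans _ _ _ (size pre + size c1) _ _ s2).
  by rewrite -catA; apply: h1.
by have := h2 (pre ++ c1) post; rewrite !size_cat !catA addnA.
Qed.

Lemma nth_mid pre (i : instr) c : nth (IJmp 0) (pre ++ i :: c) (size pre) = i.
Proof. by rewrite nth_cat ltnn subnn. Qed.

Lemma lt_mid pre (i : instr) c : size pre < size (pre ++ i :: c).
Proof. by rewrite size_cat /=; lia. Qed.

(* Time bounds are powers of W + 2, where W is the cap after the run. *)
Definition segt (c : seq instr) (s s' : store) (E : nat) : Prop :=
  reg s 1 <= reg s' 1 /\ exists2 t, seg c s s' t & t <= (reg s' 1 + 2) ^ E.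

Lemma segt_cat c1 c2 s1 s2 s3 E1 E2 :
  segt c1 s1 s2 E1 -> segt c2 s2 s3 E2 -> segt (c1 ++ c2) s1 s3 (E1 + E2).+1.
Proof.
move=> [w1 [t1 g1 b1]] [w2 [t2 g2 b2]]; split; first exact: leq_trans w2.
exists (t1 + t2); first exact: seg_cat g1 g2.
apply: leq_trans (pow_add _ _ _); apply: leq_add => //.
by apply: leq_trans b1 _; apply: pow_mono.
Qed.

Lemma segt_mono c s s' E E' : E <= E' -> segt c s s' E -> segt c s s' E'.
Proof.
move=> EE [w [t g b]]; split=> //; exists t => //.
by apply: leq_trans b _; apply: pow_mono.
Qed.

Lemma segt_write r a b s : ok s -> r < NR -> a < narr ->
  segt [:: IWrite r a b] s (seta s a (reg s r) b) 3.
Proof.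
move=> [s0 s1 sW] rN an; split=> //; eexists.
  move=> pre post; rewrite addn1.
  by apply: reach_write => //=; rewrite ?nth_mid ?lt_mid.
by apply: lin_pow3 => //=; have := sW r rN; lia.
Qed.

Lemma segt_zero r s : ok s -> 1 < r < NR ->
  segt [:: IZero r] s (setr s r 0) 3.
Proof.
move=> [s0 s1 sW] /andP[r1 rN]; split; first by rewrite /setr /=; case: eqP => // e; lia.
eexists.
  move=> pre post; rewrite addn1.
  by apply: reach_zero => //=; rewrite ?nth_mid ?lt_mid //; lia.
rewrite /setr /= (_ : (1 == r) = false); last lia.
by apply: lin_pow3 => //=; have := sW r rN; lia.
Qed.

Definition incr (s : store) (r : nat) : store :=
  if reg s r == reg s 1 then s else setr s r (reg s r).+1.

Lemma segt_inc r s : ok s -> 1 < r < NR -> segt [:: IInc r] s (incr s r) 3.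
Proof.
move=> [s0 s1 sW] /andP[r1 rN].
have w1 : reg (incr s r) 1 = reg s 1.
  by rewrite /incr /setr; case: ifP => //= _; case: eqP => // e; lia.
rewrite /segt w1; split=> //.
have rW := sW r rN; rewrite /incr; case: eqP => [/eqP e|/eqP ne]; eexists.
- move=> pre post; rewrite addn1.
  by apply: (@reach_inc_sat _ _ _ _ s r) => //=; rewrite ?nth_mid ?lt_mid //; lia.
- by apply: lin_pow3 => //; lia.
- move=> pre post; rewrite addn1.
  by apply: reach_inc => //=; rewrite ?nth_mid ?lt_mid ?ne ?orbT //; lia.
- by apply: lin_pow3 => //; lia.
Qed.

Lemma segt_grow s : ok s -> segt [:: IInc 1] s (setr s 1 (reg s 1).+1) 3.
Proof.
move=> [s0 s1 sW]; split; first by rewrite /setr /=; lia.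
eexists.
  move=> pre post; rewrite addn1.
  by apply: reach_inc => //=; rewrite ?nth_mid ?lt_mid //; lia.
by apply: lin_pow3; rewrite /setr /=; lia.
Qed.

Definition ite (r t : nat) (c1 c2 : seq instr) : seq instr :=
  ITest r t (size c1 + 2) :: c1 ++ IJmp (size c2).+1 :: c2.

Lemma segt_ite r t c1 c2 s s' E : ok s -> r < NR -> t < T ->
  segt (if trk s t (reg s r) then c1 else c2) s s' E ->
  segt (ite r t c1 c2) s s' (E + 4).
Proof.
move=> [s0 s1 sW] rN tT h.
have [w [t' g b]] := h; split=> //.
exists (reg s r + 1 + (reg s r + 1) + (t' + (trk s t (reg s r) : nat))); last first.
  apply: leq_trans (_ : (reg s' 1 + 2) ^ 3 + (reg s' 1 + 2) ^ E <= _); last first.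
    by apply: leq_trans (pow_add _ _ _) _; apply: pow_mono; lia.
  have : reg s r + 1 + (reg s r + 1) + (trk s t (reg s r) : nat) <= (reg s' 1 + 2) ^ 3.
    by apply: lin_pow3; [lia | have := sW r rN; case: (trk _ _ _) => /=; lia].
  by move: b; set X := _ ^ E; set Y := _ ^ 3; lia.
move=> pre post; have e : pre ++ ite r t c1 c2 ++ post =
    (pre ++ ITest r t (size c1 + 2) :: c1) ++ IJmp (size c2).+1 :: (c2 ++ post).
  by rewrite /ite -!catA /= -!catA /=.
have e2 : pre ++ ite r t c1 c2 ++ post =
    (pre ++ ITest r t (size c1 + 2) :: c1 ++ [:: IJmp (size c2).+1]) ++ (c2 ++ post).
  by rewrite /ite -!catA /= -!catA /=.
have sz : size (ite r t c1 c2) = size c1 + size c2 + 2 by rewrite /ite /= size_cat /=; lia.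
have tst := @reach_test NR NR2 (pre ++ ite r t c1 c2 ++ post) (size pre) s r t (size c1 + 2)
  (if trk s t (reg s r) then (size pre).+1 else size pre + (size c1 + 2)) _ _ rN tT s0 erefl _.
apply: reach_trans (tst _ _ _) _ => //.
- by rewrite /ite nth_mid.
- by rewrite /ite lt_mid.
- by rewrite !size_cat sz; case: ifP; lia.
case: (trk s t (reg s r)) g => g.
- apply: (@reach_trans _ _ _ ((size pre).+1 + size c1) _ _ s').
    have := g (rcons pre (ITest r t (size c1 + 2))) (IJmp (size c2).+1 :: c2 ++ post).
    by rewrite size_rcons cat_rcons e -catA.
  have sp : size (pre ++ ITest r t (size c1 + 2) :: c1) = (size pre).+1 + size c1.
    by rewrite size_cat /=; lia.
  rewrite e -sp (_ : size pre + _ = size (pre ++ ITest r t (size c1 + 2) :: c1) + (size c2).+1).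
    by apply: reach_jmp; rewrite ?nth_mid ?lt_mid // !size_cat /= !size_cat /=; lia.
  by rewrite sp sz; lia.
rewrite addn0 e2 (_ : size pre + size (ite r t c1 c2) = size pre + (size c1 + 2) + size c2); last first.
  by rewrite sz; lia.
have := g (pre ++ ITest r t (size c1 + 2) :: c1 ++ [:: IJmp (size c2).+1]) post.
by rewrite size_cat /= size_cat /= addn1 addn2.
Qed.

(* The loop runs as long as registers [i] and [r] differ. *)
Definition while (i r : nat) (body : seq instr) : seq instr :=
  ITest i (rtrk r) 2 :: IJmp (size body + 2) :: body ++ [:: IBack (size body + 2)].

Lemma size_while i r body : size (while i r body) = size body + 3.
Proof. by rewrite /= size_cat /=; lia. Qed.

Lemma trk_reg s r j : trk s (rtrk r) j = (j == reg s r).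
Proof. by rewrite /trk /rtrk ltnNge leq_addr /= addKn. Qed.

Lemma while_test i r body pre post s : ok s -> i < NR -> r < NR ->
  reach NR (pre ++ while i r body ++ post) (size pre) s
    (if reg s i == reg s r then (size pre).+1 else size pre + 2) s (2 * reg s i + 2).
Proof.
move=> [s0 s1 sW] iN rN; rewrite (_ : 2 * _ + 2 = reg s i + 1 + (reg s i + 1)); last lia.
apply: (@reach_test _ NR2 _ _ _ _ (rtrk r) 2); rewrite ?nth_mid ?lt_mid ?trk_reg //.
by rewrite !size_cat size_while; case: ifP; lia.
Qed.

Lemma seg_while_exit i r body s : ok s -> i < NR -> r < NR -> reg s i = reg s r ->
  seg (while i r body) s s (2 * reg s i + 2 + 1).
Proof.
move=> sok iN rN e pre post.
have := @while_test i r body pre post s sok iN rN; rewrite e eqxx => tst.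
apply: reach_trans tst _; rewrite size_while.
rewrite (_ : size pre + _ = (size pre).+1 + (size body + 2)); last lia.
have e' : pre ++ while i r body ++ post = (rcons pre (ITest i (rtrk r) 2)) ++
    IJmp (size body + 2) :: (body ++ [:: IBack (size body + 2)]) ++ post.
  by rewrite cat_rcons.
rewrite e' -(size_rcons pre (ITest i (rtrk r) 2)).
by apply: reach_jmp; rewrite ?nth_mid ?lt_mid // !size_cat /= !size_cat /=; lia.
Qed.

Lemma seg_while_step i r body s s1 s2 t1 t2 : ok s -> i < NR -> r < NR -> reg s i <> reg s r ->
  seg body s s1 t1 -> seg (while i r body) s1 s2 t2 ->
  seg (while i r body) s s2 (2 * reg s i + 2 + (t1 + (1 + t2))).
Proof.
move=> sok iN rN /eqP/negbTE e h1 h2 pre post.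
have := @while_test i r body pre post s sok iN rN; rewrite e => tst.
apply: reach_trans tst _; apply: (@reach_trans _ _ _ (size pre + 2 + size body) _ _ s1).
  have := h1 (pre ++ [:: ITest i (rtrk r) 2; IJmp (size body + 2)]) (IBack (size body + 2) :: post).
  by rewrite size_cat /while -?catA /= -?catA /=.
apply: reach_trans (h2 _ _).
have e' : pre ++ while i r body ++ post =
    (pre ++ ITest i (rtrk r) 2 :: IJmp (size body + 2) :: body) ++ IBack (size body + 2) :: post.
  by rewrite /while -!catA /= -!catA.
have sp : size (pre ++ ITest i (rtrk r) 2 :: IJmp (size body + 2) :: body) = size pre + 2 + size body.
  by rewrite size_cat /=; lia.
have := @reach_back NR NR2 (pre ++ while i r body ++ post) (size pre + 2 + size body) s1 (size body + 2).
rewrite (_ : _ - _ = size pre); last by lia.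
by apply; rewrite e' -sp ?nth_mid ?lt_mid.
Qed.

(** The number of rounds is the value of a register, hence at most the cap. The cap may grow inside
    the loop, so every round is charged with the cap at the end: body and test cost one power of
    exponent E + 4, and the number of rounds contributes one more factor. *)
Lemma segt_while i r body n E (P : nat -> store -> Prop) :
  i < NR -> r < NR ->
  (forall j s, P j s -> [/\ ok s, reg s i = j & reg s r = n]) ->
  (forall j s, j < n -> P j s -> exists2 s', segt body s s' E & P j.+1 s') ->
  forall s, P 0 s -> exists2 s', segt (while i r body) s s' (E + 5) & P n s'.
Proof.
move=> iN rN Pok step s P0.
suff h k : forall j s, j + k = n -> P j s -> exists2 s', (reg s 1 <= reg s' 1 /\ 
    exists2 t, seg (while i r body) s s' t &
     t <= (k + 1) * ((reg s' 1 + 2) ^ E + (reg s' 1 + 2) ^ 3)) & P n s'.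
  have [s' [w [t g b]] Pn] := h n 0 s erefl P0; exists s' => //; split=> //; exists t => //.
  have [[s0 s1 sW] _ sr] := Pok _ _ Pn.
  have nw : n <= reg s' 1 by rewrite -sr; apply: sW.
  apply: leq_trans b _; rewrite (_ : E + 5 = (E + 3).+2); last lia.
  rewrite expnS.
  apply: leq_mul; first by lia.
  exact: pow_add.
elim: k => [|k IH] j {P0} {}s jk Pj; have [sok si sr] := Pok _ _ Pj; have [s0 s1 sW] := sok.
  have jn : j = n by lia.
  exists s; last by rewrite -jn.
  split=> //; exists (2 * reg s i + 2 + 1); first by apply: seg_while_exit; rewrite // si sr.
  rewrite mul1n; apply: leq_trans (leq_addl _ _); apply: lin_pow3 => //.
  by have := sW i iN; lia.
have [s2 [w1 [t1 g1 b1]] P1] := step j s ltac:(lia) Pj.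
have [s3 [w2 [t2 g2 b2]] Pn] := IH j.+1 s2 ltac:(lia) P1.
exists s3 => //; split; first exact: leq_trans w2.
exists (2 * reg s i + 2 + (t1 + (1 + t2))); first by apply: (seg_while_step _ _ _ _ g1 g2); rewrite // si sr; lia.
have b1' : t1 <= (reg s3 1 + 2) ^ E by apply: leq_trans b1 _; apply: pow_mono.
have b3 : 2 * reg s i + 3 <= (reg s3 1 + 2) ^ 3 by apply: lin_pow3; have := sW i iN; lia.
move: b1' b2 b3; set X := _ ^ E; set Y := _ ^ 3; nia.
Qed.

Definition copy (x y : nat) : seq instr := IZero x :: while x y [:: IInc x].

Lemma ok_setr s r v : ok s -> 1 < r -> v <= reg s 1 -> ok (setr s r v).
Proof.
move=> [s0 s1 sW] r1 vW; rewrite /ok /setr /=.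
rewrite (_ : (0 == r) = false); last lia; rewrite (_ : (1 == r) = false); last lia.
by split=> // r' r'N; case: eqP => // _; apply: sW.
Qed.

Lemma segt_copy x y s : ok s -> 1 < x < NR -> y < NR -> x != y ->
  exists2 s', segt (copy x y) s s' 12 &
    [/\ arr s' = arr s, forall r, r != x -> reg s' r = reg s r, reg s' x = reg s y & ok s'].
Proof.
move=> sok /andP[x1 xN] yN xy.
have [s0 s1 sW] := sok; have yW := sW y yN.
pose P j s' := [/\ arr s' = arr s, forall r, r != x -> reg s' r = reg s r, reg s' x = j & ok s'] /\ j <= reg s y.
have [| | |s' h1 [h2 _]] := @segt_while x y [:: IInc x] (reg s y) 3 P xN yN _ _ (setr s x 0).
- by move=> j s' [[_ h <- ?] _]; split=> //; rewrite h // eq_sym.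
- move=> j s' jn [[h1 h2 h3 h4] h5]; exists (incr s' x); first by apply: segt_inc => //; apply/andP.
  have x1' : 1 != x by lia.
  rewrite /incr h3 h2 // (_ : (j == _) = false); last lia.
  split=> //; split=> //=; last by apply: ok_setr => //; rewrite h2 //; lia.
  - by move=> r rx; rewrite (negbTE rx) h2.
  - by rewrite eqxx.
- split=> //; split=> //=; last by apply: ok_setr.
  - by move=> r rx; rewrite (negbTE rx).
  - by rewrite eqxx.
exists s' => //; rewrite /copy -cat1s; apply: (@segt_cat _ _ _ _ _ 3 8) h1.
by apply: segt_zero => //; apply/andP.
Qed.

End Segments.

(** * A language with capped arithmetic *)

(* [Succ] saturates at the cap W, so that no value exceeds W and the running
   time of a program is polynomial in W, whatever the program computes.
   Variables are de Bruijn levels: [Var i] is the [i]-th entry of the context,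
   and binders append to it ([Iter] appends accumulator, bound and index). *)
Inductive exp :=
| Var of nat
| Zero
| Succ of exp
| Cap
| Bit of nat & exp
| Eq of exp & exp
| If of exp & exp & exp
| Iter of exp & exp & exp
| Let of exp & exp
| Call of nat & exp.

Section Eval.
Variables (W : nat) (A : nat -> nat -> bool).

Fixpoint eval (e : exp) (ctx : seq nat) : nat :=
  match e with
  | Var i => nth 0 ctx i
  | Zero => 0
  | Succ e => let v := eval e ctx in if v == W then v else v.+1
  | Cap => W
  | Bit a e => A a (eval e ctx)
  | Eq e1 e2 => let v := eval e1 ctx in v == eval e2 (ctx ++ [:: v])
  | If e e1 e2 => if eval e ctx == 0 then eval e2 ctx else eval e1 ctx
  | Iter e0 n body =>
    let v0 := eval e0 ctx in
    let cnt := eval n (ctx ++ [:: v0]) in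
    iteri cnt (fun i acc => eval body (ctx ++ [:: acc; cnt; i])) v0
  | Let e1 e2 => eval e2 (ctx ++ [:: eval e1 ctx])
  | Call k f => eval f (drop (size ctx - k) ctx)
  end.
End Eval.

Inductive stm :=
| SSeq of stm & stm
| SWrite of nat & exp & exp
| SIf of exp & stm & stm
| SFor of exp & stm
| SLet of exp & stm
| SGrow.

Definition memory := (nat * (nat -> nat -> bool))%type.

Definition write (m : memory) (a x : nat) (b : bool) : memory :=
  (m.1, fun a' x' => if (a' == a) && (x' == x) then b else m.2 a' x').

Fixpoint exec (c : stm) (ctx : seq nat) (m : memory) : memory :=
  match c with
  | SSeq c1 c2 => exec c2 ctx (exec c1 ctx m)
  | SWrite a e1 e2 =>
    let x := eval m.1 m.2 e1 ctx in
    write m a x (eval m.1 m.2 e2 (ctx ++ [:: x]) != 0)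
  | SIf e c1 c2 => if eval m.1 m.2 e ctx == 0 then exec c2 ctx m else exec c1 ctx m
  | SFor e c =>
    let cnt := eval m.1 m.2 e ctx in
    iteri cnt (fun i => exec c (ctx ++ [:: cnt; i])) m
  | SLet e c => exec c (ctx ++ [:: eval m.1 m.2 e ctx]) m
  | SGrow => (m.1.+1, m.2)
  end.

(** * The compiler and its correctness *)

Section Compile.

Variable NR : nat.
Hypothesis NR2 : 2 <= NR.

(* [comp e b d] evaluates [e] into register [d], the context being stored in
   registers b, ..., d-1. *)
Fixpoint comp (e : exp) (b d : nat) : seq instr :=
  match e with
  | Var i => if b + i < d then copy d (b + i) else [:: IZero d]
  | Zero => [:: IZero d]
  | Succ e => comp e b d ++ [:: IInc d]
  | Cap => copy d 1
  | Bit a e => comp e b d ++ ite d a ([:: IZero d] ++ [:: IInc d]) [:: IZero d]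
  | Eq e1 e2 => comp e1 b d ++ (comp e2 b d.+1 ++
      ite d (rtrk d.+1) ([:: IZero d] ++ [:: IInc d]) [:: IZero d])
  | If e e1 e2 => comp e b d ++ ite d (rtrk 0) (comp e2 b d) (comp e1 b d)
  | Iter e0 n body => comp e0 b d ++ (comp n b d.+1 ++ ([:: IZero d.+2] ++
      while d.+2 d.+1 (comp body b d.+3 ++ (copy d d.+3 ++ [:: IInc d.+2]))))
  | Let e1 e2 => comp e1 b d ++ (comp e2 b d.+1 ++ copy d d.+1)
  | Call k f => comp f (maxn b (d - k)) d
  end.

Fixpoint fits (e : exp) (d : nat) : bool :=
  match e with
  | Var _ | Zero | Cap => d < NR
  | Succ e => fits e d
  | Bit a e => (a < narr) && fits e d
  | Eq e1 e2 | Let e1 e2 => fits e1 d && fits e2 d.+1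
  | If e e1 e2 => [&& fits e d, fits e1 d & fits e2 d]
  | Iter e0 n body => [&& fits e0 d, fits n d.+1 & fits body d.+3]
  | Call k f => fits f d
  end.

Lemma fits_lt e d : fits e d -> d < NR.
Proof.
elim: e d => [i||e IH||a e IH|e1 IH e2 _|e IH e1 _ e2 _|e IH e1 _ e2 _|e1 IH e2 _|k e IH] d //=.
- exact: IH.
- by case/andP=> _; apply: IH.
- by case/andP=> /IH.
- by case/and3P=> /IH.
- by case/and3P=> /IH.
- by case/andP=> /IH.
- exact: IH.
Qed.

Definition holds (b : nat) (ctx : seq nat) (s : store) : Prop :=
  forall i, i < size ctx -> reg s (b + i) = nth 0 ctx i.

Definition evals (c : seq instr) (s : store) (d v E : nat) : Prop :=
  exists2 s', segt NR c s s' E &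
    [/\ arr s' = arr s, forall r, r < d -> reg s' r = reg s r, reg s' d = v & ok NR s'].

Lemma holds_ext b ctx s s' d : d = b + size ctx ->
  (forall r, r < d -> reg s' r = reg s r) -> holds b ctx s -> holds b ctx s'.
Proof. by move=> -> h H i ic; rewrite h ?H ?ltn_add2l. Qed.

Lemma holds_cat b ctx s v : holds b ctx s -> reg s (b + size ctx) = v -> holds b (ctx ++ [:: v]) s.
Proof.
move=> h e i; rewrite size_cat /= addn1 ltnS leq_eqVlt => /orP[/eqP ->|ic].
  by rewrite nth_cat ltnn subnn e.
by rewrite nth_cat ic h.
Qed.

Lemma evals_zero s d : ok NR s -> 1 < d < NR -> evals [:: IZero d] s d 0 3.
Proof.
move=> sok dN; exists (setr s d 0); first exact: segt_zero.
have [s0 s1 sW] := sok; have /andP[d1 dN'] := dN.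
split=> //=; last exact: ok_setr.
  by move=> r rd; rewrite (_ : (r == d) = false) //; lia.
by rewrite eqxx.
Qed.

Lemma evals_copy s d y : ok NR s -> 1 < d < NR -> y < NR -> y != d -> evals (copy d y) s d (reg s y) 12.
Proof.
move=> sok dN yN yd.
have [|s' h [h1 h2 h3 h4]] := segt_copy NR2 sok dN yN; first by rewrite eq_sym.
by exists s' => //; split=> // r rd; apply: h2; lia.
Qed.

Lemma evals_inc s d : ok NR s -> 1 < d < NR ->
  evals [:: IInc d] s d (if reg s d == reg s 1 then reg s d else (reg s d).+1) 3.
Proof.
move=> sok dN; exists (incr s d); first exact: segt_inc.
have [s0 s1 sW] := sok; have /andP[d1 dN'] := dN; have := sW d dN'.
rewrite /incr; case: eqP => // e eW; split=> //=.
- by move=> r rd; rewrite (_ : (r == d) = false) //; lia.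
- by rewrite eqxx.
- by apply: ok_setr => //; lia.
Qed.

Lemma evals_cat c1 c2 s d1 d v1 v E1 E2 : d <= d1 ->
  evals c1 s d1 v1 E1 ->
  (forall s1, arr s1 = arr s -> (forall r, r < d1 -> reg s1 r = reg s r) ->
    reg s1 d1 = v1 -> ok NR s1 -> evals c2 s1 d v E2) ->
  evals (c1 ++ c2) s d v (E1 + E2).+1.
Proof.
move=> dd [s1 g1 [a1 r1 v1E k1]] /(_ s1 a1 r1 v1E k1) [s2 g2 [a2 r2 v2E k2]].
exists s2; first exact: segt_cat g1 g2.
split=> //; first by rewrite a2.
by move=> r rd; rewrite r2 // r1 //; lia.
Qed.

Lemma evals_one s d : ok NR s -> 1 < d < NR -> evals ([:: IZero d] ++ [:: IInc d]) s d 1 7.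
Proof.
move=> sok dN; apply: (@evals_cat _ _ _ d d 0 1 3 3) => //; first exact: evals_zero.
move=> s1 a1 r1 e1 k1; have := evals_inc k1 dN.
by rewrite e1; have [_ w _] := k1; case: eqP w => // <-.
Qed.

Lemma evals_ite r t c1 c2 s d v E : ok NR s -> r < NR -> t < narr + NR ->
  evals (if trk s t (reg s r) then c1 else c2) s d v E ->
  evals (ite r t c1 c2) s d v (E + 4).
Proof.
move=> sok rN tT [s' g h]; exists s' => //; exact: segt_ite.
Qed.

Lemma evals_mono c s d v E E' : E <= E' -> evals c s d v E -> evals c s d v E'.
Proof. by move=> EE [s' g h]; exists s' => //; apply: segt_mono g. Qed.

(** The order of the quantifiers is the point: the exponent is fixed by the expression and its place
    in the registers, before the store and the values in the context are known. *)
Theorem comp_correct e : forall b d, 2 <= b -> fits e d -> exists E, forall s ctx,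
  ok NR s -> d = b + size ctx -> holds b ctx s ->
  evals (comp e b d) s d (eval (reg s 1) (arr s) e ctx) E.
Proof.
elim: e => [i|| e IH || a e IH | e1 IH1 e2 IH2 | e IH e1 IH1 e2 IH2 | e1 IH1 e2 IH2 e3 IH3 | e1 IH1 e2 IH2 | k e IH] b d b2 f;
  have dN := fits_lt f; have /= := f.
- move=> _; exists 12 => s ctx sok dE H /=; case: ltnP => bd.
    by rewrite -H; [apply: evals_copy => //; lia | lia].
  by rewrite nth_default; [apply: (evals_mono (E := 3)) => //; apply: evals_zero => //; lia | lia].
- by move=> _; exists 3 => s ctx sok dE H /=; apply: evals_zero => //; lia.
- move=> f1; have [E h] := IH b d b2 f1; exists (E + 3).+1 => s ctx sok dE H /=.
  apply: evals_cat (h s ctx sok dE H) _ => // s1 a1 r1 v1 k1.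
  rewrite -v1 -(r1 1); last lia.
  by apply: evals_inc => //; lia.
- by move=> _; exists 12 => s ctx sok dE H /=; apply: evals_copy => //; lia.
- move=> /andP[an f1]; have [E h] := IH b d b2 f1; exists (E + (7 + 4)).+1 => s ctx sok dE H /=.
  apply: evals_cat (h s ctx sok dE H) _ => // s1 a1 r1 v1 k1.
  apply: evals_ite => //; first by rewrite /narr; move: an; rewrite /narr; lia.
  rewrite v1 /trk an a1; case: (arr s a _); first by apply: evals_one => //; lia.
  by apply: (evals_mono (E := 3)) => //; apply: evals_zero => //; lia.
- move=> /andP[f1 f2]; have [E1 h1] := IH1 b d b2 f1; have [E2 h2] := IH2 b d.+1 b2 f2.
  exists (E1 + (E2 + (7 + 4)).+1).+1 => s ctx sok dE H /=.
  apply: evals_cat (h1 s ctx sok dE H) _ => // s1 a1 r1 v1 k1.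
  have H1 : holds b (ctx ++ [:: reg s1 d]) s1.
    by rewrite dE; apply: holds_cat => //; apply: holds_ext H; rewrite -?dE.
  have dE1 : d.+1 = b + size (ctx ++ [:: reg s1 d]) by rewrite size_cat /= dE; lia.
  apply: evals_cat (h2 s1 _ k1 dE1 H1) _ => // s2 a2 r2 v2 k2.
  have f2N := fits_lt f2.
  apply: evals_ite => //.
  rewrite trk_reg v2 r2 // v1 a1 (r1 1); last lia.
  case: eqP => _; first by apply: evals_one => //; lia.
  by apply: (evals_mono (E := 3)) => //; apply: evals_zero => //; lia.
- move=> /and3P[f0 f1 f2]; have [E h] := IH b d b2 f0.
  have [E1 h1] := IH1 b d b2 f1; have [E2 h2] := IH2 b d b2 f2.
  exists (E + (E1 + E2 + 4)).+1 => s ctx sok dE H /=.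
  apply: evals_cat (h s ctx sok dE H) _ => // s1 a1 r1 v1 k1.
  have H1 : holds b ctx s1 by apply: holds_ext H; rewrite -?dE.
  apply: evals_ite => //; first by rewrite /rtrk; lia.
  have [s10 _ _] := k1; rewrite trk_reg v1 s10 -a1 -(r1 1); last lia.
  case: eqP => _.
    by apply: evals_mono (h2 s1 ctx k1 dE H1); lia.
  by apply: evals_mono (h1 s1 ctx k1 dE H1); lia.
- move=> /and3P[f0 f1 f2]; have [E1 h1] := IH1 b d b2 f0.
  have [E2 h2] := IH2 b d.+1 b2 f1; have [E3 h3] := IH3 b d.+3 b2 f2.
  exists (E1 + (E2 + (3 + ((E3 + (12 + 3).+1).+1 + 5)).+1).+1).+1 => s ctx sok dE H /=.
  have f1N := fits_lt f1; have f2N := fits_lt f2.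
  apply: evals_cat (h1 s ctx sok dE H) _ => // s1 a1 r1 v1 k1.
  have H1 : holds b (ctx ++ [:: reg s1 d]) s1.
    by rewrite dE; apply: holds_cat => //; apply: holds_ext H; rewrite -?dE.
  have dE1 : d.+1 = b + size (ctx ++ [:: reg s1 d]) by rewrite size_cat /= dE; lia.
  apply: evals_cat (h2 s1 _ k1 dE1 H1) _ => // s2 a2 r2 v2 k2.
  apply: (evals_cat (d1 := d.+2)) (evals_zero k2 _) _; [lia|lia|move=> s3 a3 r3 v3 k3].
  rewrite v1 a1 (r1 1) in v2; last lia.
  move: v1 v2; set v0 := eval _ _ e1 _; set cnt := eval _ _ e2 _ => v1 v2.
  set F := fun i acc => _.
  (* Registers d, d+1, d+2 hold accumulator, bound and index, in the order in which [Iter] appends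
     them to the context; the body is compiled with target d+3 and its result is then copied down to
     d. *)
  pose P j s' := [/\ arr s' = arr s, forall r, r < d -> reg s' r = reg s r, ok NR s' &
     [/\ reg s' d = iteri j F v0, reg s' d.+1 = cnt & reg s' d.+2 = j]].
  have [|||||s' g [p1 p2 p3 [p4 p5 p6]]] := @segt_while NR NR2 d.+2 d.+1
      (comp e3 b d.+3 ++ (copy d d.+3 ++ [:: IInc d.+2])) cnt (E3 + (12 + 3).+1).+1 P _ _ _ _ s3.
  - lia.
  - lia.
  - by move=> j s' [_ _ ? [_ ? ?]].
  - move=> j s4 jc [p1 p2 p3 [p4 p5 p6]].
    set ctx' := ctx ++ [:: reg s4 d; cnt; j].
    have dE' : d.+3 = b + size ctx' by rewrite size_cat /= dE; lia.
    have H' : holds b ctx' s4.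
      rewrite /ctx' (_ : _ ++ _ = ((ctx ++ [:: reg s4 d]) ++ [:: cnt]) ++ [:: j]); last first.
        by rewrite -!catA.
      rewrite dE in p4 p5 p6 *.
      do 3! (apply: holds_cat; last by rewrite ?size_cat /= ?addn1 ?addnS).
      by apply: holds_ext H => // r; rewrite -dE; apply: p2.
    have [s5 g5 [a5 r5 v5 k5]] := h3 s4 ctx' p3 dE' H'.
    have d3N : d.+3 < NR by lia.
    have [||s6 g6 [a6 r6 v6 k6]] := @segt_copy NR NR2 d d.+3 s5 k5 _ d3N; try lia.
    exists (incr s6 d.+2).
      apply: segt_cat g5 _; apply: segt_cat g6 _; apply: segt_inc => //; lia.
    have e6 : reg s6 d.+2 = j by rewrite r6 ?r5 //; lia.
    have w6 : reg s6 1 = reg s 1 by rewrite r6 ?r5 ?p2 //; lia.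
    have cW : cnt <= reg s6 1.
      by have [_ _ /(_ d.+1)] := k6; rewrite r6 ?r5 ?p5; lia.
    rewrite /incr e6 (_ : (j == _) = false); last lia.
    split=> /=.
    + by rewrite a6 a5.
    + by move=> r rd; rewrite (_ : (r == _) = false) ?r6 ?r5 ?p2 //; lia.
    + by apply: ok_setr => //; lia.
    + rewrite (_ : (d == _) = false); last lia.
      rewrite (_ : (d.+1 == _) = false); last lia.
      have e5 : reg s6 d.+1 = cnt by rewrite r6 ?r5 ?p5 //; lia.
      rewrite eqxx v6 e5.
      by split=> //; rewrite -p4 v5 p1 (p2 1) //; lia.
  - split=> //; [by rewrite a3 a2 | by move=> r rd; rewrite r3 ?r2 ?r1 //; lia |].
    by split=> //; rewrite r3 ?v2 // r2.
  exists s' => //; split=> //; first by rewrite p1 a3 a2 a1.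
  by move=> r rd; rewrite p2 // r3 ?r2 ?r1 //; lia.
- move=> /andP[f1 f2]; have [E1 h1] := IH1 b d b2 f1; have [E2 h2] := IH2 b d.+1 b2 f2.
  exists (E1 + (E2 + 12).+1).+1 => s ctx sok dE H /=.
  apply: evals_cat (h1 s ctx sok dE H) _ => // s1 a1 r1 v1 k1.
  have H1 : holds b (ctx ++ [:: reg s1 d]) s1.
    by rewrite dE; apply: holds_cat => //; apply: holds_ext H; rewrite -?dE.
  have dE1 : d.+1 = b + size (ctx ++ [:: reg s1 d]) by rewrite size_cat /= dE; lia.
  apply: evals_cat (h2 s1 _ k1 dE1 H1) _ => // s2 a2 r2 v2 k2.
  have f2N := fits_lt f2.
  rewrite v1 a1 (r1 1) in v2; last lia.
  by rewrite -v2; apply: evals_copy => //; lia.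
(* Variables are levels, so raising the base register to d - k turns the last k entries into a
   context of their own without copying anything. *)
- move=> f1; have [E h] := IH (maxn b (d - k)) d ltac:(lia) f1; exists E => s ctx sok dE H /=.
  apply: h => //; first by rewrite size_drop; lia.
  move=> i; rewrite size_drop nth_drop => ic; rewrite -H; last lia.
  by congr (reg s _); lia.
Qed.

Fixpoint scomp (c : stm) (b d : nat) : seq instr :=
  match c with
  | SSeq c1 c2 => scomp c1 b d ++ scomp c2 b d
  | SWrite a e1 e2 => comp e1 b d ++ (comp e2 b d.+1 ++
      ite d.+1 (rtrk 0) [:: IWrite d a false] [:: IWrite d a true])
  | SIf e c1 c2 => comp e b d ++ ite d (rtrk 0) (scomp c2 b d) (scomp c1 b d)
  | SFor e c => comp e b d ++ ([:: IZero d.+1] ++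
      while d.+1 d (scomp c b d.+2 ++ [:: IInc d.+1]))
  | SLet e c => comp e b d ++ scomp c b d.+1
  | SGrow => [:: IInc 1]
  end.

Fixpoint sfits (c : stm) (d : nat) : bool :=
  match c with
  | SSeq c1 c2 => sfits c1 d && sfits c2 d
  | SWrite a e1 e2 => [&& a < narr, fits e1 d & fits e2 d.+1]
  | SIf e c1 c2 => [&& fits e d, sfits c1 d & sfits c2 d]
  | SFor e c => [&& d.+1 < NR, fits e d & sfits c d.+2]
  | SLet e c => fits e d && sfits c d.+1
  | SGrow => true
  end.

(** Register 1 is exempt because [SGrow] raises the cap. Contexts start at register 2 or later, so
    their entries survive. *)
Definition agree (d : nat) (s s' : store) : Prop :=
  forall r, r < d -> r != 1 -> reg s' r = reg s r.

Definition execs (c : seq instr) (s : store) (d : nat) (m : memory) (E : nat) : Prop :=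
  exists2 s', segt NR c s s' E &
    [/\ reg s' 1 = m.1, arr s' = m.2, agree d s s' & ok NR s'].

Lemma holds_agree b ctx s s' d : 2 <= b -> d = b + size ctx ->
  agree d s s' -> holds b ctx s -> holds b ctx s'.
Proof. by move=> b2 -> h H i ic; rewrite h ?H ?ltn_add2l //; lia. Qed.

Lemma execs_evals c1 c2 s d d1 v E1 E2 m : 1 < d <= d1 ->
  evals c1 s d1 v E1 ->
  (forall s1, arr s1 = arr s -> (forall r, r < d1 -> reg s1 r = reg s r) ->
    reg s1 d1 = v -> ok NR s1 -> execs c2 s1 d m E2) ->
  execs (c1 ++ c2) s d m (E1 + E2).+1.
Proof.
move=> dd [s1 g1 [a1 r1 v1E k1]] /(_ s1 a1 r1 v1E k1) [s2 g2 [w2 a2 r2 k2]].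
exists s2; first exact: segt_cat g1 g2.
by split=> // r rd rn; rewrite r2 // r1 //; lia.
Qed.

Lemma execs_mono c s d m E E' : E <= E' -> execs c s d m E -> execs c s d m E'.
Proof. by move=> EE [s' g h]; exists s' => //; apply: segt_mono g. Qed.

Lemma execs_ite r t c1 c2 s d m E : ok NR s -> r < NR -> t < narr + NR ->
  execs (if trk s t (reg s r) then c1 else c2) s d m E ->
  execs (ite r t c1 c2) s d m (E + 4).
Proof. by move=> sok rN tT [s' g h]; exists s' => //; exact: segt_ite. Qed.

Theorem scomp_correct c : forall b d, 2 <= b -> sfits c d -> exists E, forall s ctx,
  ok NR s -> d = b + size ctx -> holds b ctx s ->
  execs (scomp c b d) s d (exec c ctx (reg s 1, arr s)) E.
Proof.
have t0 : rtrk 0 < narr + NR by rewrite /rtrk; lia.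
elim: c => [c1 IH1 c2 IH2|a e1 e2|e c1 IH1 c2 IH2|e c IH|e c IH|] b d b2.
- move=> /= /andP[f1 f2]; have [E1 h1] := IH1 b d b2 f1; have [E2 h2] := IH2 b d b2 f2.
  exists (E1 + E2).+1 => s ctx sok dE H.
  have [s1 g1 [w1 a1 r1 k1]] := h1 s ctx sok dE H.
  have [s2 g2 [w2 a2 r2 k2]] := h2 s1 ctx k1 dE (holds_agree b2 dE r1 H).
  exists s2; first exact: segt_cat g1 g2.
  rewrite /= w2 a2 w1 a1 -surjective_pairing; split=> // r rd rn.
  by rewrite r2 ?r1.
- move=> /= /and3P[an f1 f2]; have [E1 h1] := comp_correct b2 f1.
  have [E2 h2] := comp_correct b2 f2.
  have dN := fits_lt f2.
  exists (E1 + (E2 + (3 + 4)).+1).+1 => s ctx sok dE H /=.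
  apply: execs_evals (h1 s ctx sok dE H) _; first by lia.
  move=> s1 a1 r1 v1 k1.
  have H1 : holds b (ctx ++ [:: reg s1 d]) s1.
    by rewrite dE; apply: holds_cat => //; apply: holds_ext H; rewrite -?dE.
  have dE1 : d.+1 = b + size (ctx ++ [:: reg s1 d]) by rewrite size_cat /= dE; lia.
  apply: execs_evals (h2 s1 _ k1 dE1 H1) _; first by lia.
  move=> s2 a2 r2 v2 k2; rewrite v1 a1 (r1 1) in v2; last lia.
  apply: execs_ite => //; have [s20 _ _] := k2; rewrite trk_reg s20.
  exists (seta s2 a (reg s2 d) (reg s2 d.+1 != 0)).
    by case: (reg s2 d.+1 == 0); apply: segt_write => //; lia.
  have dd : reg s2 d = reg s1 d by apply: r2.
  by split=> //=; [rewrite r2 ?r1 //; lia | rewrite v2 dd v1 a2 a1].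
- move=> /= /and3P[f0 f1 f2]; have [E h] := comp_correct b2 f0.
  have [E1 h1] := IH1 b d b2 f1; have [E2 h2] := IH2 b d b2 f2.
  have dN := fits_lt f0.
  exists (E + (E1 + E2 + 4)).+1 => s ctx sok dE H /=.
  apply: execs_evals (h s ctx sok dE H) _; first by lia.
  move=> s1 a1 r1 v1 k1.
  have H1 : holds b ctx s1 by apply: holds_ext H; rewrite -?dE.
  apply: execs_ite => //; have [s10 _ _] := k1; rewrite trk_reg v1 s10 -a1 -(r1 1); last lia.
  case: eqP => _.
    by apply: execs_mono (h2 s1 ctx k1 dE H1); lia.
  by apply: execs_mono (h1 s1 ctx k1 dE H1); lia.
- move=> /= /and3P[dN f1 f2]; have [E1 h1] := comp_correct b2 f1.
  have [E2 h2] := IH b d.+2 b2 f2.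
  exists (E1 + (3 + ((E2 + 3).+1 + 5)).+1).+1 => s ctx sok dE H /=.
  apply: execs_evals (h1 s ctx sok dE H) _; first by lia.
  move=> s1 a1 r1 v1 k1.
  apply: (execs_evals (d1 := d.+1)) (evals_zero k1 _) _; [lia|lia|move=> s3 a3 r3 v3 k3].
  move: v1; set cnt := eval _ _ e _ => v1; set F := fun i => _; set m0 := (reg s 1, arr s).
  pose P j s' := [/\ ok NR s', reg s' d = cnt & reg s' d.+1 = j] /\
     [/\ reg s' 1 = (iteri j F m0).1, arr s' = (iteri j F m0).2 & agree d s s'].
  have [|||||s' g [[p1 p2 p3] [p4 p5 p6]]] := @segt_while NR NR2 d.+1 d
      (scomp c b d.+2 ++ [:: IInc d.+1]) cnt (E2 + 3).+1 P _ _ _ _ s3.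
  - lia.
  - lia.
  - by move=> j s' [[? ? ?] _].
  - move=> j s4 jc [[p1 p2 p3] [p4 p5 p6]].
    set ctx' := ctx ++ [:: cnt; j].
    have dE' : d.+2 = b + size ctx' by rewrite size_cat /= dE; lia.
    have H' : holds b ctx' s4.
      rewrite /ctx' (_ : _ ++ _ = ((ctx ++ [:: cnt]) ++ [:: j])); last by rewrite -!catA.
      rewrite dE in p2 p3 p6 *.
      do 2! (apply: holds_cat; last by rewrite ?size_cat /= ?addn1 ?addnS).
      exact: holds_agree p6 H.
    have [s5 g5 [w5 a5 r5 k5]] := h2 s4 ctx' p1 dE' H'.
    exists (incr s5 d.+1).
      by apply: segt_cat g5 _; apply: segt_inc => //; lia.
    have e5 : reg s5 d.+1 = j by rewrite r5 //; lia.
    have d5 : reg s5 d = cnt by rewrite r5 //; lia.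
    have cW : cnt <= reg s5 1.
      by have [_ _ /(_ d)] := k5; rewrite d5; apply; lia.
    rewrite /incr e5 (_ : (j == _) = false); last lia.
    split; [split=> /= | split=> //=].
    + by apply: ok_setr => //; lia.
    + by rewrite (_ : (d == _) = false); last lia.
    + by rewrite eqxx.
    + rewrite (_ : (1 == _) = false); last lia.
      by rewrite w5 p4 p5 -surjective_pairing.
    + by rewrite a5 p4 p5 -surjective_pairing.
    + move=> r rd rn; rewrite /= (_ : (r == _) = false) ?r5 ?p6 //; lia.
  - split; split=> //=.
    + by rewrite r3.
    + by rewrite r3 ?r1 //; lia.
    + by rewrite a3.
    + by move=> r rd rn; rewrite r3 ?r1 //; lia.
  exists s' => //; split=> //.
  by move=> r rd rn; rewrite p6 // r3 ?r1 //; lia.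
- move=> /= /andP[f1 f2]; have [E1 h1] := comp_correct b2 f1.
  have [E2 h2] := IH b d.+1 b2 f2.
  exists (E1 + E2).+1 => s ctx sok dE H /=.
  apply: execs_evals (h1 s ctx sok dE H) _; first by lia.
  move=> s1 a1 r1 v1 k1.
  have H1 : holds b (ctx ++ [:: reg s1 d]) s1.
    by rewrite dE; apply: holds_cat => //; apply: holds_ext H; rewrite -?dE.
  have dE1 : d.+1 = b + size (ctx ++ [:: reg s1 d]) by rewrite size_cat /= dE; lia.
  have [s2 g2 [w2 a2 r2 k2]] := h2 s1 _ k1 dE1 H1.
  exists s2 => //; rewrite w2 a2 v1 a1 (r1 1); last lia.
  by split=> // r rd rn; apply: r2 => //; lia.
- move=> _; exists 3 => s ctx sok dE H /=; have [s0 s1 sW] := sok.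
  exists (setr s 1 (reg s 1).+1); first exact: segt_grow.
  split=> //=; first by move=> r rd /negbTE rn; rewrite /= rn.
  split=> //= r rN; case: eqP => // _; have := sW r rN; lia.
Qed.

End Compile.

Lemma leq_pow w n : n <= (w + 2) ^ n.
Proof.
apply: leq_trans (_ : 2 ^ n <= _); first by apply: ltnW; apply: ltn_expl.
by case: n => // n; rewrite leq_exp2r //; lia.
Qed.

(** * From statements to complete machines *)

Section Program.

Variable NR : nat.
Hypothesis NR2 : 2 <= NR.

(** The cap may be among the registers to be reset, so the time cannot be measured by the final cap
    as in [segt]; a bound W is supplied from outside. *)
Lemma seg_zeros rs s W : reg s 0 = 0 -> all (fun r => 0 < r < NR) rs ->
  (forall r, r < NR -> reg s r <= W) ->
  exists s' t, [/\ seg NR [seq IZero r | r <- rs] s s' t, arr s' = arr s,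
    forall r, reg s' r = if r \in rs then 0 else reg s r & t <= size rs * (2 * W + 2)].
Proof.
move=> s0 rsN sW.
elim: rs s s0 rsN sW => [|r rs IH] s s0.
  by move=> _ _; exists s, 0; split=> //; apply: seg_nil.
rewrite /= => /andP[rN rsN] sW.
have sW' r' : r' < NR -> reg (setr s r 0) r' <= W.
  by move=> h; rewrite /=; case: eqP => // _; apply: sW.
have s0' : reg (setr s r 0) 0 = 0 by rewrite /= s0 if_same.
have [s' [t [g a h b]]] := IH (setr s r 0) s0' rsN sW'.
exists s', (reg s r + 1 + (reg s r + 1) + t); split.
- rewrite -cat1s; apply: seg_cat g => pre post; rewrite [size pre + _]addn1.
  by apply: reach_zero => //=; rewrite ?nth_mid //; apply: lt_mid.
- by rewrite a.
- by move=> r'; rewrite h inE /=; case: (r' == r); rewrite ?if_same.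
- by have := sW r; case/andP: rN => _ rN /(_ rN); rewrite mulSn; lia.
Qed.

(* The verdict is read from array 2 at position 0. The registers are reset so
   that the final tape shows the arrays only. *)
Definition prog (c : stm) : seq instr :=
  scomp c 2 2 ++ ([seq IZero r | r <- iota 1 NR.-1] ++
    [:: ITest 0 2 2; IHalt true; IHalt false]).

Definition input_memory (w : seq nat) : memory := ((size w).+1, arr (init_store w)).

(** The whole final tape is described, and not only the verdict, since the machine that computes the
    parameter-dependent factor is judged by its output. *)
Theorem prog_correct c : sfits NR c 2 -> exists E, forall w, all (fun x => 0 < x < 4) w ->
  let m := exec c [::] (input_memory w) in
  exists2 t, t <= (m.1 + 2) ^ E &
  rep (NR := NR) (code := prog c) (if m.2 2 0 then 3 else 4) 1
    (tape NR (Store (fun=> 0) m.2)) (run (machine NR (prog c)) t (init (machine NR (prog c)) w)).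
Proof.
move=> cf; have [E h] := scomp_correct NR2 (leqnn 2) cf.
exists (E + (3 + (NR + 4))).+2 => w wP m.
have iok : ok NR (init_store w).
  by split=> //= r _; case: ifP.
have [s1 [w1 [t1 g1 b1]] [e1 a1 _ [k0 k1 k2]]] := h (init_store w) [::] iok erefl ltac:(by []).
change (reg s1 1 = m.1) in e1; change (arr s1 = m.2) in a1.
clearbody m; have rsP : all (fun r => 0 < r < NR) (iota 1 NR.-1).
  by apply/allP => r; rewrite mem_iota; lia.
have [s2 [t2 [g2 a2 r2 b2]]] := seg_zeros k0 rsP k2.
have r2' r : r < NR -> reg s2 r = 0.
  by move=> rN; rewrite r2 mem_iota; case: r rN => [|r] rN; rewrite ?if_same //= add1n prednK ?rN //; lia.
set M := machine NR (prog c).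
set code := prog c in M *.
pose t0 := 2 + (size w + 1 + ((size w).+1 + 1)).
have i0 := @reach_init NR NR2 code w wP.
have st1 : at_home (NR := NR) (code := code) (size (scomp c 2 2)) s1 (run M (t0 + t1) (init M w)).
  by rewrite run_add; apply: (g1 [::]).
have st2 : at_home (NR := NR) (code := code) (size (scomp c 2 2) + NR.-1) s2 (run M (t0 + t1 + t2) (init M w)).
  rewrite run_add; have := g2 (scomp c 2 2) [:: ITest 0 2 2; IHalt true; IHalt false].
  by rewrite size_map size_iota; apply.
set pc := size (scomp c 2 2) + NR.-1 in st2.
have codeE : code = (scomp c 2 2 ++ [seq IZero r | r <- iota 1 NR.-1]) ++ [:: ITest 0 2 2; IHalt true; IHalt false].
  by rewrite /code /prog catA.
have pcE : size (scomp c 2 2 ++ [seq IZero r | r <- iota 1 NR.-1]) = pc.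
  by rewrite size_cat size_map size_iota.
have ncode i : nth (IJmp 0) code (pc + i) = nth (IJmp 0) [:: ITest 0 2 2; IHalt true; IHalt false] i.
  by rewrite codeE nth_cat pcE ltnNge leq_addr /= addKn.
have scode : size code = pc + 3 by rewrite codeE size_cat pcE.
have k20 : reg s2 0 = 0 by apply: r2'; lia.
have a20 : trk s2 2 (reg s2 0) = m.2 2 0 by rewrite k20 /trk /= a2 a1.
have st3 : at_home (NR := NR) (code := code) (if m.2 2 0 then pc.+1 else pc + 2) s2
   (run M (t0 + t1 + t2 + 2) (init M w)).
  rewrite run_add; have := @reach_test NR NR2 code pc s2 0 2 2 (if m.2 2 0 then pc.+1 else pc + 2).
  rewrite -[in nth _ _ pc](addn0 pc) ncode a20 k20; apply=> //; try lia.
  by case: (m.2 2 0); lia.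
exists (t0 + t1 + t2 + 2 + 1).
  have b3 : t0 <= (m.1 + 2) ^ 3.
    by rewrite -[m.1]e1; apply: lin_pow3 => //; rewrite /t0; move: w1; rewrite /=; lia.
  have b4 : t2 <= (m.1 + 2) ^ NR * (m.1 + 2) ^ 2.
    have h1 : NR.-1 <= (m.1 + 2) ^ NR by apply: leq_trans (leq_pred _) (leq_pow _ _).
    have h2 : 2 * m.1 + 2 <= (m.1 + 2) ^ 2 by rewrite expnS expn1; nia.
    by rewrite size_iota e1 in b2; apply: leq_trans b2 (leq_mul h1 h2).
  rewrite e1 in b1; rewrite -expnD in b4.
  have b5 : t2 + 3 <= (m.1 + 2) ^ (NR + 4).
    apply: leq_trans (_ : (m.1 + 2) ^ (NR + 2) + (m.1 + 2) ^ 1 <= _); last first.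
      by apply: leq_trans (pow_add _ _ _) _; apply: pow_mono; lia.
    by rewrite expn1; move: b4 k1; rewrite e1; set X := _ ^ _; rewrite -/m; lia.
  apply: leq_trans (_ : (m.1 + 2) ^ E + (m.1 + 2) ^ (3 + (NR + 4)).+1 <= _); last first.
    by apply: leq_trans (pow_add _ _ _) _; apply: pow_mono; lia.
  have b6 := pow_add m.1 3 (NR + 4).
  by move: b1 b3 b5 b6; set X := _ ^ E; set Y := _ ^ 3; set Z := _ ^ (NR + 4); rewrite -/m; lia.
rewrite run_add -[run M 1 _]/(step M _).
have st4 : rep (NR := NR) (code := code) (if m.2 2 0 then 3 else 4) 1 (tape NR s2)
    (step M (run M (t0 + t1 + t2 + 2) (init M w))).
  move: st3; case: (m.2 2 0) => st3.
    apply: (@reach_halt NR NR2 code pc.+1 s2 true) st3; last by rewrite scode; lia.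
    by rewrite -addn1 ncode.
  apply: (@reach_halt NR NR2 code (pc + 2) s2 false) st3; last by rewrite scode; lia.
  by rewrite ncode.
apply: rep_ext st4 => j; apply: pack_ext => t tT; rewrite /trk a2 a1; case: ltnP => // nt.
by rewrite r2' //; lia.
Qed.

End Program.

(** * Arithmetic routines under the cap *)

Definition App1 (f a : exp) : exp := Let a (Call 1 f).
Definition App2 (f a b : exp) : exp := Let a (Let b (Call 2 f)).
Definition App3 (f a b c : exp) : exp := Let a (Let b (Let c (Call 3 f))).
Definition App4 (f a b c d : exp) : exp := Let a (Let b (Let c (Let d (Call 4 f)))).
Definition App5 (f a b c d e : exp) : exp :=
  Let a (Let b (Let c (Let d (Let e (Call 5 f))))).
Definition App6 (f a b c d e g : exp) : exp :=
  Let a (Let b (Let c (Let d (Let e (Let g (Call 6 f)))))).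

Definition One := locked (Succ Zero).
Definition Add := locked (Iter (Var 0) (Var 1) (Succ (Var 2))).
Definition Mul := locked (Iter Zero (Var 1) (App2 Add (Var 2) (Var 0))).
(** The body returns the loop index, whose last value is the predecessor of the bound. *)
Definition Pred := locked (Iter Zero (Var 0) (Var 3)).
Definition Minus := locked (Iter (Var 0) (Var 1) (App1 Pred (Var 2))).
Definition Leq := locked (Eq (App2 Minus (Var 0) (Var 1)) Zero).
Definition Dist := locked (App2 Add (App2 Minus (Var 0) (Var 1)) (App2 Minus (Var 1) (Var 0))).
Definition Mod := locked (Iter Zero (Var 0) (If (Eq (Succ (Var 2)) (Var 1)) Zero (Succ (Var 2)))).
(** The quotient is the number of multiples of the divisor among 1, ..., x; [Var 4] is the loop
    index, so its successor runs through these numbers. *)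
Definition Div := locked (Iter Zero (Var 0)
  (If (App2 Mod (Succ (Var 4)) (Var 1)) (Var 2) (Succ (Var 2)))).
Definition Digit := locked (App2 Mod (Iter (Var 0) (Var 1) (App2 Div (Var 3) (Var 2))) (Var 2)).

Definition digit (c j B : nat) : nat := iter j (fun x => x %/ B) c %% B.

(* [wk n h e] : the value of [e] does not change when junk is inserted between
   the first [n] and the last [h] entries of the context. *)
Fixpoint wk (n h : nat) (e : exp) : bool :=
  match e with
  | Var i => i < n
  | Zero | Cap => true
  | Succ e | Bit _ e => wk n h e
  | Eq e1 e2 | Let e1 e2 => wk n h e1 && wk n h.+1 e2
  | If e e1 e2 => [&& wk n h e, wk n h e1 & wk n h e2]
  | Iter e0 k body => [&& wk n h e0, wk n h.+1 k & wk n h.+3 body]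
  | Call k f => k <= h
  end.

Section Arithmetic.

Variables (W : nat) (A : nat -> nat -> bool).
Notation ev := (eval W A).

Lemma iteri_eq n (f g : nat -> nat -> nat) x :
  (forall i y, i < n -> f i y = g i y) -> iteri n f x = iteri n g x.
Proof. by elim: n => //= n IH h; rewrite IH ?h // => i y ni; apply/h/ltnW. Qed.

Lemma iteri_inv (X : Type) n (f : nat -> X -> X) x (P : nat -> X -> Prop) :
  P 0 x -> (forall i y, i < n -> P i y -> P i.+1 (f i y)) -> P n (iteri n f x).
Proof.
move=> P0; elim: n => //= n IH h; apply: (h) => //; apply: IH => i y ni; apply: h; exact: ltnW.
Qed.

Arguments eval : simpl never.

Lemma ev_Var i ctx : ev (Var i) ctx = nth 0 ctx i. Proof. by []. Qed.
Lemma ev_Zero ctx : ev Zero ctx = 0. Proof. by []. Qed.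
Lemma ev_Succ e ctx : ev (Succ e) ctx = if ev e ctx == W then ev e ctx else (ev e ctx).+1.
Proof. by []. Qed.
Lemma ev_Cap ctx : ev Cap ctx = W. Proof. by []. Qed.
Lemma ev_Bit a e ctx : ev (Bit a e) ctx = A a (ev e ctx). Proof. by []. Qed.
Lemma ev_If e e1 e2 ctx : ev (If e e1 e2) ctx = if ev e ctx == 0 then ev e2 ctx else ev e1 ctx.
Proof. by []. Qed.
Lemma ev_Let e1 e2 ctx : ev (Let e1 e2) ctx = ev e2 (ctx ++ [:: ev e1 ctx]).
Proof. by []. Qed.
Lemma ev_Call k f ctx : ev (Call k f) ctx = ev f (drop (size ctx - k) ctx).
Proof. by []. Qed.

Lemma wkP n h e ctx l t : size ctx = n -> size t = h -> wk n h e ->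
  ev e (ctx ++ l ++ t) = ev e (ctx ++ t).
Proof.
elim: e h ctx l t => [i||e IH||a e IH|e1 IH1 e2 IH2|e IH e1 IH1 e2 IH2|e1 IH1 e2 IH2 e3 IH3|e1 IH1 e2 IH2|k e IH]
  h ctx l t sc st //=.
- by move=> ic; rewrite !ev_Var !nth_cat sc ic.
- by move=> we; rewrite !ev_Succ (IH h).
- by move=> we; rewrite !ev_Bit (IH h).
- move=> /andP[we1 we2]; rewrite /eval -/(eval W A) (IH1 h) //.
  by rewrite -!catA (IH2 h.+1) // size_cat st addn1.
- by move=> /and3P[we we1 we2]; rewrite !ev_If (IH h) // (IH1 h) // (IH2 h).
- move=> /and3P[we1 we2 we3]; rewrite /eval -/(eval W A) (IH1 h) //.
  rewrite -!catA (IH2 h.+1) ?size_cat ?st ?addn1 //.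
  apply: iteri_eq => i y _; rewrite -!catA (IH3 h.+3) // size_cat st addn3 //.
- move=> /andP[we1 we2]; rewrite !ev_Let (IH1 h) //.
  by rewrite -!catA (IH2 h.+1) // size_cat st addn1.
- move=> kh; rewrite !ev_Call; congr (eval _ _ _ _).
  rewrite catA [RHS]drop_cat [LHS]drop_cat !size_cat !ifF; try lia.
  by congr drop; lia.
Qed.

Lemma wkP0 e ctx l : wk (size ctx) 0 e -> ev e (ctx ++ l) = ev e ctx.
Proof. by move=> we; rewrite -[l]cats0 (@wkP (size ctx) 0) // cats0. Qed.

Lemma drop_last (ctx l : seq nat) : drop (size (ctx ++ l) - size l) (ctx ++ l) = l.
Proof. by rewrite size_cat addnK drop_size_cat. Qed.

Lemma ev_Eq e1 e2 ctx : wk (size ctx) 0 e2 ->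
  ev (Eq e1 e2) ctx = (ev e1 ctx == ev e2 ctx).
Proof. by move=> we; rewrite /eval -/(eval W A) wkP0. Qed.

Lemma ev_Iter e0 n body ctx : wk (size ctx) 0 n -> ev (Iter e0 n body) ctx =
  iteri (ev n ctx) (fun i acc => ev body (ctx ++ [:: acc; ev n ctx; i])) (ev e0 ctx).
Proof. by move=> we; rewrite /eval -/(eval W A) wkP0. Qed.

Lemma ev_App1 f a ctx : ev (App1 f a) ctx = ev f [:: ev a ctx].
Proof.
rewrite /App1 !ev_Let ev_Call -?catA (drop_last ctx [:: _]).
by congr (ev f [:: _]); rewrite -?catA wkP0.
Qed.

Lemma ev_App2 f a b ctx : wk (size ctx) 0 b -> ev (App2 f a b) ctx = ev f [:: ev a ctx; ev b ctx].
Proof.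
move=> wb; rewrite /App2 !ev_Let ev_Call -?catA (drop_last ctx [:: _; _]).
by congr (ev f [:: _; _]); rewrite -?catA wkP0.
Qed.

Lemma ev_App3 f a b c ctx : wk (size ctx) 0 b -> wk (size ctx) 0 c -> 
  ev (App3 f a b c) ctx = ev f [:: ev a ctx; ev b ctx; ev c ctx].
Proof.
move=> wb wc; rewrite /App3 !ev_Let ev_Call -?catA (drop_last ctx [:: _; _; _]).
by congr (ev f [:: _; _; _]); rewrite -?catA wkP0.
Qed.

Lemma ev_App4 f a b c d ctx : wk (size ctx) 0 b -> wk (size ctx) 0 c -> wk (size ctx) 0 d -> 
  ev (App4 f a b c d) ctx = ev f [:: ev a ctx; ev b ctx; ev c ctx; ev d ctx].
Proof.
move=> wb wc wd; rewrite /App4 !ev_Let ev_Call -?catA (drop_last ctx [:: _; _; _; _]).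
by congr (ev f [:: _; _; _; _]); rewrite -?catA wkP0.
Qed.

Lemma ev_App5 f a b c d e ctx : wk (size ctx) 0 b -> wk (size ctx) 0 c -> wk (size ctx) 0 d -> wk (size ctx) 0 e -> 
  ev (App5 f a b c d e) ctx = ev f [:: ev a ctx; ev b ctx; ev c ctx; ev d ctx; ev e ctx].
Proof.
move=> wb wc wd we; rewrite /App5 !ev_Let ev_Call -?catA (drop_last ctx [:: _; _; _; _; _]).
by congr (ev f [:: _; _; _; _; _]); rewrite -?catA wkP0.
Qed.

Lemma ev_App6 f a b c d e g ctx : wk (size ctx) 0 b -> wk (size ctx) 0 c -> wk (size ctx) 0 d -> wk (size ctx) 0 e -> wk (size ctx) 0 g -> 
  ev (App6 f a b c d e g) ctx = ev f [:: ev a ctx; ev b ctx; ev c ctx; ev d ctx; ev e ctx; ev g ctx].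
Proof.
move=> wb wc wd we wg; rewrite /App6 !ev_Let ev_Call -?catA (drop_last ctx [:: _; _; _; _; _; _]).
by congr (ev f [:: _; _; _; _; _; _]); rewrite -?catA wkP0.
Qed.

Definition evE := (ev_App1, ev_App2, ev_App3, ev_App4, ev_App5, ev_App6,
  (ev_Var, ev_Zero, ev_Succ, ev_Cap, ev_Bit, (ev_Eq, ev_If, ev_Iter, ev_Let))).

Hypothesis W0 : 0 < W.

Lemma ev_One ctx : ev One ctx = 1.
Proof. by rewrite /One -lock !evE; case: eqP W0 => // <-. Qed.

Lemma ev_Add x y : x <= W -> ev Add [:: x; y] = minn (x + y) W.
Proof.
move=> xW; rewrite /Add -lock !evE //=.
apply: (iteri_inv (P := fun i v => v = minn (x + i) W)) => [|i v _ ->]; first by rewrite /=; lia.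
by rewrite !evE //=; case: eqP; lia.
Qed.

Lemma ev_Mul x y : x <= W -> ev Mul [:: x; y] = minn (x * y) W.
Proof.
move=> xW; rewrite /Mul -lock !evE //=.
apply: (iteri_inv (P := fun i v => v = minn (x * i) W)) => [|i v _ ->]; first by rewrite /=; lia.
by rewrite !evE //= ev_Add; nia.
Qed.

Lemma ev_Pred x : ev Pred [:: x] = x.-1.
Proof. by rewrite /Pred -lock !evE //=; case: x => //= x; rewrite !evE. Qed.

Lemma ev_Minus x y : ev Minus [:: x; y] = x - y.
Proof.
rewrite /Minus -lock !evE //=.
apply: (iteri_inv (P := fun i v => v = x - i)) => [|i v _ ->]; first by rewrite /=; lia.
by rewrite !evE ev_Pred /=; lia.
Qed.

Lemma ev_Leq x y : ev Leq [:: x; y] = (x <= y).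
Proof. by rewrite /Leq -lock !evE //= ev_Minus. Qed.

Lemma ev_Dist x y : x <= W -> y <= W -> ev Dist [:: x; y] = (x - y) + (y - x).
Proof. by move=> xW yW; rewrite /Dist -lock !evE //= !ev_Minus /= ev_Add; lia. Qed.

Lemma modnS_cond i y : 0 < y -> i.+1 %% y = if (i %% y).+1 == y then 0 else (i %% y).+1.
Proof.
move=> y0; have := ltn_pmod i y0; rewrite leq_eqVlt -[in LHS]addn1 -modnDml addn1.
case: eqP => [->|_ /= h]; first by rewrite modnn.
by rewrite modn_small.
Qed.

Lemma ev_Mod x y : 0 < y <= W -> ev Mod [:: x; y] = x %% y.
Proof.
move=> /andP[y0 yW]; rewrite /Mod -lock !evE //=.
apply: (iteri_inv (P := fun i v => v = i %% y)) => [|i v _ ->]; first by rewrite mod0n.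
have h := ltn_pmod i y0; rewrite !evE //= (_ : (_ == W) = false); last lia.
by rewrite modnS_cond //; case: (_ == y).
Qed.

Lemma ev_Div x y : 0 < y <= W -> x <= W -> ev Div [:: x; y] = x %/ y.
Proof.
move=> yW xW; have /andP[y0 _] := yW; rewrite /Div -lock !evE //=.
apply: (iteri_inv (P := fun i v => v = i %/ y)) => [|i v ix ->]; first by rewrite div0n.
have dW : i %/ y <= i by apply: leq_div.
rewrite !evE //= (_ : (i == W) = false); last lia.
rewrite ev_Mod // [in RHS]divnS // /dvdn (_ : (i %/ y == W) = false); last lia.
by case: eqP.
Qed.

Lemma ev_Digit c j B : 0 < B <= W -> c <= W -> ev Digit [:: c; j; B] = digit c j B.
Proof.
move=> BW cW; rewrite /Digit -lock !evE //=.
set v := iteri _ _ _; have [-> _] : v = iter j (fun x => x %/ B) c /\ v <= W.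
  rewrite /v; apply: (iteri_inv (P := fun i v => v = iter i (fun x => x %/ B) c /\ v <= W)) => //.
  move=> i u _ [-> uW]; rewrite !evE //= ev_Div //; split=> //.
  by apply: leq_trans uW; apply: leq_div.
by rewrite ev_Mod.
Qed.

End Arithmetic.

(** * Parsing and the violation of the constraints *)

Definition Endp := locked (Succ (Iter (Var 0) Cap
  (If (Bit 0 (Var 1)) (If (Bit 1 (Var 1)) (Var 1) (Succ (Var 1))) (Succ (Var 1))))).
(** Horner's rule, run from the end of the numeral back to its start because the least significant
    bit comes first. The two predecessors skip the separator and turn the end position into an
    index. *)
Definition Nval := locked (Let (App1 Endp (Var 0))
  (Iter Zero (App1 Pred (App2 Minus (Var 1) (Var 0)))
    (App2 Add (App2 Add (Var 2) (Var 2))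
      (Bit 1 (App1 Pred (App1 Pred (App2 Minus (Var 1) (Var 4)))))))).
Definition BitAt := locked (Let (App2 Add (Var 0) (Var 2))
  (If (App2 Leq (Succ (Var 3)) (App1 Pred (Var 1))) (Bit 1 (Var 3)) Zero)).
Definition Binleq := locked (Let (App1 Endp (Var 0)) (Let (App1 Endp (Var 1))
  (Iter One Cap
    (If (Eq (App3 BitAt (Var 0) (Var 2) (Var 6)) (App3 BitAt (Var 1) (Var 3) (Var 6)))
      (Var 4) (App3 BitAt (Var 1) (Var 3) (Var 6)))))).
Definition Cbit := locked (Bit 1
  (App2 Add (App2 Add (Var 0) (App2 Mul (Var 2) (Var 1))) (Var 3))).
(* The key of a candidate encodes its value vector and its membership in the trial
   committee; candidates with equal keys are interchangeable. *)
Definition Key := locked (Iter (Bit 3 (Var 2)) (Var 1)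
  (App2 Add (App2 Add (Var 3) (Var 3)) (App4 Cbit (Var 0) (Var 1) (Var 2) (Var 5)))).
(** The search starts from n, which is no candidate, so the result n signals a key that does not
    occur. Otherwise the last match survives; any match would do. *)
Definition Find := locked (Iter (Var 2) (Var 2)
  (If (Eq (App3 Key (Var 0) (Var 1) (Var 6)) (Var 3)) (Var 6) (Var 4))).
Definition Size a := locked (Iter Zero (Var 0) (If (Bit a (Var 3)) (Succ (Var 1)) (Var 1))).
Definition Count a := locked (Iter Zero (Var 2)
  (If (Bit a (Var 6))
    (If (App4 Cbit (Var 0) (Var 1) (Var 6) (Var 3)) (Succ (Var 4)) (Var 4)) (Var 4))).
Definition Term a := locked (Let (App1 Nval (App1 Endp (Var 5)))
  (If (App2 Leq (Var 6) (Var 2))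
    (App2 Dist (App2 Mul (App4 (Count a) (Var 0) (Var 1) (Var 2) (Var 4)) (Var 6))
      (App2 Mul (Var 3) (App1 Nval (Var 5)))) One)).
Definition Pos := locked (Iter (Var 0) (Var 1)
  (App1 Endp (App1 Endp (App1 Endp (App1 Endp (Var 2)))))).
Definition Viol a := locked (Iter (App2 Dist (App1 (Size a) (Var 2)) (Var 3)) (Var 1)
  (App2 Add (Var 5) (App6 (Term a) (Var 0) (Var 1) (Var 2) (Var 3) (Var 7)
    (App2 Pos (Var 4) (Var 7))))).

Definition bval (s : seq bool) : nat := foldr (fun (b : bool) v => b + v.*2) 0 s.

Lemma bval_take s i : bval (take i.+1 s) = bval (take i s) + nth false s i * 2 ^ i.
Proof.
elim: s i => [|b s IH] [|i] //=; first by rewrite take0 /=; lia.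
by rewrite IH expnS; lia.
Qed.

Lemma bval_lt s : bval s < 2 ^ size s.
Proof. by elim: s => //= b s IH; rewrite expnS; case: b; lia. Qed.

Lemma bval_take_lt s i : bval (take i s) < 2 ^ i.
Proof.
apply: leq_trans (bval_lt _) _; rewrite leq_exp2l //.
by rewrite size_take; case: ltnP => //; lia.
Qed.

(** The symbols 1, 2, 3 are 01, 10, 11 in binary: track 1 carries the encoded bit, and among input
    symbols both tracks are set only on the separator. *)
Definition sep (A : nat -> nat -> bool) (x : nat) : bool := A 0 x && A 1 x.

Definition code_at (A : nat -> nat -> bool) (x : nat) (bs : seq bool) : Prop :=
  [/\ forall i, i < size bs -> sep A (x + i) = false,
      forall i, i < size bs -> A 1 (x + i) = nth false bs i &
      sep A (x + size bs)].

Section Parsing.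

Variables (W : nat) (A : nat -> nat -> bool).
Hypothesis W0 : 0 < W.
Notation ev := (eval W A).

Lemma ev_Endp x bs : code_at A x bs -> x + size bs < W -> ev Endp [:: x] = x + size bs + 1.
Proof.
move=> [h1 _ h3] xW; rewrite /Endp -lock !evE //=.
set v := iteri _ _ _; suff -> : v = x + size bs by case: eqP; lia.
(* The scan advances one cell per round and then rests on the separator; W rounds suffice because
   the separator lies below W. *)
have -> : x + size bs = minn (x + W) (x + size bs) by lia.
apply: (iteri_inv (P := fun i v => v = minn (x + i) (x + size bs))) => [|i u iW ->]; first by rewrite /=; lia.
rewrite ?evE //= -/(sep _ _); case: (ltnP i (size bs)) => ib.
  rewrite (_ : minn (x + i) _ = x + i); last lia.
  have := h1 i ib; rewrite /sep (_ : (x + i == W) = false); last lia.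
  by case: (A 0 _); case: (A 1 _) => //= _; lia.
rewrite (_ : minn (x + i) _ = x + size bs); last lia.
by move: h3; rewrite /sep => /andP[-> ->] /=; lia.
Qed.

Lemma ev_Nval x bs : code_at A x bs -> x + size bs < W -> ev Nval [:: x] = minn (bval bs) W.
Proof.
move=> h xW; rewrite /Nval -lock !evE //= !(ev_Endp h) // ev_Minus // ev_Pred //.
have [_ h2 _] := h; rewrite (_ : (_ - x).-1 = size bs); last lia.
rewrite (_ : bval bs = bval (drop (size bs - size bs) bs)); last by rewrite subnn drop0.
apply: (iteri_inv (P := fun i v => v = minn (bval (drop (size bs - i) bs)) W)) => [|i v ib ->].
  by rewrite /= subn0 drop_size /= min0n.
rewrite !ev_Add //; try lia.
rewrite ?ev_Minus ?ev_Pred // (_ : _.-1.-1 = x + (size bs - i.+1)); last lia.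
rewrite h2 ?(drop_nth false (n := size bs - i.+1)) /=; try lia.
by rewrite (_ : (size bs - i.+1).+1 = size bs - i); lia.
Qed.

Lemma ev_BitAt x e i bs : code_at A x bs -> x + size bs < W -> e = x + size bs + 1 ->
  ev BitAt [:: x; e; i] = nth false bs i.
Proof.
move=> [_ h2 _] xW ->; rewrite /BitAt -lock !evE //= ev_Pred // ev_Leq // ev_Add //; last lia.
case: (ltnP i (size bs)) => ib.
  rewrite -h2 // (_ : minn _ _ = x + i); last lia.
  rewrite (_ : (x + i == W) = false); last lia.
  by rewrite (_ : (x + i).+1 <= _) //; lia.
rewrite nth_default // (_ : (_ <= _) = false) //; case: eqP; lia.
Qed.

(** The scan goes up from the least significant bit and overwrites the verdict at every position
    where the numerals differ, so the most significant difference decides. Only the lengths have to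
    fit under the cap; the values may be far larger. *)
Lemma ev_Binleq x y a b : code_at A x a -> code_at A y b -> x + size a < W -> y + size b < W ->
  ev Binleq [:: x; y] = (bval a <= bval b).
Proof.
move=> ha hb xW yW; rewrite /Binleq -lock !evE //= !(ev_Endp ha) // !(ev_Endp hb) //.
rewrite (_ : (bval a <= bval b) = (bval (take W a) <= bval (take W b))); last first.
  by rewrite !take_oversize //; lia.
apply: (iteri_inv (P := fun i v => v = (bval (take i a) <= bval (take i b)) :> nat)) => [|i v iW ->].
  by rewrite !take0 ev_One.
rewrite !(ev_BitAt _ ha) // !(ev_BitAt _ hb) // !bval_take.
have := bval_take_lt a i; have := bval_take_lt b i.
by case: (nth false a i); case: (nth false b i) => /=; lia.
Qed.

End Parsing.

(** * Zero-sum blocks *)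

Lemma sum_gt0 (T : eqType) (v : T -> int) (s : seq T) : s != [::] ->
  {in s, forall x, (0 < v x)%R} -> (0 < \sum_(x <- s) v x)%R.
Proof.
case: s => // a s _ h; rewrite big_cons big_seq.
apply: ltr_wpDr; last by apply: h; rewrite mem_head.
by apply: sumr_ge0 => x xs; apply/ltW/h; rewrite inE xs orbT.
Qed.

Lemma sum_lt0 (T : eqType) (v : T -> int) (s : seq T) : s != [::] ->
  {in s, forall x, (v x < 0)%R} -> (\sum_(x <- s) v x < 0)%R.
Proof.
move=> s0 h; rewrite -oppr_gt0 -sumrN; apply: sum_gt0 => // x xs.
by rewrite oppr_gt0 h.
Qed.

Lemma flatten_flatten (T : Type) (sss : seq (seq (seq T))) :
  flatten [seq flatten ss | ss <- sss] = flatten (flatten sss).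
Proof. by elim: sss => //= ss sss ->; rewrite flatten_cat. Qed.

Section OneDim.

Variables (T : eqType) (v : T -> int) (D : nat).
Hypothesis D0 : 0 < D.

(* Greedy reordering: the partial sums stay in the window (-D, D]. *)
Lemma reorder (s : seq T) (o : int) : {in s, forall x, (`|v x| <= D%:Z)%R} ->
  (- D%:Z < o <= D%:Z)%R -> (\sum_(x <- s) v x = - o)%R ->
  exists2 s', perm_eq s s' &
    forall i, (- D%:Z < o + \sum_(x <- take i s') v x <= D%:Z)%R.
Proof.
move: {2}(size s) (erefl (size s)) => n; elim: n s o => [|n IH] s o.
  by move=> /size0nil -> _ oD _; exists [::] => // i; rewrite big_nil addr0.
move=> sn sD oD so.
suff [x xs xo] : exists2 x, x \in s & (- D%:Z < o + v x <= D%:Z)%R.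
  have px := perm_to_rem xs.
  have [||||s' ps' h] := IH (rem x s) (o + v x)%R.
  - by rewrite size_rem // sn.
  - by move=> y /mem_rem; apply: sD.
  - by [].
  - have := so; rewrite (perm_big _ px) /= big_cons.
    by move: (\sum_(j <- rem x s) v j)%R => Z; lia.
  exists (x :: s').
    by apply: perm_trans px _; rewrite perm_cons.
  by case=> [|i]; rewrite /= ?big_nil ?addr0 // big_cons addrA.
have sn0 : s != [::] by rewrite -size_eq0 sn.
case: (lerP o 0) => o0.
  case E : (has (fun x => (0 <= v x)%R) s).
    by have /hasP[x xs x0] := E; exists x => //; have := sD x xs; lia.
  have h : {in s, forall x, (v x < 0)%R}.
    by move=> x xs; rewrite ltNge; apply/negP => x0; move/hasP: E; apply; exists x.
  by have := sum_lt0 sn0 h; rewrite so; lia.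
case E : (has (fun x => (v x <= 0)%R) s).
  by have /hasP[x xs x0] := E; exists x => //; have := sD x xs; lia.
have h : {in s, forall x, (0 < v x)%R}.
  by move=> x xs; rewrite ltNge; apply/negP => x0; move/hasP: E; apply; exists x.
by have := sum_gt0 sn0 h; rewrite so; lia.
Qed.

Lemma zero_block (s : seq T) : {in s, forall x, (`|v x| <= D%:Z)%R} ->
  (\sum_(x <- s) v x = 0)%R -> s != [::] ->
  exists b r, [/\ perm_eq s (b ++ r), b != [::], size b <= 2 * D & (\sum_(x <- b) v x = 0)%R].
Proof.
move=> sD s0 sn; case: (leqP (size s) (2 * D)) => sz.
  by exists s, [::]; rewrite cats0.
have [||s' ps' h] := @reorder s 0%R sD; [lia | by rewrite s0 oppr0 |].
pose S i := (\sum_(x <- take i s') v x)%R.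
have hS i : (- D%:Z < S i <= D%:Z)%R by have := h i; rewrite add0r.
(* Adding D - 1 maps the window (-D, D] onto 0, ..., 2D - 1, so two of the 2D + 1 prefixes of length
   at most 2D collide. As [s] is longer than 2D, the block between them is a proper stretch of the
   list. *)
pose f (i : 'I_(2 * D).+1) : 'I_(2 * D).-1.+1 := inord (absz (S i + D%:Z - 1)%R).
have /injectivePn [i [j ij fij]] : ~~ injectiveb f.
  apply/negP => /injectiveP /leq_card; rewrite !card_ord; lia.
have {fij} Sij : S i = S j.
  move/(congr1 val): fij; rewrite /= !inordK; have := hS i; have := hS j; lia.
wlog ltij : i j ij Sij / i < j.
  by move=> H; case: (ltngtP i j) ij => [l ij|l ij|/val_inj -> /eqP //]; [exact: (H i j) | apply: (H j i); rewrite // eq_sym].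
exists (take (j - i) (drop i s')), (take i s' ++ drop j s').
have e : s' = take i s' ++ take (j - i) (drop i s') ++ drop j s'.
  by rewrite -{1}(cat_take_drop i s') -{1}(cat_take_drop (j - i) (drop i s')) drop_drop subnK // ltnW.
have si : size s' = size s by rewrite -(perm_size ps').
have jD := ltn_ord j.
split.
- by apply: perm_trans ps' _; rewrite {1}e perm_catCA.
- by rewrite -size_eq0 size_take size_drop; case: ifP; lia.
- by rewrite size_take; case: ifP; lia.
have : S j = (S i + \sum_(x <- take (j - i) (drop i s')) v x)%R.
  rewrite /S -big_cat /=; congr bigop; rewrite -[in take j _](cat_take_drop i s').
  by rewrite take_cat size_takel ?ltnNge ?(ltnW ltij) //; lia.
by rewrite Sij; lia.
Qed.

Lemma zero_blocks1 (s : seq T) : {in s, forall x, (`|v x| <= D%:Z)%R} ->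
  (\sum_(x <- s) v x = 0)%R ->
  exists2 ss, perm_eq s (flatten ss) &
    {in ss, forall b : seq T, size b <= 2 * D /\ (\sum_(x <- b) v x = 0)%R}.
Proof.
move: {2}(size s) (leqnn (size s)) => n; elim: n s => [|n IH] s sn sD s0.
  by exists [::]; first by move: sn; rewrite leqn0 size_eq0 => /eqP ->.
case: (s =P [::]) => [->|/eqP sn0]; first by exists [::].
have [b [r [p bn bD b0]]] := zero_block sD s0 sn0.
have [|||ss pss h] := IH r.
- have := perm_size p; rewrite size_cat.
  by move: bn; rewrite -size_eq0; lia.
- by move=> x xr; apply: sD; rewrite (perm_mem p) mem_cat xr orbT.
- by have := s0; rewrite (perm_big _ p) big_cat /= b0 add0r.
exists (b :: ss); first by apply: perm_trans p _; rewrite perm_cat2l.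
by move=> c; rewrite inE => /orP[/eqP -> //|]; apply: h.
Qed.

End OneDim.

(** A block of at most B items has a sum of absolute value at most B in the next coordinate, so at
    most 2B blocks are merged into one, of at most 2B * B items. *)
Fixpoint block_bound (m : nat) : nat :=
  if m is m'.+1 then 2 * block_bound m' * block_bound m' else 1.

Lemma block_bound_gt0 m : 0 < block_bound m.
Proof. by elim: m => //= m IH; rewrite !muln_gt0 IH. Qed.

Lemma zero_blocks (T : eqType) (w : nat -> T -> int) (m : nat) (s : seq T) :
  (forall i, i < m -> {in s, forall x, (`|w i x| <= 1)%R}) ->
  (forall i, i < m -> (\sum_(x <- s) w i x = 0)%R) ->
  exists2 ss, perm_eq s (flatten ss) &
    {in ss, forall b : seq T, size b <= block_bound m /\
      forall i, i < m -> (\sum_(x <- b) w i x = 0)%R}.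
Proof.
elim: m => [|m IH] w1 w0.
  exists [seq [:: x] | x <- s]; first by rewrite flatten_seq1.
  by move=> b /mapP[x xs ->].
have [i im x xs|i im|ss ps hss] := IH; [exact/w1/xs/ltnW | exact/w0/ltnW |].
have sub b : b \in ss -> {subset b <= s}.
  by move=> bss x xb; rewrite (perm_mem ps); apply/flattenP; exists b.
pose v (b : seq T) := (\sum_(x <- b) w m x)%R.
have [||sss psss hsss] := @zero_blocks1 _ v (block_bound m) (block_bound_gt0 m) ss.
- move=> b bss; have [bs _] := hss b bss; apply: le_trans (_ : (size b)%:Z <= _)%R; last by lia.
  have : {in b, forall x, (`|w m x| <= 1)%R} by move=> x /(sub b bss); apply: w1.
  rewrite /v; elim: (b) => [|x r IHr] h; first by rewrite big_nil.
  rewrite big_cons /=; have := h x (mem_head _ _).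
  have := IHr (fun y yr => h y (mem_behead (s := x :: r) yr)).
  by move: (\sum_(j <- r) w m j)%R => Z; lia.
- by rewrite /v -big_flatten /= -(perm_big _ ps) w0.
exists [seq flatten b | b <- sss].
  by rewrite flatten_flatten; apply: perm_trans ps _; apply: perm_flatten.
move=> b /mapP[bb bbs ->]; have [bb1 bb2] := hsss bb bbs.
have hb c : c \in bb -> c \in ss by move=> cb; rewrite (perm_mem psss); apply/flattenP; exists bb.
split=> [|i].
  rewrite size_flatten /shape sumnE big_map /=.
  apply: leq_trans (_ : size bb * block_bound m <= _); last by nia.
  elim: (bb) hb => [|c r IHr] hb; first by rewrite big_nil.
  rewrite big_cons /= mulSn leq_add ?(hss c (hb _ (mem_head _ _))).1 //.
  by apply: IHr => d dr; apply: hb; rewrite inE dr orbT.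
rewrite ltnS leq_eqVlt => /orP[/eqP ->|im]; first by rewrite big_flatten.
rewrite big_flatten big_seq big1 //= => c cb.
exact: (hss c (hb c cb)).2.
Qed.

Definition dist (x y : nat) : nat := (x - y) + (y - x).

Lemma posz_sum (s : seq nat) (F : nat -> nat) :
  ((\sum_(c <- s) F c)%N%:Z = \sum_(c <- s) (F c)%:Z)%R.
Proof. exact: (big_morph Posz PoszD erefl). Qed.

(** * A zero-sum block with slack brings a committee closer to a solution *)

Section Improve.

Variables (n m : nat) (u : nat -> nat -> bool).

Definition csum (S : nat -> bool) (i : nat) : nat := \sum_(c < n) (S c && u i c).

Lemma csumE S i : csum S i = \sum_(c <- iota 0 n) (S c && u i c).
Proof.
by rewrite /csum -(big_mkord xpredT (fun c => (S c && u i c) : nat)) /index_iota subn0.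
Qed.

Definition flip_on (U : seq nat) (S : nat -> bool) (c : nat) : bool := S c (+) (c \in U).

Variables (S Z : nat -> bool).

Definition gap (i : nat) : int := ((csum Z i)%:Z - (csum S i)%:Z)%R.

Definition sg (x : int) : int := if (0 < x)%R then 1%R else if (x < 0)%R then (-1)%R else 0%R.

Definition change (i c : nat) : int := (((Z c : nat)%:Z - (S c : nat)%:Z) * (u i c : nat)%:Z)%R.

(* [inl c] stands for flipping candidate [c], [inr i] for a unit of slack in coordinate [i]. *)
Definition weight (i : nat) (x : nat + nat) : int :=
  match x with inl c => change i c | inr j => if j == i then (- sg (gap i))%R else 0%R end.

Definition left_part (x : nat + nat) : option nat := if x is inl c then Some c else None.

Lemma sum_weight i b : (\sum_(x <- b) weight i x =
  \sum_(c <- pmap left_part b) change i c - sg (gap i) * (count_mem (inr i) b)%:Z)%R.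
Proof.
elim: b => [|[c|j] b IH]; first by rewrite !big_nil mulr0 subr0.
  by rewrite /= !big_cons IH add0n addrA.
rewrite /= big_cons IH -[inr j == inr i]/(j == i) /=.
by case: (j == i); [lia | rewrite add0r add0n].
Qed.

Definition moved : seq nat := [seq c <- iota 0 n | S c != Z c].

(** The moves that turn S into Z change coordinate j by [gap j] in total; as many slack units as the
    absolute value of the gap, each weighing minus its sign, bring the sum to zero. *)
Definition items : seq (nat + nat) :=
  map inl moved ++ flatten [seq nseq (absz (gap j)) (inr j) | j <- iota 0 m].

Lemma pmap_items : pmap left_part items = moved.
Proof.
rewrite pmap_cat (_ : pmap left_part (flatten _) = [::]) ?cats0.
  by elim: moved => //= c s ->.
elim: (iota 0 m) => //= j s IH; rewrite pmap_cat IH cats0.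
by elim: (absz _).
Qed.

Lemma count_items i : i < m -> count_mem (inr i) items = absz (gap i).
Proof.
move=> im; rewrite count_cat (_ : count _ (map _ _) = 0) ?add0n; last first.
  by rewrite count_map; apply/eqP; rewrite -leqn0 leqNgt -has_count; apply/hasPn.
have : i \in iota 0 m by rewrite mem_iota.
have := iota_uniq 0 m; elim: (iota 0 m) => //= j s IH /andP[js us].
rewrite count_cat count_nseq inE -[pred1 _ _]/(j == i) [i == j]eq_sym.
case: (j =P i) js => [->|_] js /=.
  rewrite mul1n => _; rewrite -[RHS]addn0; congr addn.
  apply/eqP; rewrite -leqn0 leqNgt -has_count; apply/hasPn => x /flattenP[t /mapP[l ls ->]].
  by move=> /nseqP[-> _]; apply/eqP => -[e]; rewrite -e ls in js.
by rewrite mul0n; apply: IH.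
Qed.

Lemma gapE i : gap i = (\sum_(c <- iota 0 n) change i c)%R.
Proof.
rewrite /gap !csumE !posz_sum -sumrB; apply: eq_bigr => c _.
by rewrite /change; case: (Z c); case: (S c); case: (u i c).
Qed.

Lemma sum_items i : i < m -> (\sum_(x <- items) weight i x = 0)%R.
Proof.
move=> im; rewrite sum_weight pmap_items count_items //.
have -> : (\sum_(c <- moved) change i c = gap i)%R.
  rewrite gapE big_filter big_mkcond; apply: eq_bigr => c _.
  by case: eqP => //= e; rewrite /change e subrr mul0r.
by rewrite /sg; case: ltP => [|h]; [lia | case: ltP; lia].
Qed.

(** Take the block that contains a slack unit of a violated coordinate, and flip the candidates in
    it. As the block sums to zero, the flips move each coordinate i towards its value for Z by
    exactly the number of slack units of i in the block. That number is at most the gap, so no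
    coordinate overshoots, and the chosen one strictly gains. *)
Lemma improve : (exists2 i, i < m & csum S i <> csum Z i) ->
  exists U, [/\ uniq U, all (fun c => c < n) U, size U <= block_bound m,
    forall i, i < m -> dist (csum (flip_on U S) i) (csum Z i) <= dist (csum S i) (csum Z i) &
    exists2 i, i < m & dist (csum (flip_on U S) i) (csum Z i) < dist (csum S i) (csum Z i)].
Proof.
move=> [i0 i0m ne].
have [i im x _|ss ps hss] := @zero_blocks _ weight m items _ sum_items.
  case: x => [c|j] /=; rewrite /change ?/sg.
    by case: (Z c); case: (S c); case: (u i c).
  by case: ifP => // _; case: ifP => // _; case: ifP.
have g0 : gap i0 != 0%R by rewrite /gap; lia.
have : inr i0 \in flatten ss.
  by rewrite -(perm_mem ps) -has_pred1 has_count count_items //; lia.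
move=> /flattenP[b bss i0b]; have [sb wb] := hss b bss.
have pb : perm_eq items (b ++ flatten (rem b ss)).
  by apply: perm_trans ps _; apply: (perm_flatten (perm_to_rem bss)).
exists (pmap left_part b); set U := pmap _ _.
have pU : perm_eq moved (U ++ pmap left_part (flatten (rem b ss))).
  by rewrite -pmap_items -pmap_cat; apply: perm_pmap.
have uU : uniq U.
  have : uniq moved by apply/filter_uniq/iota_uniq.
  by rewrite (perm_uniq pU) cat_uniq => /and3P[].
have Um c : c \in U -> c \in moved by move=> cU; rewrite (perm_mem pU) mem_cat cU.
have gapU i : i < m -> ((csum (flip_on U S) i)%:Z = (csum S i)%:Z + \sum_(c <- U) change i c)%R.
  move=> im.
  have -> : (\sum_(c <- U) change i c = \sum_(c <- iota 0 n | c \in U) change i c)%R.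
    rewrite -[RHS]big_filter; apply: perm_big; apply: uniq_perm => //.
      exact/filter_uniq/iota_uniq.
    move=> c; rewrite mem_filter; case cU : (c \in U) => //=.
    by have := Um c cU; rewrite mem_filter => /andP[_ ->].
  rewrite !csumE !posz_sum.
  rewrite [X in (_ + X)%R]big_mkcond -big_split; apply: eq_bigr => c _ /=.
  rewrite /flip_on /change; case cU : (c \in U); last by rewrite addbF addr0.
  have := Um c cU; rewrite mem_filter => /andP[].
  by case: (Z c); case: (S c); case: (u i c).
have cle i : i < m -> count_mem (inr i) b <= absz (gap i).
  by move=> im; rewrite -count_items // (permP pb) count_cat leq_addr.
have hd i : i < m -> dist (csum (flip_on U S) i) (csum Z i) + count_mem (inr i) b =
    dist (csum S i) (csum Z i).
  move=> im; have := gapU i im; have := cle i im; have := wb i im.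
  rewrite sum_weight -/U /gap /sg /dist.
  move: (\sum_(c <- U) _)%R (count_mem _ b) => X Y.
  by case: ltP => [|h1]; [lia | case: ltP; lia].
split=> //.
- by apply/allP => c /Um; rewrite mem_filter mem_iota => /and3P[].
- apply: leq_trans sb; rewrite size_pmap; apply: count_size.
- by move=> i im; rewrite -(hd i im) leq_addr.
exists i0 => //; rewrite -(hd i0 i0m) -[X in X < _]addn0 ltn_add2l -has_count has_pred1 //.
Qed.

End Improve.

(** * The routines compute keys, counts and the total violation *)

Section Candidates.

Variables (W : nat) (A : nat -> nat -> bool) (b p n : nat).
Hypothesis W0 : 0 < W.
Hypothesis bW : b + n * p <= W.
Hypothesis nW : n < W.
Notation ev := (eval W A).

Definition cbit (c i : nat) : bool := A 1 (b + c * p + i).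

Definition key (c : nat) : nat := iteri p (fun i v => v.*2 + cbit c i) (A 3 c).

Definition csize (a : nat) : nat := \sum_(c < n) A a c.

Definition ccount (a i : nat) : nat := \sum_(c < n) (A a c && cbit c i).

Lemma ccount_le a i : ccount a i <= n.
Proof.
rewrite -[X in _ <= X]card_ord -sum1_card; apply: leq_sum => c _.
by case: (_ && _).
Qed.

Lemma csize_le a : csize a <= n.
Proof. by rewrite -[X in _ <= X]card_ord -sum1_card; apply: leq_sum => c _; case: (A a c). Qed.

Lemma ev_Cbit c i : c < n -> i < p -> ev Cbit [:: b; p; c; i] = cbit c i.
Proof.
move=> cn ip; rewrite /Cbit -lock !evE //= !(ev_Mul, ev_Add) //; try nia.
by rewrite (_ : minn _ _ = b + c * p + i) //; nia.
Qed.

Lemma ev_Key c : 2 ^ p.+1 <= W -> c < n -> ev Key [:: b; p; c] = key c.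
Proof.
move=> pW cn; rewrite /Key -lock !evE //=.
pose K i := iteri i (fun i v => v.*2 + cbit c i) (A 3 c).
have KW i : K i < 2 ^ i.+1.
  rewrite /K; elim: i => [|i IH] /=; first by case: (A 3 c).
  by rewrite expnS; case: (cbit c i); lia.
apply: (iteri_inv (P := fun i v => v = K i)) => // i v ip ->.
have KW' : K i.+1 <= W.
  by apply: leq_trans (leq_trans (ltnW (KW i.+1)) _) pW; rewrite leq_exp2l.
have KS : K i.+1 = (K i).*2 + cbit c i by [].
rewrite KS in KW' *; rewrite ?evE //= ev_Cbit // !ev_Add //;
  move: KW'; rewrite -addnn; move: (K i) => x; case: (cbit c i) => /=; lia.
Qed.

Lemma ev_Find q : 2 ^ p.+1 <= W -> let v := ev Find [:: b; p; n; q] in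
  (v < n /\ key v = q) \/ (v = n /\ forall c, c < n -> key c <> q).
Proof.
move=> pW; rewrite /Find -lock !evE //=.
suff [h1|[h1 h2]] : let v := iteri n (fun i acc => ev (If (Eq (App3 Key (Var 0) (Var 1) (Var 6)) (Var 3)) (Var 6) (Var 4)) ([:: b; p; n; q] ++ [:: acc; n; i])) n in
  (v < n /\ key v = q) \/ (v = n /\ forall c, c < n -> key c <> q); [by left|by right|].
apply: (iteri_inv (P := fun i v => (v < n /\ key v = q) \/ (v = n /\ forall c, c < i -> key c <> q))).
  by right.
move=> i v iN h; rewrite ?evE //= ev_Key //; case: (key i =P q) => [e|ne] /=; first by left.
case: h => [h|[h1 h2]]; [by left|right; split=> // c]; rewrite ltnS leq_eqVlt => /orP[/eqP -> //|].
exact: h2.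
Qed.

Lemma ev_Size a : ev (Size a) [:: n] = csize a.
Proof.
rewrite /Size -lock !evE //=.
have sW i : i <= n -> \sum_(c < i) (A a c : nat) <= i.
  by move=> _; rewrite -[X in _ <= X]card_ord -sum1_card; apply: leq_sum => c _; case: (A a c).
apply: (iteri_inv (P := fun i v => v = \sum_(c < i) A a c)) => [|i v iN ->]; first by rewrite big_ord0.
rewrite ?evE //= big_ord_recr /=; have := sW i (ltnW iN).
by move: (\sum_(c < i) _) => S; case: (A a i) => /=; [case: eqP|]; lia.
Qed.

Lemma ev_Count a i : i < p -> ev (Count a) [:: b; p; n; i] = ccount a i.
Proof.
move=> ip; rewrite /Count -lock !evE //=.
have sW j : j <= n -> \sum_(c < j) (A a c && cbit c i : nat) <= j.
  by move=> _; rewrite -[X in _ <= X]card_ord -sum1_card; apply: leq_sum => c _; case: (_ && _).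
apply: (iteri_inv (P := fun j v => v = \sum_(c < j) (A a c && cbit c i))) => [|j v jN ->].
  by rewrite big_ord0.
rewrite ?evE //= big_ord_recr /=; have := sW j (ltnW jN); rewrite ev_Cbit //.
move: (\sum_(c < j) _) => S.
by case: (A a j) => /=; case: (cbit j i) => /=; try case: eqP; lia.
Qed.

Variables (k : nat) (q : nat -> nat) (B : nat -> seq bool).
Hypothesis kn : k <= n.
Hypothesis n0 : 0 < n.
Hypothesis hq : forall j, j < 4 * p ->
  [/\ code_at A (q j) (B j), q j.+1 = q j + size (B j) + 1 & q j + size (B j) < W].
Hypothesis den_num : forall i, i < p -> bval (B (4 * i).+1) <= n -> bval (B (4 * i)) <= n.
Hypothesis nnW : n + p * (n * n) <= W.

Lemma ev_Pos i : i <= p -> ev Pos [:: q 0; i] = q (4 * i).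
Proof.
move=> ip; rewrite /Pos -lock !evE //=.
apply: (iteri_inv (P := fun i v => v = q (4 * i))) => // j v ji ->.
have e x : x < 4 * p -> ev Endp [:: q x] = q x.+1.
  by move=> xp; have [h1 h2 h3] := hq xp; rewrite (ev_Endp W0 h1 h3) h2.
have -> : 4 * j.+1 = (4 * j).+4 by lia.
by rewrite ?evE //= !e //; lia.
Qed.

(** A reduced denominator above n cannot occur for a nonempty committee of at most n members. The
    constant 1 records such a constraint as violated and keeps its possibly exponential numbers out
    of the unary products, so every term is at most n^2. *)
Definition cterm (a i : nat) : nat :=
  let num := bval (B (4 * i)) in let den := bval (B (4 * i).+1) in
  if den <= n then dist (ccount a i * den) (k * num) else 1.

Definition cviol (a : nat) : nat := dist (csize a) k + \sum_(i < p) cterm a i.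

Lemma cterm_le a i : i < p -> cterm a i <= n * n.
Proof.
move=> ip; rewrite /cterm; case: ifP => [h|_]; last by nia.
have := den_num ip h; have := ccount_le a i; rewrite /dist; nia.
Qed.

Lemma ev_Term a i : i < p -> ev (Term a) [:: b; p; n; k; i; q (4 * i)] = cterm a i.
Proof.
move=> ip; rewrite /Term -lock !evE //=.
have i1 : 4 * i < 4 * p by lia.
have i2 : (4 * i).+1 < 4 * p by lia.
have [h1 h2 h3] := hq i1; have [h4 h5 h6] := hq i2.
rewrite (ev_Endp W0 h1 h3) -h2 (ev_Nval W0 h4 h6) (ev_Nval W0 h1 h3).
rewrite ev_Leq // /cterm ev_One // ev_Count //.
(* A saturated denominator reads as W > n, so the cap does not falsify the test. *)
have -> : (minn (bval (B (4 * i).+1)) W <= n) = (bval (B (4 * i).+1) <= n) by lia.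
case: ifP => [|h]; first by case: leqP.
have {}h : bval (B (4 * i).+1) <= n by case: leqP h.
have d := den_num ip h; have c := ccount_le a i.
have nW2 : n * n <= W by nia.
rewrite h !ev_Mul; try lia.
have x1 : ccount a i * bval (B (4 * i).+1) <= W by nia.
have x2 : k * bval (B (4 * i)) <= W by nia.
rewrite ev_Dist; try lia.
rewrite !(minn_idPl _) //; try lia.
Qed.

Lemma ev_Viol a : ev (Viol a) [:: b; p; n; k; q 0] = cviol a.
Proof.
rewrite /Viol -lock !evE //= ev_Size.
have sl := csize_le a; rewrite ev_Dist; try lia.
have sW i : i <= p -> \sum_(j < i) cterm a j <= i * (n * n).
  move=> ip; rewrite -[X in X * _]card_ord -sum_nat_const; apply: leq_sum => j _.
  by apply: cterm_le; apply: leq_trans ip.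
apply: (iteri_inv (P := fun i v => v = dist (csize a) k + \sum_(j < i) cterm a j)).
  by rewrite big_ord0 addn0.
move=> i v ip ->; rewrite ?evE //= ev_Pos 1?ltnW // ev_Term //.
have dn : dist (csize a) k <= n by rewrite /dist; lia.
have m1 : i.+1 * (n * n) <= p * (n * n) by rewrite leq_mul2r ip orbT.
have := sW i.+1 ip; rewrite big_ord_recr /=.
move: (\sum_(j < i) _) (i.+1 * _) (p * _) m1 nnW dn => S X Y m1 h dn h'.
by rewrite ev_Add; lia.
Qed.

End Candidates.

(** * Codes of flip sequences and interchangeable candidates *)

Lemma digit_code G ds : 0 < G -> all (fun d => d < G) ds ->
  exists2 code, code < G ^ size ds & forall j, j < size ds -> digit code j G = nth 0 ds j.
Proof.
move=> G0; elim: ds => [|d ds IH] /=; first by exists 0.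
move=> /andP[dG /IH [x xG h]]; exists (d + x * G).
  rewrite expnS; apply: leq_trans (_ : x.+1 * G <= _); first by rewrite mulSn; lia.
  by rewrite mulnC leq_mul2l xG orbT.
case=> [|j] jd; first by rewrite /digit /= addnC modnMDl modn_small.
rewrite /digit iterSr addnC divnMDl // divn_small // addn0.
exact: h.
Qed.

Definition lcode (l : bool * seq bool) : nat := foldl (fun v (b : bool) => v.*2 + b) (l.1 : nat) l.2.

Lemma lcode_inj l1 l2 : size l1.2 = size l2.2 -> lcode l1 = lcode l2 -> l1 = l2.
Proof.
case: l1 l2 => [b1 s1] [b2 s2] /=; rewrite /lcode /=.
elim/last_ind: s1 s2 => [|s1 x1 IH] s2.
  by move=> /esym /size0nil -> /=; case: b1; case: b2.
elim/last_ind: s2 => [|s2 x2 _]; first by rewrite size_rcons.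
rewrite !size_rcons !foldl_rcons => -[ss] e.
have [e1 e2] : foldl (fun v (b : bool) => v.*2 + b) (b1 : nat) s1 =
   foldl (fun v (b : bool) => v.*2 + b) (b2 : nat) s2 /\ x1 = x2.
  by move: e; move: (foldl _ _ s1) (foldl _ _ s2) => v1 v2; case: x1; case: x2 => /=; lia.
by rewrite e2; have [-> ->] := IH s2 ss e1.
Qed.

Section Labels.

Variables (n p : nat) (bit : nat -> nat -> bool).

Definition label (S : nat -> bool) (c : nat) : bool * seq bool := (S c, [seq bit c i | i <- iota 0 p]).

Definition labels (S : nat -> bool) := [seq label S c | c <- iota 0 n].

Definition skey (S : nat -> bool) (c : nat) : nat := lcode (label S c).

Definition flip (c : nat) (S : nat -> bool) (x : nat) : bool := if x == c then ~~ S x else S x.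

Lemma skeyE (S : nat -> bool) c : iteri p (fun i v => v.*2 + bit c i) (S c) = skey S c.
Proof.
rewrite /skey /lcode /label /=; elim: p => // p' IH.
by rewrite [LHS]/= IH -[in RHS]addn1 iotaD map_cat foldl_cat.
Qed.

Lemma skey_inj S S' c c' : skey S c = skey S' c' -> label S c = label S' c'.
Proof. by apply: lcode_inj; rewrite !size_map. Qed.

Lemma eq_labels S S' : (forall c, c < n -> S c = S' c) -> labels S = labels S'.
Proof.
move=> h; apply/eq_in_map => c; rewrite mem_iota => /andP[_ cn].
by rewrite /label h.
Qed.

(** A flip replaces one label by another. In this exchange form, with a label added on both sides,
    nothing has to be removed from a multiset. *)
Lemma perm_labels_flip S c : c < n ->
  perm_eq (label S c :: labels (flip c S)) (label (flip c S) c :: labels S).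
Proof.
move=> cn; have ci : c \in iota 0 n by rewrite mem_iota.
have p0 := perm_to_rem ci; rewrite /labels.
apply: (perm_trans (y := [:: label S c, label (flip c S) c & [seq label S x | x <- rem c (iota 0 n)]])).
  rewrite perm_cons; apply: perm_trans (perm_map _ p0) _; rewrite /= perm_cons.
  rewrite (_ : map _ _ = [seq label S x | x <- rem c (iota 0 n)]) //.
  apply/eq_in_map => x; rewrite (rem_filter _ (iota_uniq 0 n)) mem_filter => /andP[/= /negbTE xc _].
  by rewrite /label /flip xc.
apply: (perm_trans (y := [:: label (flip c S) c, label S c & [seq label S x | x <- rem c (iota 0 n)]])).
  by apply/permPl; apply: (perm_catCA [:: _] [:: _]).
by rewrite perm_cons perm_sym; apply: (perm_map (label S) p0).
Qed.

(** The machine flips whichever candidate its search returns, the argument flips a chosen one. Equal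
    labels keep the two committees equal as multisets of labels, and the objective sees no more than
    these. *)
Lemma perm_labels_flip2 S1 S2 c1 c2 : c1 < n -> c2 < n -> label S1 c1 = label S2 c2 ->
  perm_eq (labels S1) (labels S2) -> perm_eq (labels (flip c1 S1)) (labels (flip c2 S2)).
Proof.
move=> h1 h2 e pe; rewrite -(perm_cons (label S1 c1)).
apply: perm_trans (perm_labels_flip S1 h1) _; rewrite perm_sym e.
apply: perm_trans (perm_labels_flip S2 h2) _; rewrite perm_sym.
rewrite (_ : label (flip c1 S1) c1 = label (flip c2 S2) c2) ?perm_cons //.
by case: e => e1 e2; rewrite /label /flip !eqxx e1 e2.
Qed.

Lemma perm_labels_match S1 S2 c : c < n -> perm_eq (labels S1) (labels S2) ->
  exists2 c', c' < n & skey S2 c' = skey S1 c.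
Proof.
move=> cn pe; have : label S1 c \in labels S2.
  by rewrite -(perm_mem pe); apply/mapP; exists c; rewrite // mem_iota.
by case/mapP=> c'; rewrite mem_iota => /andP[_ c'n] e; exists c' => //; rewrite /skey e.
Qed.

(* Coordinate [p] is constantly 1, so that its sum is the size of the committee. *)
Definition coordinate (i c : nat) : bool := (i == p) || bit c i.

Lemma csum_labels S i : i <= p ->
  csum n coordinate S i = \sum_(l <- labels S) (l.1 && ((i == p) || nth false l.2 i)).
Proof.
move=> ip; rewrite csumE /labels big_map; apply: eq_bigr => c _ /=; rewrite /coordinate.
case: eqP => //= /eqP ne.
by rewrite (nth_map 0) ?size_iota ?nth_iota ?add0n // ltn_neqAle ne.
Qed.

Lemma csum_perm S S' i : i <= p -> perm_eq (labels S) (labels S') ->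
  csum n coordinate S i = csum n coordinate S' i.
Proof. by move=> ip pe; rewrite !csum_labels //; apply: perm_big. Qed.

End Labels.

Section Objective.

Variables (n p k : nat) (bit : nat -> nat -> bool) (num den : nat -> nat).
Notation csum := (csum n (coordinate p bit)).

Definition obj (S : nat -> bool) : nat :=
  dist (csum S p) k +
  \sum_(i < p) (if den i <= n then dist (csum S i * den i) (k * num i) else 1).

(** The condition on [den i] matches the constant penalty in [obj]. It excludes no nonempty perfect
    committee, because there the reduced denominator divides k. *)
Definition solution (S : nat -> bool) : Prop :=
  csum S p = k /\ forall i, i < p -> den i <= n /\ csum S i * den i = k * num i.

Lemma obj_eq0 S : obj S = 0 <-> solution S.
Proof.
split=> [|[s1 s2]].
  rewrite /obj /dist => /eqP; rewrite addn_eq0 sum_nat_eq0 => /andP[/eqP h1 /forallP h2].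
  split=> [|i ip]; first by lia.
  by have /= := h2 (Ordinal ip); case: leqP => // h /eqP; lia.
rewrite /obj s1 big1 ?addn0 => [|i _]; first by rewrite /dist; lia.
by have [-> ->] := s2 i (ltn_ord i); rewrite /dist; lia.
Qed.

Lemma obj_perm S S' : perm_eq (labels n p bit S) (labels n p bit S') -> obj S = obj S'.
Proof.
move=> pe; rewrite /obj (csum_perm (leqnn p) pe); congr addn.
by apply: eq_bigr => i _; rewrite (csum_perm (ltnW (ltn_ord i)) pe).
Qed.

Lemma sum_ltn m (a b : nat -> nat) i : i < m -> (forall j, j < m -> a j <= b j) -> a i < b i ->
  \sum_(j < m) a j < \sum_(j < m) b j.
Proof.
move=> im h1 h2; rewrite (bigD1 (Ordinal im)) //= [X in _ < X](bigD1 (Ordinal im)) //= -addSn; apply: leq_add => //.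
by apply: leq_sum => j _; apply: h1.
Qed.

(** A solution Z satisfies k * num = csum Z * den and excludes the constant penalties, so the
    objective becomes a sum of distances to the counts of Z with weights [den i], and weight 1 for
    the size. The weights are positive, so progress in the coordinates is progress of the
    objective. *)
Lemma obj_improve Z S : solution Z -> (forall i, i < p -> 0 < den i) -> obj S <> 0 ->
  exists U, [/\ uniq U, all (fun c => c < n) U, size U <= block_bound p.+1 &
    obj (flip_on U S) < obj S].
Proof.
move=> [z1 z2] d0 nz.
pose wt i := if i == p then 1 else den i.
have objE S' : obj S' = \sum_(i < p.+1) wt i * dist (csum S' i) (csum Z i).
  rewrite big_ord_recr /= /wt eqxx mul1n z1 addnC /obj; congr addn.
  apply: eq_bigr => i _; have [-> <-] := z2 i (ltn_ord i).
  by rewrite ltn_eqF //; rewrite /dist -!mulnBl -mulnDl mulnC.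
have wt0 i : i < p.+1 -> 0 < wt i.
  by rewrite /wt; case: eqP => // /eqP ne ip; apply: d0; rewrite ltn_neqAle ne.
have [U [u1 u2 u3 u4 [i ip u5]]] : exists U, [/\ uniq U, all (fun c => c < n) U,
    size U <= block_bound p.+1,
    forall i, i < p.+1 -> dist (csum (flip_on U S) i) (csum Z i) <= dist (csum S i) (csum Z i) &
    exists2 i, i < p.+1 & dist (csum (flip_on U S) i) (csum Z i) < dist (csum S i) (csum Z i)].
  apply: improve; case: (boolP [forall i : 'I_p.+1, csum S i == csum Z i]) => h.
    case: nz; rewrite objE big1 // => i _; have /eqP -> := forallP h i.
    by rewrite /dist subnn muln0.
  by have /forallPn[i /eqP ne] := h; exists (i : nat).
exists U; split=> //; rewrite !objE.
apply: (@sum_ltn _ (fun i => wt i * dist (csum (flip_on U S) i) (csum Z i))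
  (fun i => wt i * dist (csum S i) (csum Z i)) i ip) => [j jp|].
  by rewrite leq_mul2l u4 ?orbT.
by rewrite ltn_pmul2l // wt0.
Qed.

End Objective.

(** * Local search *)

Definition SSkip := SFor Zero SGrow.
Definition CopyArr (src dst nv d : nat) :=
  SFor (Var nv) (SWrite dst (Var d.+1) (Bit src (Var d.+1))).

(* The context is p, position of k, position of n, base of the candidate bits, k, n,
   G, N, base of the target distribution; loops add their bound and index. *)
Definition Apply := SFor (Var 6)
  (SLet (App4 Find (Var 3) (Var 0) (Var 5) (App3 Digit (Var 12) (Var 14) (Var 6)))
    (SIf (App2 Leq (Succ (Var 15)) (Var 5))
      (SWrite 3 (Var 15) (Eq (Bit 3 (Var 15)) Zero)) SSkip)).
Definition ViolE a := App5 (Viol a) (Var 3) (Var 0) (Var 5) (Var 4) (Var 8).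
Definition Body := SSeq (CopyArr 2 3 5 13) (SSeq Apply
  (SIf (App2 Leq (Succ (ViolE 3)) (ViolE 2)) (CopyArr 3 2 5 13) SSkip)).
Definition Search := SFor Cap (SFor (Var 7) Body).

Lemma exec_SSeq c1 c2 ctx m : exec (SSeq c1 c2) ctx m = exec c2 ctx (exec c1 ctx m).
Proof. by []. Qed.
Lemma exec_SWrite a e1 e2 ctx m : exec (SWrite a e1 e2) ctx m =
  write m a (eval m.1 m.2 e1 ctx)
    (eval m.1 m.2 e2 (ctx ++ [:: eval m.1 m.2 e1 ctx]) != 0).
Proof. by []. Qed.
Lemma exec_SIf e c1 c2 ctx m : exec (SIf e c1 c2) ctx m =
  if eval m.1 m.2 e ctx == 0 then exec c2 ctx m else exec c1 ctx m.
Proof. by []. Qed.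
Lemma exec_SFor e c ctx m : exec (SFor e c) ctx m =
  iteri (eval m.1 m.2 e ctx) (fun i => exec c (ctx ++ [:: eval m.1 m.2 e ctx; i])) m.
Proof. by []. Qed.
Lemma exec_SLet e c ctx m : exec (SLet e c) ctx m = exec c (ctx ++ [:: eval m.1 m.2 e ctx]) m.
Proof. by []. Qed.
Lemma exec_SGrow ctx m : exec SGrow ctx m = (m.1.+1, m.2).
Proof. by []. Qed.
Lemma exec_SSkip ctx m : exec SSkip ctx m = m.
Proof. by []. Qed.

Arguments exec : simpl never.

Section SearchExec.

Variables (W : nat) (A : nat -> nat -> bool).
Variables (p x1 x2 b k n G N x0 : nat) (q : nat -> nat) (B : nat -> seq bool).
Hypothesis W0 : 0 < W.
Hypothesis bW : b + n * p <= W.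
Hypothesis nW : n < W.
Hypothesis pW : 2 ^ p.+1 <= W.
Hypothesis kn : k <= n.
Hypothesis n0 : 0 < n.
Hypothesis q0 : q 0 = x0.
Hypothesis hq : forall j, j < 4 * p ->
  [/\ code_at A (q j) (B j), q j.+1 = q j + size (B j) + 1 & q j + size (B j) < W].
Hypothesis den_num : forall i, i < p -> bval (B (4 * i).+1) <= n -> bval (B (4 * i)) <= n.
Hypothesis nnW : n + p * (n * n) < W.
Hypothesis GW : 0 < G <= W.
Hypothesis pG : 2 ^ p.+1 < G.
Hypothesis NW : N <= W.

Definition bit (c i : nat) : bool := A 1 (b + c * p + i).
Notation objective := (obj n p k bit (fun i => bval (B (4 * i))) (fun i => bval (B (4 * i).+1))).
Notation labels := (labels n p bit).

Definition input_kept (m : memory) : Prop := m.1 = W /\ forall a x, a < 2 -> m.2 a x = A a x.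

Lemma inv_key m c : input_kept m -> key m.2 b p c = skey p bit (m.2 3) c.
Proof.
move=> [_ h]; rewrite -skeyE; apply: iteri_eq => i y _; congr (_ + _).
by rewrite /cbit h.
Qed.

Lemma inv_find m d : input_kept m -> let v := eval W m.2 Find [:: b; p; n; d] in
  (v < n /\ skey p bit (m.2 3) v = d) \/ (v = n /\ forall c, c < n -> skey p bit (m.2 3) c <> d).
Proof.
move=> im; have [h|[h1 h2]] := ev_Find m.2 W0 bW nW d pW; rewrite /= ?inv_key //; [left|right].
  by rewrite -inv_key.
by split=> // c cn; rewrite -inv_key //; apply: h2.
Qed.

Lemma inv_code m x bs : input_kept m -> code_at A x bs -> code_at m.2 x bs.
Proof.
move=> [_ h] [h1 h2 h3]; rewrite /code_at /sep !h //; split=> // i ib; rewrite !h //.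
  exact: h1.
exact: h2.
Qed.

Lemma inv_viol m a : input_kept m -> eval W m.2 (Viol a) [:: b; p; n; k; x0] = objective (m.2 a).
Proof.
move=> im; have [_ h] := im; rewrite -q0 (@ev_Viol _ _ _ _ _ W0 bW nW k q B kn n0) //; last exact: ltnW.
  rewrite /cviol /obj; congr (_ + _).
    by congr dist; apply: eq_bigr => c _; rewrite /coordinate eqxx andbT.
  apply: eq_bigr => i _; rewrite /cterm; case: ifP => // _; congr dist; congr muln.
  apply: eq_bigr => c _; rewrite /cbit (h 1) // /coordinate ltn_eqF //.
by move=> j jp; have [h1 h2 h3] := hq jp; split=> //; apply: inv_code.
Qed.

(** Strictness is used twice: [Succ] does not saturate when two violations are compared, and W
    sweeps with an improvement in each exhaust any violation. *)
Lemma obj_lt S : objective S < W.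
Proof.
have cs i : csum n (coordinate p bit) S i <= n.
  rewrite -[X in _ <= X]card_ord -sum1_card; apply: leq_sum => c _; by case: (_ && _).
have t i : i < p -> (if bval (B (4 * i).+1) <= n
    then dist (csum n (coordinate p bit) S i * bval (B (4 * i).+1)) (k * bval (B (4 * i))) else 1) <= n * n.
  move=> ip; case: ifP => [h|_]; last by nia.
  by have := den_num ip h; have := cs i; rewrite /dist; nia.
have : objective S <= n + p * (n * n).
  rewrite /obj; apply: leq_add; first by have := cs p; rewrite /dist; lia.
  by rewrite -[X in _ <= X * _]card_ord -sum_nat_const; apply: leq_sum => i _; apply: t.
by lia.
Qed.

Lemma exec_copy src dst j code m : input_kept m -> src != dst ->
  let m' := exec (CopyArr src dst 5 13) [:: p; x1; x2; b; k; n; G; N; x0; W; j; N; code] m in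
  m'.1 = m.1 /\ forall a x, m'.2 a x = if (a == dst) && (x < n) then m.2 src x else m.2 a x.
Proof.
move=> im sd; rewrite /= /CopyArr exec_SFor !evE /=.
apply: (iteri_inv (P := fun i m' => m'.1 = m.1 /\ forall a x, m'.2 a x =
  if (a == dst) && (x < i) then m.2 src x else m.2 a x)).
  by split=> // a x; rewrite ltn0 andbF.
move=> i m' iN [h1 h2]; rewrite exec_SWrite !evE /=; split=> // a x.
rewrite h2 (negbTE sd) /= !h2 ltnS.
case: (a =P dst) => //= _; case: (ltngtP x i) => //= ->.
by case: (m.2 src i).
Qed.

Notation ctx13 j code := [:: p; x1; x2; b; k; n; G; N; x0; W; j; N; code].

Lemma exec_apply_step j code i m : input_kept m -> code <= W ->
  let m' := exec (SLet (App4 Find (Var 3) (Var 0) (Var 5) (App3 Digit (Var 12) (Var 14) (Var 6)))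
    (SIf (App2 Leq (Succ (Var 15)) (Var 5))
      (SWrite 3 (Var 15) (Eq (Bit 3 (Var 15)) Zero)) SSkip)) (ctx13 j code ++ [:: G; i]) m in
  [/\ input_kept m', forall x, m'.2 2 x = m.2 2 x &
    (exists c, [/\ c < n, skey p bit (m.2 3) c = digit code i G &
        forall x, m'.2 3 x = flip c (m.2 3) x]) \/
    ((forall c, c < n -> skey p bit (m.2 3) c <> digit code i G) /\ m' = m)].
Proof.
move=> im cW; have [im1 im2] := im; rewrite /= exec_SLet exec_SIf im1 !evE //=.
rewrite (ev_Digit _ W0 i GW cW).
have := inv_find (digit code i G) im; set c := eval _ _ Find _ => /= h.
have cn : c <= n by case: h => [[/ltnW]|[->]].
rewrite (_ : (c == W) = false) ?ev_Leq //; last by lia.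
case: h => [[h1 h2]|[h1 h2]].
  rewrite h1 /= exec_SWrite im1 !evE //=; split; first split=> //=.
  - by move=> a x a2; rewrite /= ifF ?im2 //; lia.
  - by [].
  left; exists c; split=> // x; rewrite /flip /=.
  by case: (x =P c) => // ->; case: (m.2 3 c).
by rewrite h1 ltnn /= exec_SSkip; split=> //; right.
Qed.

Lemma exec_apply_frame j code m : input_kept m -> code <= W ->
  let m' := exec Apply (ctx13 j code) m in input_kept m' /\ forall x, m'.2 2 x = m.2 2 x.
Proof.
move=> im cW; have [im1 _] := im; rewrite /= /Apply exec_SFor im1 !evE /=.
apply: (iteri_inv (P := fun i m' => input_kept m' /\ forall x, m'.2 2 x = m.2 2 x)) => // i m' _ [h1 h2].
have [h3 h4 _] := exec_apply_step j i h1 cW; split=> // x.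
by rewrite -h2 -h4.
Qed.

(** After i digits the trial committee agrees, as a multiset of labels, with [S0] after the first i
    flips of [U]. The actual candidates flipped may differ from those in [U]. *)
Lemma exec_apply_perm j code m U S0 : input_kept m -> code <= W ->
  uniq U -> all (fun c => c < n) U -> size U <= G ->
  (forall i, i < G -> digit code i G = nth (2 ^ p.+1) [seq skey p bit S0 c | c <- U] i) ->
  perm_eq (labels S0) (labels (m.2 3)) ->
  perm_eq (labels (flip_on U S0)) (labels ((exec Apply (ctx13 j code) m).2 3)).
Proof.
move=> im cW uU Un sU hd pe; have [im1 _] := im; rewrite /= /Apply exec_SFor im1 !evE /=.
suff : let m' := iteri G (fun i => exec (SLet (App4 Find (Var 3) (Var 0) (Var 5) (App3 Digit (Var 12) (Var 14) (Var 6)))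
    (SIf (App2 Leq (Succ (Var 15)) (Var 5))
      (SWrite 3 (Var 15) (Eq (Bit 3 (Var 15)) Zero)) SSkip)) (ctx13 j code ++ [:: G; i])) m in
    input_kept m' /\ perm_eq (labels (flip_on (take G U) S0)) (labels (m'.2 3)).
  by case=> _; rewrite take_oversize.
apply: (iteri_inv (P := fun i m' => input_kept m' /\
  perm_eq (labels (flip_on (take i U) S0)) (labels (m'.2 3)))) => [|i m' iG [h1 h2]].
  split=> //; rewrite take0 (_ : labels (flip_on [::] S0) = labels S0) //.
  by apply: eq_labels => c _; rewrite /flip_on addbF.
have [h3 _ h4] := exec_apply_step j i h1 cW; split=> //.
have klt S c : skey p bit S c < 2 ^ p.+1.
  rewrite -skeyE; elim: (p) => [|p' IH]; first by case: (S c).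
  by rewrite expnS /=; case: (bit c p'); lia.
(* Beyond the end of [U] the digit exceeds every key, so the search fails and nothing is flipped. *)
case: (ltnP i (size U)) => iU; last first.
  case: h4 => [[c [c1 c2 _]]|[_ ->]].
    by have := klt (m'.2 3) c; rewrite c2 hd // nth_default ?size_map // ltnn.
  by rewrite take_oversize in h2 *; rewrite ?take_oversize // ltnW.
pose c := nth 0 U i; have cn : c < n by apply: (allP Un); apply: mem_nth.
have cU : c \notin take i U.
  apply/negP => h; have := uU; rewrite -(cat_take_drop i U) cat_uniq => /and3P[_ /hasPn h' _].
  by have := h' c; rewrite h (drop_nth 0 iU) mem_head => /(_ isT).
(* [U] has no repetitions, so its next candidate has not been flipped yet and still has the key it
   had in [S0]. *)
have kc : skey p bit (flip_on (take i U) S0) c = digit code i G.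
  by rewrite hd // (nth_map 0) // /skey /label /flip_on (negbTE cU) addbF.
case: h4 => [[c' [c1 c2 c3]]|[h _]]; last first.
  have [c' c'n e] := perm_labels_match cn h2.
  by case: (h c' c'n); rewrite e.
have e1 : labels (flip_on (take i.+1 U) S0) = labels (flip c (flip_on (take i U) S0)).
  apply: eq_labels => x _; rewrite /flip_on /flip (take_nth 0 iU) mem_rcons inE.
  by case: (x =P c) => //= ->; rewrite (negbTE cU) addbT addbF.
rewrite e1 (eq_labels _ _ (fun x _ => c3 x)).
apply: perm_labels_flip2 => //; apply: (skey_inj (p := p) (bit := bit)).
by rewrite kc c2.
Qed.

Lemma exec_body j code m : input_kept m -> code <= W ->
  let m' := exec Body (ctx13 j code) m in
  [/\ input_kept m', objective (m'.2 2) <= objective (m.2 2),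
    (forall c, c < n -> m'.2 2 c = m.2 2 c) \/ objective (m'.2 2) < objective (m.2 2) &
    forall U S0, (forall c, c < n -> m.2 2 c = S0 c) ->
      uniq U -> all (fun c => c < n) U -> size U <= G ->
      (forall i, i < G -> digit code i G = nth (2 ^ p.+1) [seq skey p bit S0 c | c <- U] i) ->
      objective (m'.2 2) <= objective (flip_on U S0)].
Proof.
move=> im cW; rewrite /= /Body exec_SSeq.
set m1 := exec (CopyArr 2 3 5 13) _ m.
have [e1 e2] := exec_copy j code im (isT : 2 != 3).
have im1 : input_kept m1.
  split=> [|a x a2]; first by rewrite e1 im.1.
  by rewrite e2 ifF ?im.2 //; lia.
have m12 x : m1.2 2 x = m.2 2 x by rewrite e2.
have m13 x : x < n -> m1.2 3 x = m.2 2 x by move=> xn; rewrite e2 xn.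
rewrite exec_SSeq; set m2 := exec Apply _ m1.
have [im2 m22] := exec_apply_frame j im1 cW.
have o2 : objective (m2.2 2) = objective (m.2 2).
  by apply: obj_perm; rewrite (@eq_labels n p bit (m2.2 2) (m.2 2)) // => x _; rewrite m22 m12.
have pm2 U S0 : (forall c, c < n -> m.2 2 c = S0 c) ->
      uniq U -> all (fun c => c < n) U -> size U <= G ->
      (forall i, i < G -> digit code i G = nth (2 ^ p.+1) [seq skey p bit S0 c | c <- U] i) ->
      objective (m2.2 3) = objective (flip_on U S0).
  move=> h uU Un sU hd; apply: obj_perm; rewrite perm_sym.
  apply: exec_apply_perm => //.
  by rewrite (@eq_labels n p bit S0 (m1.2 3)) // => c cn; rewrite m13 ?h.
rewrite exec_SIf; have [im21 _] := im2; rewrite im21 /ViolE !evE //= !inv_viol //.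
rewrite (ltn_eqF (obj_lt _)) ev_Leq //.
case: ltnP => o23 /=; last first.
  rewrite exec_SSkip; split=> //; first by rewrite o2.
    by left=> c cn; rewrite m22 m12.
  by move=> U S0 *; rewrite -(pm2 U S0).
have [f1 f2] := exec_copy j code im2 (isT : 3 != 2).
set m3 := exec _ _ _ in f1 f2 *.
have o3 : objective (m3.2 2) = objective (m2.2 3).
  by apply: obj_perm; rewrite (@eq_labels n p bit (m3.2 2) (m2.2 3)) // => x xn; rewrite f2 xn.
split.
- split=> [|a x a2]; first by rewrite f1 im2.1.
  by rewrite f2 ifF ?im2.2 //; lia.
- by rewrite o3 -o2 ltnW.
- by right; rewrite o3 -o2.
by move=> U S0 *; rewrite o3 -(pm2 U S0).
Qed.

(** The improving code belongs to the committee at the start of the sweep. When its turn comes,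
    either that committee is still in place, or an earlier code has already lowered the objective;
    later codes never raise it. One sweep therefore gains at least 1. *)
Lemma exec_codes j m : input_kept m ->
  let m' := exec (SFor (Var 7) Body) [:: p; x1; x2; b; k; n; G; N; x0; W; j] m in
  [/\ input_kept m', objective (m'.2 2) <= objective (m.2 2) &
    forall Z, G ^ G <= N -> block_bound p.+1 <= G ->
      solution n p k bit (fun i => bval (B (4 * i))) (fun i => bval (B (4 * i).+1)) Z ->
      (forall i, i < p -> 0 < bval (B (4 * i).+1)) ->
      objective (m.2 2) <> 0 -> objective (m'.2 2) < objective (m.2 2)].
Proof.
move=> im; have [im1 _] := im; rewrite /= exec_SFor im1 !evE /=.
set F := fun i => _.
have hP : forall i, i <= N -> let m' := iteri i F m in
   [/\ input_kept m', objective (m'.2 2) <= objective (m.2 2) &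
     (forall c, c < n -> m'.2 2 c = m.2 2 c) \/ objective (m'.2 2) < objective (m.2 2)].
  move=> i iN; apply: (iteri_inv (P := fun _ m' => [/\ input_kept m', objective (m'.2 2) <= objective (m.2 2) &
     (forall c, c < n -> m'.2 2 c = m.2 2 c) \/ objective (m'.2 2) < objective (m.2 2)])).
    by split=> //; left.
  move=> l m' li [h1 h2 h3].
  have [g1 g2 g3 _] := @exec_body j l m' h1 ltac:(lia).
  split=> //; first exact: leq_trans h2.
  case: h3 => h3; last by right; apply: leq_ltn_trans h3.
  case: g3 => g3; last by right; apply: leq_trans h2.
  by left=> c cn; rewrite g3 // h3.
have [h1 h2 _] := hP N (leqnn N); split=> // Z GN bG sZ d0 nz.
have [U [u1 u2 u3 u4]] := obj_improve sZ d0 nz.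
have G0 : 0 < G by lia.
(* Short sequences are padded to G digits with 2 ^ p.+1, which is below the radix by [pG] but is no
   key. *)
pose ds := [seq skey p bit (m.2 2) c | c <- U] ++ nseq (G - size U) (2 ^ p.+1).
have sG : size ds = G by rewrite size_cat size_map size_nseq subnKC // (leq_trans u3).
have klt S c : skey p bit S c < 2 ^ p.+1.
  rewrite -skeyE; elim: (p) => [|p' IH]; first by case: (S c).
  by rewrite expnS /=; case: (bit c p'); lia.
have [|code cN hc] := @digit_code G ds G0.
  rewrite all_cat all_nseq pG orbT andbT; apply/allP => d /mapP[c _ ->].
  exact: ltn_trans (klt _ _) pG.
rewrite sG in cN hc.
have {}cN : code < N by apply: leq_trans GN.
have hc' i : i < G -> digit code i G = nth (2 ^ p.+1) [seq skey p bit (m.2 2) c | c <- U] i.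
  move=> iG; rewrite hc // nth_cat; case: ltnP => iU; first by apply: set_nth_default.
  rewrite [RHS]nth_default //; rewrite size_map in iU *.
  by rewrite nth_nseq ifT //; apply: ltn_sub2r (leq_ltn_trans iU iG) iG.
have rest : forall i, code < i <= N -> objective ((iteri i F m).2 2) < objective (m.2 2).
  elim=> // i IH /andP[ci iN].
  have [g1 g2 g3] := hP i (ltnW iN).
  have [k1 k2 k3 k4] := @exec_body j i (iteri i F m) g1 ltac:(lia).
  move: ci; rewrite ltnS leq_eqVlt => /orP[/eqP ei|ci].
    case: g3 => g3; last by apply: leq_ltn_trans g3.
    apply: leq_ltn_trans u4; apply: k4 => //; first by rewrite (leq_trans u3).
    by rewrite -ei.
  by apply: leq_ltn_trans k2 (IH _); rewrite ci ltnW.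
by apply: rest; rewrite cN leqnn.
Qed.

Lemma exec_search m : input_kept m ->
  let m' := exec Search [:: p; x1; x2; b; k; n; G; N; x0] m in
  input_kept m' /\ forall Z, G ^ G <= N -> block_bound p.+1 <= G ->
      solution n p k bit (fun i => bval (B (4 * i))) (fun i => bval (B (4 * i).+1)) Z ->
      (forall i, i < p -> 0 < bval (B (4 * i).+1)) -> objective (m'.2 2) = 0.
Proof.
move=> im; have [im1 _] := im; rewrite /= /Search exec_SFor im1 !evE /=.
suff [h1 h2] : let m' := iteri W (fun i => exec (SFor (Var 7) Body) ([:: p; x1; x2; b; k; n; G; N; x0] ++ [:: W; i])) m in
  input_kept m' /\ forall Z, G ^ G <= N -> block_bound p.+1 <= G ->
      solution n p k bit (fun i => bval (B (4 * i))) (fun i => bval (B (4 * i).+1)) Z ->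
      (forall i, i < p -> 0 < bval (B (4 * i).+1)) ->
      objective (m'.2 2) <= objective (m.2 2) - W.
  split=> // Z *; apply/eqP; rewrite -leqn0; apply: leq_trans (h2 Z _ _ _ _) _ => //.
  by have := obj_lt (m.2 2); lia.
apply: (iteri_inv (P := fun i m' => input_kept m' /\ forall Z, G ^ G <= N -> block_bound p.+1 <= G ->
      solution n p k bit (fun i => bval (B (4 * i))) (fun i => bval (B (4 * i).+1)) Z ->
      (forall i, i < p -> 0 < bval (B (4 * i).+1)) ->
      objective (m'.2 2) <= objective (m.2 2) - i)).
  by split=> // *; rewrite subn0.
move=> i m' iW [h1 h2]; have [g1 g2 g3] := exec_codes i h1; split=> // Z hG hB hZ d0.
have l1 := h2 Z hG hB hZ d0; case: (objective (m'.2 2) =P 0) => [e|ne].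
  by rewrite e in g2; apply: leq_trans g2 _.
have aux x y z : x < y -> y <= z - i -> x <= z - i.+1 by lia.
exact: aux (g3 Z hG hB hZ d0 ne) l1.
Qed.

End SearchExec.

(* A number v is stored in array 3 in unary, as the set of positions below v. *)
Definition VRead := locked (Iter Zero Cap (If (Bit 3 (Var 0)) (Succ (Var 0)) (Var 0))).

(** * Raising the cap by amounts that depend on p only *)

Definition Tick := SSeq SGrow (SWrite 3 (Call 0 VRead) One).
Definition GrowRadix (d ip : nat) := SSeq Tick (SSeq Tick (SFor (Succ (Var ip))
  (SLet (Call 0 VRead) (SFor (Var (d + 2)) (SFor (Var (d + 2)) (SFor (Var (d + 2)) Tick)))))).
Definition GrowCodes (d iG : nat) :=
  SFor (Var iG) (SLet (Call 0 VRead) (SFor (Var (d + 2)) (SFor (Var iG) Tick))).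

(** G is both the radix and the length of a code, so it must exceed 2 ^ p.+1 and reach
    [block_bound p.+1]. The map g + g^3 dominates doubling as well as 2 g^2, the step of the block
    bound, and it is three nested loops of increments. *)
Definition radix (p : nat) : nat := iter p.+1 (fun g => g + g * g * g) 2.
(** This equals G (G + 1)^G, which dominates the number G^G of codes. It starts from G because that
    is what the counter already holds. *)
Definition ncodes (G : nat) : nat := iter G (fun v => v + v * G) G.

Lemma radix_bound p : block_bound p.+1 <= radix p /\ 2 ^ p.+1 < radix p.
Proof.
rewrite /radix; elim: p.+1 => [//|m [IH1 IH2]]; rewrite iterS; move: IH1 IH2.
set g := iter m _ 2; have b0 := block_bound_gt0 m; rewrite [block_bound _]/= expnS => h1 h2.
have g2 : 2 <= g by rewrite /g; elim: (m) => //= m' IH; lia.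
have gg : g * g * g >= g by nia.
split; last by lia.
have h : 2 * block_bound m * block_bound m <= 2 * g * g by nia.
apply: leq_trans h _.
case: (g) g2 => [//|[//|g']] _; nia.
Qed.

Lemma ncodes_bound G : 0 < G -> G ^ G <= ncodes G.
Proof.
case: G => [//|G] _; rewrite /ncodes.
suff h m : G.+1 ^ m <= iter m (fun v => v + v * G.+1) G.+1 by apply: h.
elim: m => [//|m IH]; rewrite iterS expnS.
by move: IH; move: (iter m _ _) (_ ^ m) => x y; nia.
Qed.

Lemma ev_VRead W B v ctx : v <= W -> (forall x, B 3 x = (x < v)) ->
  eval W B (Call 0 VRead) ctx = v.
Proof.
move=> vW hB; rewrite ev_Call subn0 drop_size /VRead -lock !evE //=.
have -> : v = minn W v by lia.
apply: (iteri_inv (P := fun i x => x = minn i v)) => [|i x iW ->]; first by rewrite min0n.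
by rewrite ?evE //= hB; case: ltnP => /= h; [case: eqP | ]; lia.
Qed.

Section Growth.

Variables (W0 : nat) (A : nat -> nat -> bool).
Hypothesis Wpos : 0 < W0.

(** Statements have no mutable variables, so the counter lives in array 3. Cap and counter rise
    together; hence the counter never exceeds the cap and stays readable however large it grows. *)
Definition stage (v : nat) (m : memory) : Prop :=
  [/\ m.1 = W0 + v, forall x, m.2 3 x = (x < v) & forall a x, a != 3 -> m.2 a x = A a x].

Lemma exec_Tick ctx v m : stage v m -> stage v.+1 (exec Tick ctx m).
Proof.
move=> [h1 h2 h3]; rewrite /Tick exec_SSeq exec_SGrow exec_SWrite ev_One; last by rewrite /=; lia.
rewrite (@ev_VRead _ _ v) //=; last by rewrite h1; lia.
split=> /= [|x|a x a3]; first by rewrite h1 addnS.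
  by rewrite h2 ltnS; case: ltngtP.
by rewrite (negbTE a3) h3.
Qed.

Lemma iteri_stage n F v d m : stage v m ->
  (forall i u m', i < n -> stage u m' -> stage (u + d) (F i m')) ->
  stage (v + n * d) (iteri n F m).
Proof.
move=> h hF; apply: (iteri_inv (P := fun i m' => stage (v + i * d) m')).
  by rewrite mul0n addn0.
by move=> i m' iN h'; rewrite mulSn addnCA addnC; apply: hF.
Qed.

Lemma exec_SFor_Tick e ctx v m n : stage v m ->
  (forall u m', stage u m' -> v <= u -> eval m'.1 m'.2 e ctx = n) ->
  stage (v + n) (exec (SFor e Tick) ctx m).
Proof.
move=> h he; rewrite exec_SFor (he v) // -[n in _ + n]muln1; apply: iteri_stage => // i u m' _ h'.
by rewrite addn1; apply: exec_Tick.
Qed.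

Lemma nth_front (ctx l : seq nat) i : i < size ctx -> nth 0 (ctx ++ l) i = nth 0 ctx i.
Proof. by move=> h; rewrite nth_cat h. Qed.

Lemma nth_back (ctx l : seq nat) i : nth 0 (ctx ++ l) (size ctx + i) = nth 0 l i.
Proof. by rewrite nth_cat ltnNge leq_addr /= addKn. Qed.

Lemma exec_GrowRadix ip ctx m p : stage 0 m -> nth 0 ctx ip = p -> ip < size ctx -> p < W0 ->
  stage (radix p) (exec (GrowRadix (size ctx) ip) ctx m).
Proof.
move=> h0 hp ic pW; rewrite /GrowRadix 2!exec_SSeq.
have h2 := exec_Tick ctx (exec_Tick ctx h0); move: (exec Tick _ _) h2 => m2 h2.
rewrite exec_SFor !evE hp; have [e1 _ _] := h2.
rewrite (_ : (p == m2.1) = false); last by rewrite e1; lia.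
apply: (iteri_inv (P := fun i m' => stage (iter i (fun g => g + g * g * g) 2) m')) => // i m' ip' h.
(* The counter grows inside the loops that it bounds; binding it first freezes the value g. *)
rewrite iterS; move: (iter i _ 2) h => g h; rewrite exec_SLet.
have [f1 f2 f3] := h; rewrite (@ev_VRead _ _ g) //; last by rewrite f1; lia.
rewrite -catA; set ctx' := ctx ++ _.
have hg l : nth 0 (ctx' ++ l) (size ctx + 2) = g by rewrite -catA nth_back.
rewrite exec_SFor !evE -[ctx' in nth 0 ctx' _]cats0 hg -mulnA.
apply: iteri_stage => // i1 u1 m1 _ h1.
rewrite exec_SFor !evE hg; apply: iteri_stage => // i2 u2 m3 _ h3.
by apply: exec_SFor_Tick => // *; rewrite evE -catA hg.
Qed.

Lemma exec_GrowCodes iG ctx m G : stage G m -> nth 0 ctx iG = G -> iG < size ctx ->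
  stage (ncodes G) (exec (GrowCodes (size ctx) iG) ctx m).
Proof.
move=> h0 hG ic; rewrite /GrowCodes exec_SFor !evE hG.
apply: (iteri_inv (P := fun i m' => stage (iter i (fun v => v + v * G) G) m')) => // i m' iG' h.
rewrite iterS; move: (iter i _ G) h => g h; rewrite exec_SLet.
have [f1 f2 f3] := h; rewrite (@ev_VRead _ _ g) //; last by rewrite f1; lia.
rewrite -catA; set ctx' := ctx ++ _.
have hg l : nth 0 (ctx' ++ l) (size ctx + 2) = g by rewrite -catA nth_back.
rewrite exec_SFor !evE -[ctx' in nth 0 ctx' _]cats0 hg.
apply: iteri_stage => // i1 u1 m1 _ h1.
by apply: exec_SFor_Tick => // *; rewrite evE -catA nth_front.
Qed.

End Growth.

(** * The encoded instance on the tape *)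

Lemma bval_bits fuel n : n <= fuel -> bval (bits_of fuel n) = n.
Proof.
elim: fuel n => [|f IH] n /=; first by case: n.
move=> nf; case: eqP => [->//|n0] /=; rewrite IH ?odd_double_half //.
by move: nf n0; have := odd_double_half n; case: (odd n); lia.
Qed.

Lemma all_enc_bit s : all (fun x => 0 < x < 4) (map enc_bit s).
Proof. by elim: s => //= -[]. Qed.

Lemma all_enc_nat n : all (fun x => 0 < x < 4) (enc_nat n).
Proof. by rewrite /enc_nat all_cat all_enc_bit. Qed.

Lemma all_enc I : all (fun x => 0 < x < 4) (enc_instance I).
Proof.
rewrite /enc_instance 4!(all_cat, all_enc_nat) /= 2!(all_cat, all_enc_nat) /=.
rewrite all_cat; apply/andP; split; apply/allP => y /flattenP[s /mapP[x _ ->]].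
  exact: (allP (all_enc_bit x)).
by apply/allP: y; rewrite /enc_rat all_cat !(all_cat _ (enc_nat _)) !all_enc_nat.
Qed.

Section Input.

Variable w : seq nat.
Notation A := (arr (init_store w)).

Lemma input_sep pre post : w = pre ++ 3 :: post -> sep A (size pre).+1.
Proof. by move=> e; rewrite /sep /= e nth_cat ltnn subnn. Qed.

Lemma input_bit pre b post : w = pre ++ enc_bit b :: post ->
  sep A (size pre).+1 = false /\ A 1 (size pre).+1 = b.
Proof. by move=> e; rewrite /sep /= e nth_cat ltnn subnn; case: (b). Qed.

Lemma code_at_enc pre bs post : w = pre ++ map enc_bit bs ++ 3 :: post ->
  code_at A (size pre).+1 bs.
Proof.
move=> e; have hb i : i < size bs ->
    sep A ((size pre).+1 + i) = false /\ A 1 ((size pre).+1 + i) = nth false bs i.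
  move=> ib; have := @input_bit (pre ++ map enc_bit (take i bs)) (nth false bs i)
    (map enc_bit (drop i.+1 bs) ++ 3 :: post).
  rewrite size_cat size_map size_takel 1?ltnW // addSn; apply.
  by rewrite e -{1}(cat_take_drop i bs) (drop_nth false ib) map_cat -!catA.
split=> [i ib|i ib|]; [exact: (hb i ib).1 | exact: (hb i ib).2 |].
have := @input_sep (pre ++ map enc_bit bs) post; rewrite size_cat size_map addSn; apply.
by rewrite e catA.
Qed.

End Input.

Lemma nth_flatten_const (T : Type) (x0 : T) (s0 : seq T) p (ss : seq (seq T)) c i :
  all (fun s => size s == p) ss -> c < size ss -> i < p ->
  nth x0 (flatten ss) (c * p + i) = nth x0 (nth s0 ss c) i.
Proof.
elim: ss c => //= s ss IH [|c] /andP[/eqP sp al] cs ip.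
  by rewrite mul0n add0n nth_cat sp ip.
by rewrite mulSn -addnA nth_cat ltnNge sp leq_addr /= addKn; apply: IH.
Qed.

Lemma size_flatten_const (T : Type) p (ss : seq (seq T)) :
  all (fun s => size s == p) ss -> size (flatten ss) = size ss * p.
Proof. by elim: ss => //= s ss IH /andP[/eqP sp /IH]; rewrite size_cat sp mulSn => ->. Qed.

Definition pi_nums (I : instance) : seq nat :=
  flatten [seq [:: `|numq q.1|; `|denq q.1|; `|numq q.2|; `|denq q.2|]%N | q <- inst_pi I].

Lemma enc_pi (I : instance) :
  flatten [seq enc_rat q.1 ++ enc_rat q.2 | q <- inst_pi I] = flatten (map enc_nat (pi_nums I)).
Proof. by rewrite /pi_nums; elim: (inst_pi I) => //= q s ->; rewrite /enc_rat -!catA. Qed.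

Lemma size_pi_nums I : size (pi_nums I) = 4 * size (inst_pi I).
Proof. by rewrite /pi_nums; elim: (inst_pi I) => //= q s ->; rewrite mulnS. Qed.

Lemma nth_pi_nums I i : i < size (inst_pi I) ->
  nth 0 (pi_nums I) (4 * i) = `|numq (target I i).1|%N /\
  nth 0 (pi_nums I) (4 * i).+1 = `|denq (target I i).1|%N.
Proof.
rewrite /pi_nums /target; elim: (inst_pi I) i => //= q s IH [|i] // h.
by have [h1 h2] := IH i h; rewrite mulnS.
Qed.

Section Layout.

Variable I : instance.
Hypothesis vI : valid_instance I.
Notation w := (enc_instance I).
Notation A := (arr (init_store w)).
Notation p := (inst_p I).
Notation k := (inst_k I).
Notation n := (size (inst_C I)).
Notation bits m := (bits_of m m).

Definition posk := size (enc_nat p) + 1.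
Definition posn := size (enc_nat p ++ enc_nat k) + 1.
Definition base := size (enc_nat p ++ enc_nat k ++ enc_nat n) + 1.
Definition posq (j : nat) := base + n * p + size (flatten (map enc_nat (take j (pi_nums I)))).

Lemma size_enc_nat m : size (enc_nat m) = size (bits m) + 1.
Proof. by rewrite /enc_nat size_cat size_map. Qed.

Lemma sizeC : all (fun s : seq bool => size s == p) (inst_C I).
Proof. by case/and3P: vI. Qed.

Lemma wE : w = enc_nat p ++ enc_nat k ++ enc_nat n ++ map enc_bit (flatten (inst_C I)) ++
  flatten (map enc_nat (pi_nums I)).
Proof. by rewrite /enc_instance enc_pi map_flatten. Qed.

Lemma code_p : code_at A 1 (bits p).
Proof. by apply: (@code_at_enc w [::]); rewrite wE {1}/enc_nat -catA. Qed.

Lemma code_k : code_at A posk (bits k).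
Proof. by rewrite /posk addn1; apply: code_at_enc; rewrite wE {2}/enc_nat -catA. Qed.

Lemma code_n : code_at A posn (bits n).
Proof. by rewrite /posn addn1; apply: code_at_enc; rewrite wE {3}/enc_nat -!catA. Qed.

Lemma size_w : (size w).+1 = base + n * p + size (flatten (map enc_nat (pi_nums I))).
Proof.
by rewrite wE /base /enc_nat !size_cat /= !size_map (size_flatten_const sizeC); lia.
Qed.

Lemma posk_le : posk + size (bits k) < (size w).+1.
Proof. by rewrite size_w /base /posk /enc_nat !size_cat /= !size_map; lia. Qed.

Lemma posnE : posn = posk + size (bits k) + 1.
Proof. by rewrite /posn /posk /enc_nat !size_cat /= !size_map; lia. Qed.

Lemma baseE : base = posn + size (bits n) + 1.
Proof. by rewrite /base /posn /enc_nat !size_cat /= !size_map; lia. Qed.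

Lemma base_le : base + n * p <= (size w).+1.
Proof. by rewrite size_w leq_addr. Qed.

Lemma posn_le : posn + size (bits n) < (size w).+1.
Proof. by have := base_le; rewrite baseE; lia. Qed.

Lemma pos1_le : 1 + size (bits p) < (size w).+1.
Proof. by have := posk_le; rewrite /posk size_enc_nat; lia. Qed.

Lemma poskE : posk = 1 + size (bits p) + 1.
Proof. by rewrite /posk size_enc_nat; lia. Qed.

Lemma cand_bit c i : c < n -> i < p ->
  A 1 (base + c * p + i) = nth false (nth [::] (inst_C I) c) i.
Proof.
move=> cn ip; have il : c * p + i < size (flatten (inst_C I)).
  by rewrite (size_flatten_const sizeC); nia.
pose pre := enc_nat p ++ enc_nat k ++ enc_nat n ++ map enc_bit (take (c * p + i) (flatten (inst_C I))).
have := @input_bit w pre (nth false (flatten (inst_C I)) (c * p + i))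
  (map enc_bit (drop (c * p + i).+1 (flatten (inst_C I))) ++ flatten (map enc_nat (pi_nums I))).
rewrite (nth_flatten_const _ [::] sizeC) //.
rewrite (_ : (size pre).+1 = base + c * p + i) => [h|]; last first.
  by rewrite /pre /base /enc_nat !size_cat !size_map size_takel 1?ltnW //; lia.
apply: (h _).2; rewrite wE /pre -{1}(cat_take_drop (c * p + i) (flatten (inst_C I))).
rewrite (drop_nth false il) (nth_flatten_const _ [::] sizeC) //.
by rewrite map_cat -!catA.
Qed.

Lemma size_pi : size (inst_pi I) = p.
Proof. by case/and3P: vI => _ /eqP. Qed.

Lemma code_q j : j < 4 * p ->
  [/\ code_at A (posq j) (bits (nth 0 (pi_nums I) j)),
      posq j.+1 = posq j + size (bits (nth 0 (pi_nums I) j)) + 1 &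
      posq j + size (bits (nth 0 (pi_nums I) j)) < (size w).+1].
Proof.
move=> jp; have jl : j < size (pi_nums I) by rewrite size_pi_nums size_pi.
have e1 : posq j.+1 = posq j + size (bits (nth 0 (pi_nums I) j)) + 1.
  rewrite /posq (take_nth 0 jl) -cats1 map_cat flatten_cat size_cat /= cats0 size_enc_nat; lia.
split=> //; last first.
  apply: leq_trans (_ : posq j.+1 <= _); first by rewrite e1 addn1.
  rewrite size_w /posq leq_add2l -{2}(cat_take_drop j.+1 (pi_nums I)) map_cat flatten_cat size_cat.
  exact: leq_addr.
pose pre := enc_nat p ++ enc_nat k ++ enc_nat n ++ map enc_bit (flatten (inst_C I)) ++
  flatten (map enc_nat (take j (pi_nums I))).
rewrite (_ : posq j = (size pre).+1).
  apply: (@code_at_enc w pre _ (flatten (map enc_nat (drop j.+1 (pi_nums I))))).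
  rewrite wE /pre -{1}(cat_take_drop j (pi_nums I)) (drop_nth 0 jl) map_cat flatten_cat /=.
  by rewrite {4}/enc_nat -!catA.
by rewrite /posq /pre /base /enc_nat !size_cat !size_map (size_flatten_const sizeC); lia.
Qed.

Lemma posq0 : posq 0 = base + n * p.
Proof. by rewrite /posq take0 addn0. Qed.

(** Although p is written in binary, each attribute contributes four numerals of the target
    distribution, and each of them ends in a separator. *)
Lemma p_le : p <= size w.
Proof.
have h : size (pi_nums I) <= size (flatten (map enc_nat (pi_nums I))).
  elim: (pi_nums I) => //= x s IH; rewrite size_cat size_enc_nat; lia.
move: h; rewrite size_pi_nums size_pi; have := size_w; rewrite /base; lia.
Qed.

Lemma n_le : 0 < p -> n <= size w.
Proof. by have := size_w; rewrite /base; nia. Qed.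

Lemma np_le : n * p <= size w.
Proof. by have := size_w; rewrite /base; nia. Qed.

End Layout.

(** * Perfect committees as integer equations *)

Lemma rat_absE (t : rat) : (0 <= t)%R -> t = ((`|numq t|%N)%:R / (`|denq t|%N)%:R)%R.
Proof.
move=> t0; rewrite -[LHS]divq_num_den -{1}[numq t]gez0_abs ?numq_ge0 //.
by rewrite -{1}[denq t]gez0_abs ?denq_ge0.
Qed.

Lemma absz_denq_gt0 (t : rat) : 0 < `|denq t|%N.
Proof. by rewrite absz_gt0 denq_neq0. Qed.

Lemma ratio_eq (c k : nat) (t : rat) : 0 < k -> (0 <= t)%R ->
  (c%:R / k%:R)%R = t <-> (c * `|denq t| = k * `|numq t|)%N.
Proof.
move=> k0 t0; have kn : (k%:R != 0 :> rat)%R by rewrite pnatr_eq0 -lt0n.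
have dn : ((`|denq t|%N)%:R != 0 :> rat)%R by rewrite pnatr_eq0 -lt0n absz_denq_gt0.
rewrite {1}(rat_absE t0); split=> [/eqP|e].
  by rewrite eqr_div // -!natrM eqr_nat => /eqP ->; rewrite mulnC.
by apply/eqP; rewrite eqr_div // -!natrM eqr_nat e mulnC.
Qed.

Lemma numq_le_denq (t : rat) : (0 <= t <= 1)%R -> (`|numq t| <= `|denq t|)%N.
Proof.
move=> /andP[t0]; rewrite {1}(rat_absE t0) ler_pdivrMr ?mul1r ?ler_nat //.
by rewrite ltr0n absz_denq_gt0.
Qed.

Section Correctness.

Variable I : instance.
Hypothesis vI : valid_instance I.
Notation p := (inst_p I).
Notation k := (inst_k I).
Notation n := (size (inst_C I)).

Definition anum (i : nat) := nth 0 (pi_nums I) (4 * i).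
Definition aden (i : nat) := nth 0 (pi_nums I) (4 * i).+1.
Definition cattr (c i : nat) : bool := nth false (nth [::] (inst_C I) c) i.

Lemma target_ok i : i < p ->
  [/\ (0 <= (target I i).1)%R, (0 <= (target I i).2)%R & ((target I i).1 + (target I i).2 = 1)%R].
Proof.
case/and3P: (vI) => _ /eqP sp /all_nthP h ip.
by have /and3P[h1 h2 /eqP h3] := h (0%R, 0%R) i ltac:(by rewrite sp).
Qed.

Lemma anumE i : i < p -> anum i = `|numq (target I i).1|%N.
Proof. by move=> ip; apply: (nth_pi_nums _).1; rewrite size_pi. Qed.

Lemma adenE i : i < p -> aden i = `|denq (target I i).1|%N.
Proof. by move=> ip; apply: (nth_pi_nums _).2; rewrite size_pi. Qed.

Lemma aden_gt0 i : i < p -> 0 < aden i.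
Proof. by move=> ip; rewrite adenE // absz_denq_gt0. Qed.

Lemma anum_le i : i < p -> anum i <= aden i.
Proof.
move=> ip; rewrite anumE // adenE //; apply: numq_le_denq.
have [h1 h2 h3] := target_ok ip; rewrite h1 /=.
by rewrite -h3 lerDl.
Qed.

(** Cross multiplication turns the ratios for the first value into the equations of [solution]. The
    denominator is coprime to the numerator and divides k * num, so it divides k and is at most
    n. *)
Lemma perfect_solution : 0 < k -> k <= n ->
  perfect_committee_exists I <-> exists S, solution n p k cattr anum aden S.
Proof.
move=> k0 kn.
have main (S : nat -> bool) (Q : {set 'I_n}) : (forall c : 'I_n, (c \in Q) = S c) ->
    perfect I Q <-> solution n p k cattr anum aden S.
  move=> QS.
  have cp : #|Q| = csum n (coordinate p cattr) S p.
    rewrite -sum1_card big_mkcond /=; apply: eq_bigr => c _.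
    by rewrite QS /coordinate eqxx; case: (S c).
  have ct i : i < p -> #|[set c in Q | attr I c i == true]| = csum n (coordinate p cattr) S i.
    move=> ip; rewrite -sum1_card big_mkcond /=; apply: eq_bigr => c _.
    by rewrite inE QS /coordinate ltn_eqF //= eqb_id /attr /cattr; case: (_ && _).
  have cf i : i < p -> #|[set c in Q | attr I c i == true]| + #|[set c in Q | attr I c i == false]| = #|Q|.
    move=> ip; rewrite -(cardsID [set c | attr I c i == true] Q); congr (_ + _); apply: eq_card => c.
      by rewrite !inE.
    by rewrite !inE andbC; case: (attr I c i).
  have rt i : i < p -> Defs.ratio I Q i true = (target I i).1 <->
      (csum n (coordinate p cattr) S i * aden i = k * anum i)%N.
    move=> ip; rewrite anumE // adenE // -ct //; have [h1 _ _] := target_ok ip.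
    exact: ratio_eq.
  split=> [[h1 h2]|[h1 h2]].
    split=> [|i ip]; first by rewrite -cp.
    have [/(rt i ip) e _] := h2 i ip; split=> //.
    apply: leq_trans kn; apply: dvdn_leq => //.
    rewrite -(@Gauss_dvdl _ k (anum i)) -?e ?dvdn_mull //.
    by rewrite coprime_sym anumE // adenE //; apply: coprime_num_den.
  split=> [|i ip]; first by rewrite cp.
  have [_ /(rt i ip) e] := h2 i ip; split=> //.
  have [_ _ s1] := target_ok ip.
  have kn0 : (k%:R != 0 :> rat)%R by rewrite pnatr_eq0 -lt0n.
  (* The ratio of the second value comes for free: the two counts add up to k and the two targets to
     1. *)
  apply: (addrI (target I i).1); rewrite s1 -{1}e /Defs.ratio -mulrDl -natrD cf // cp h1.
  by rewrite divff.
split=> [[Q pQ]|[S sS]].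
  have h (c : 'I_n) : (c \in Q) = ((c : nat) \in [seq val o | o in Q]).
    by rewrite mem_map ?mem_enum //; apply: val_inj.
  by exists (fun c => c \in [seq val o | o in Q]); apply: (main _ _ h).1 pQ.
have h (c : 'I_n) : (c \in [set c : 'I_n | S c]) = S c by rewrite inE.
by exists [set c : 'I_n | S c]; apply: (main _ _ h).2 sS.
Qed.

Lemma perfect_size : perfect_committee_exists I -> k <= n.
Proof. by case=> Q [<- _]; rewrite -[X in _ <= X]card_ord max_card. Qed.

(** Division by zero gives zero here, so for k = 0 both ratios of an attribute vanish, whereas its
    targets add up to 1. *)
Lemma perfect_k0 : 0 < p -> perfect_committee_exists I -> 0 < k.
Proof.
move=> p0 [Q [_ /(_ 0 p0) [h1 h2]]]; rewrite lt0n; apply/eqP => k0.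
have [_ _] := target_ok p0; rewrite -h1 -h2 /Defs.ratio k0 invr0 !mulr0 addr0 => /esym/eqP.
by rewrite oner_eq0.
Qed.

Lemma perfect_p0 : p = 0 -> k <= n -> perfect_committee_exists I.
Proof.
move=> p0 kn; exists [set c : 'I_n | c < k]; split=> [|i]; last by rewrite p0.
rewrite -sum1_card big_mkcond /=.
transitivity (\sum_(c < n) (c < k) : nat).
  by apply: eq_bigr => c _; rewrite inE; case: ltnP.
rewrite -(big_mkord xpredT (fun c => (c < k) : nat)) (big_cat_nat (n := k)) //=.
rewrite (eq_big_nat _ _ (F2 := fun _ => 1)) => [|c /andP[_ ->] //].
rewrite sum_nat_const_nat subn0 muln1 big_nat big1 ?addn0 // => c /andP[kc _].
by rewrite ltnNge kc.
Qed.

End Correctness.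

(** * The complete decision program *)

(** The violation may reach n + p n^2. Both n and n p are at most the input size, so squaring the
    cap makes enough room. In a context of eight entries [Var 8] is the bound of the outer loop,
    that is, the cap on entry. *)
Definition Square := SFor Cap (SFor (Var 8) SGrow).
Definition Decide (e : exp) := SWrite 2 Zero e.
Definition Solve := SSeq (GrowRadix 6 0) (SLet (Call 0 VRead)
  (SSeq (GrowCodes 7 6) (SLet (Call 0 VRead)
    (SSeq Square (SLet (App2 Add (Var 3) (App2 Mul (Var 5) (Var 0)))
      (SSeq Search (Decide (Eq (ViolE 2) Zero)))))))).
(* If p = 0 the candidates occupy no tape cells and their number may be exponential
   in the input size; then k <= n is decided on the binary numerals. *)
Definition Main := SLet (App1 Nval One) (SLet (App1 Endp One) (SLet (App1 Endp (Var 1))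
  (SLet (App1 Endp (Var 2)) (SLet (App1 Nval (Var 1)) (SLet (App1 Nval (Var 2))
    (SIf (Var 0)
      (SIf (App2 Binleq (Var 1) (Var 2)) (SIf (Var 4) Solve (Decide Zero)) (Decide Zero))
      (Decide (App2 Binleq (Var 1) (Var 2))))))))).

Lemma exec_Square ctx m : size ctx = 8 -> exec Square ctx m = (m.1 + m.1 * m.1, m.2).
Proof.
move=> s8; case: m => W A; rewrite /Square exec_SFor !evE /=.
apply: (iteri_inv (P := fun i m' => m' = (W + i * W, A))) => [|i m' _ ->]; first by rewrite addn0.
have nE l : nth 0 (ctx ++ W :: l) 8 = W by rewrite nth_cat s8.
rewrite exec_SFor !evE /= nE (_ : W + i.+1 * W = W + i * W + W); last by rewrite mulSn; lia.
apply: (iteri_inv (P := fun i' m' => m' = (W + i * W + i', A))) => [|i' m'' _ ->].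
  by rewrite addn0.
by rewrite exec_SGrow /= addnS.
Qed.

Lemma exec_Decide e ctx m : (exec (Decide e) ctx m).1 = m.1 /\
  (exec (Decide e) ctx m).2 2 0 = (eval m.1 m.2 e (ctx ++ [:: 0]) != 0).
Proof. by rewrite /Decide exec_SWrite !evE. Qed.

Section Main.

Variable I : instance.
Hypothesis vI : valid_instance I.
Notation w := (enc_instance I).
Notation A := (arr (init_store w)).
Notation p := (inst_p I).
Notation k := (inst_k I).
Notation n := (size (inst_C I)).
Notation W := ((size w).+1).

Lemma exec_Solve : 0 < p -> 0 < k -> k <= n ->
  let m := exec Solve [:: p; posk I; posn I; base I; k; n] (W, A) in
  let W1 := W + ncodes (radix p) in
  m.1 = W1 + W1 * W1 /\ (m.2 2 0 <-> perfect_committee_exists I).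
Proof.
(* The postcondition is hidden behind an opaque predicate, so that rewriting and simplification act
   on the program alone. *)
move=> p0 k0 kn; cbv zeta; have [P PE] : exists P : memory -> Prop, forall m, P m <->
    m.1 = W + ncodes (radix p) + (W + ncodes (radix p)) * (W + ncodes (radix p)) /\
    (m.2 2 0 <-> perfect_committee_exists I) by eexists=> m; exact: iff_refl.
apply/PE; have pW : p < W by rewrite ltnS p_le.
have nW : n < W by rewrite ltnS n_le.
have st0 : stage W A 0 (W, A) by split=> //=; rewrite addn0.
rewrite /Solve exec_SSeq.
have : stage W A (radix p) (exec (GrowRadix 6 0) [:: p; posk I; posn I; base I; k; n] (W, A)).
  exact: (@exec_GrowRadix W A isT 0 [:: p; posk I; posn I; base I; k; n] (W, A) p st0 erefl isT pW).
move: (exec (GrowRadix 6 0) _ _) => m1 st1.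
rewrite exec_SLet (@ev_VRead _ _ (radix p)); [|by case: st1 => -> _ _; lia|by case: st1].
rewrite exec_SSeq.
have : stage W A (ncodes (radix p)) (exec (GrowCodes 7 6) [:: p; posk I; posn I; base I; k; n; radix p] m1).
  exact: (@exec_GrowCodes W A isT 6 [:: p; posk I; posn I; base I; k; n; radix p] m1 _ st1 erefl isT).
move: (exec (GrowCodes 7 6) _ _) => m2 st2.
rewrite exec_SLet (@ev_VRead _ _ (ncodes (radix p))); [|by case: st2 => -> _ _; lia|by case: st2].
rewrite exec_SSeq exec_Square //; case: st2 => e1 _ e3; rewrite e1.
set N := ncodes (radix p); set W1 := W + N; set W2 := W1 + W1 * W1; rewrite exec_SLet.
have [bG pG] := radix_bound p; have G0 : 0 < radix p by lia.
have GN := ncodes_bound G0.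
have GleN : radix p <= N.
  apply: leq_trans GN; rewrite -{1}[radix p]expn1 leq_exp2l //.
  by have := ltn_expl p.+1 (isT : 1 < 2); lia.
have W1W : W <= W1 by apply: leq_addr.
have W12 : W1 <= W2 by apply: leq_addr.
have NW1 : N <= W1 by apply: leq_addl.
have bl : base I + n * p <= W2 by apply: leq_trans (base_le vI) (leq_trans W1W W12).
rewrite !evE //= !ev_Mul ?ev_Add; try lia.
have -> : minn (base I + minn (n * p) W2) W2 = base I + n * p by lia.
set m3 : memory := (W2, m2.2).
have im3 : input_kept W2 A m3 by split=> //= a x a2; apply: e3; lia.
pose B j := bits_of (nth 0 (pi_nums I) j) (nth 0 (pi_nums I) j).
have BE j : bval (B j) = nth 0 (pi_nums I) j by apply: bval_bits.
have n0 : 0 < n by apply: leq_trans kn.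
have hq j : j < 4 * p -> [/\ code_at A (posq I j) (B j), posq I j.+1 = posq I j + size (B j) + 1
    & posq I j + size (B j) < W2].
  by move=> /(code_q vI) [h1 h2 h3]; split=> //; apply: leq_trans h3 (leq_trans W1W W12).
have dn i : i < p -> bval (B (4 * i).+1) <= n -> bval (B (4 * i)) <= n.
  by move=> ip; rewrite !BE; apply: leq_trans; apply: anum_le.
have nnW : n + p * (n * n) < W2.
  have h1 := n_le vI p0; have h2 := np_le vI.
  have h3 : p * (n * n) <= size w * size w by nia.
  have h4 : size w * size w <= W1 * W1 by nia.
  by move: h3 h4; rewrite /W2; move: (p * _) (size w * _) (W1 * W1) => x y z; lia.
have W20 : 0 < W2 by lia.
have nW2 : n < W2 by lia.
have pW2 : 2 ^ p.+1 <= W2 by lia.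
have GW2 : 0 < radix p <= W2 by lia.
have NW2 : N <= W2 by lia.
rewrite exec_SSeq.
have [im4 done] := @exec_search W2 A p (posk I) (posn I) (base I) k n (radix p) N _ (posq I) B
  W20 bl nW2 pW2 kn n0 (posq0 I) hq dn nnW GW2 pG NW2 m3 im3.
move: (exec Search _ m3) im4 done => m4 im4 done.
have [d1 d2] := exec_Decide (Eq (ViolE 2) Zero) [:: p; posk I; posn I; base I; k; n; radix p; N; base I + n * p] m4.
apply/PE; split; first by rewrite d1; case: im4.
rewrite {}d2; have [im41 _] := im4; rewrite im41 /ViolE !evE //= (inv_viol W20 bl nW2 kn n0 (posq0 I) hq dn nnW) //.
rewrite eqb0 negbK.
have solE S : solution n p k (bit A p (base I)) (fun i => bval (B (4 * i))) (fun i => bval (B (4 * i).+1)) S <->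
    solution n p k (cattr I) (anum I) (aden I) S.
  have cs i : i <= p -> csum n (coordinate p (bit A p (base I))) S i = csum n (coordinate p (cattr I)) S i.
    move=> ip; apply: eq_bigr => c _; rewrite /coordinate; case: (eqVneq i p) => // ne.
    have ip' : i < p by rewrite ltn_neqAle ne.
    by rewrite [bit _ _ _ _ _](cand_bit vI (ltn_ord c) ip').
  rewrite /solution cs //; split=> -[h1 h2]; split=> // i ip; have := h2 i ip;
    rewrite cs ?(ltnW ip) // !BE; apply.
split=> [/eqP /obj_eq0 /solE h|].
  by apply/(perfect_solution vI k0 kn); exists (m4.2 2).
move=> /(perfect_solution vI k0 kn) [Z /solE hZ]; apply/eqP; apply: (done Z) => // i ip.
by rewrite BE; apply: aden_gt0.
Qed.

Lemma exec_Main : let m := exec Main [::] (W, A) in let W1 := W + ncodes (radix p) in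
  m.1 <= W1 + W1 * W1 /\ (m.2 2 0 <-> perfect_committee_exists I).
Proof.
have Wle : W <= W + ncodes (radix p) + (W + ncodes (radix p)) * (W + ncodes (radix p)) by nia.
cbv zeta; have [P PE] : exists P : memory -> Prop, forall m, P m <->
    m.1 <= W + ncodes (radix p) + (W + ncodes (radix p)) * (W + ncodes (radix p)) /\
    (m.2 2 0 <-> perfect_committee_exists I) by eexists=> m; exact: iff_refl.
apply/PE; rewrite /Main exec_SLet !evE //= ev_One // (ev_Nval (ltn0Sn _) (code_p I) (pos1_le vI)) bval_bits //.
rewrite (minn_idPl _); last by apply: ltnW; rewrite ltnS p_le.
rewrite exec_SLet !evE //= ev_One // (ev_Endp (ltn0Sn _) (code_p I) (pos1_le vI)) -poskE //.
rewrite exec_SLet !evE //= (ev_Endp (ltn0Sn _) (code_k I) (posk_le vI)) -posnE //.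
rewrite exec_SLet !evE //= (ev_Endp (ltn0Sn _) (code_n I) (posn_le vI)) -baseE //.
rewrite exec_SLet !evE //= (ev_Nval (ltn0Sn _) (code_k I) (posk_le vI)) bval_bits //.
rewrite exec_SLet !evE //= (ev_Nval (ltn0Sn _) (code_n I) (posn_le vI)) bval_bits //.
rewrite exec_SIf !evE //=; case: posnP => [p0|p0].
  have [d1 d2] := exec_Decide (App2 Binleq (Var 1) (Var 2)) [:: p; posk I; posn I; base I; minn k W; minn n W] (W, A).
  apply/PE; rewrite d1 d2 !evE //= (ev_Binleq (ltn0Sn _) (code_k I) (code_n I)) ?posk_le ?posn_le // !bval_bits //.
  split=> //; rewrite eqb0 negbK; split; [exact: perfect_p0 | exact: perfect_size].
have nW : n < W by rewrite ltnS n_le.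
have rej : let m := exec (Decide Zero) [:: p; posk I; posn I; base I; minn k W; minn n W] (W, A) in
    m.1 = W /\ m.2 2 0 = false.
  by have [d1 d2] := exec_Decide Zero [:: p; posk I; posn I; base I; minn k W; minn n W] (W, A).
rewrite exec_SIf !evE //= (ev_Binleq (ltn0Sn _) (code_k I) (code_n I)) ?posk_le ?posn_le // !bval_bits //.
(* k may be exponential in the input size, so it is first compared with n in binary. Only when k <=
   n < W is known does its capped value equal k. *)
case: (leqP k n) => kn /=; last first.
  by apply/PE; have [-> ->] := rej; split=> //; split=> // /perfect_size; rewrite leqNgt kn.
rewrite exec_SIf !evE /=; case: posnP => k0.
  apply/PE; have [-> ->] := rej; split=> //; split=> // /(perfect_k0 vI p0); move: k0; lia.
have -> : minn k W = k by lia.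
have -> : minn n W = n by lia.
have k0' : 0 < k by lia.
by apply/PE; have [-> h] := exec_Solve p0 k0' kn.
Qed.

End Main.

(** * The parameter-dependent factor *)

Definition URead := locked (Iter Zero Cap (If (Bit 1 (Succ (Var 0))) (Succ (Var 0)) (Var 0))).
Definition UTick := SSeq SGrow (SWrite 1 (Succ (Call 0 URead)) One).
Fixpoint UPow (iN e : nat) : stm := if e is e'.+1 then SFor (Var iN) (UPow iN e') else UTick.
(** The result is appended in track 1 to the unary input, whence the summand p in [bound]. The two
    [SGrow] make room for N + 2, and array 3 is erased at the end because it would alter the output
    symbols. *)
Definition Bound (e : nat) := SLet (Call 0 URead) (SSeq (GrowRadix 1 0) (SLet (Call 0 VRead)
  (SSeq (GrowCodes 2 1) (SLet (Call 0 VRead) (SSeq SGrow (SSeq SGrow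
    (SLet (Succ (Succ (Var 2))) (SSeq (UPow 3 e) (SFor Cap (SWrite 3 (Var 5) Zero)))))))))).

Lemma sfits_Main : sfits 100 Main 2.
Proof.
rewrite /Main /Solve /GrowRadix /GrowCodes /Search /Body /Apply /CopyArr /ViolE /Decide /Tick /SSkip /Square.
rewrite /Viol /Term /Pos /Count /Size /Find /Key /Cbit /Binleq /BitAt /Nval /Endp /VRead.
rewrite /Digit /Div /Mod /Dist /Leq /Minus /Pred /Mul /Add /One -!lock.
by vm_compute.
Qed.

(** Each nested loop takes two more registers, for its bound and its index. *)
Lemma sfits_UPow NR iN e d : d + e.*2 + 4 < NR -> sfits NR (UPow iN e) d.
Proof.
elim: e d => [|e IH] d h.
  by rewrite /UPow /UTick /URead /One -!lock /=; lia.
by rewrite /= IH; lia.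
Qed.

Lemma sfits_Bound e : sfits (20 + e.*2) (Bound e) 2.
Proof.
rewrite /Bound /GrowRadix /GrowCodes /Tick /VRead /URead /One -!lock /= sfits_UPow //=; lia.
Qed.

Lemma ev_URead W B v ctx : v < W -> (forall x, B 1 x.+1 = (x < v)) ->
  eval W B (Call 0 URead) ctx = v.
Proof.
move=> vW hB; rewrite ev_Call subn0 drop_size /URead -lock !evE //=.
have -> : v = minn W v by lia.
apply: (iteri_inv (P := fun i x => x = minn i v)) => [|i x iW ->]; first by rewrite min0n.
rewrite ?evE //= (_ : (minn i v == W) = false); last by lia.
by rewrite hB; case: ltnP => /= h; lia.
Qed.

Section Output.

Variables (c : nat) (A : nat -> nat -> bool).
Hypothesis c0 : 0 < c.

Definition ustage (v : nat) (m : memory) : Prop :=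
  [/\ m.1 = c + v, forall x, m.2 1 x.+1 = (x < v) & forall a x, (a != 1) || (x == 0) -> m.2 a x = A a x].

Lemma exec_UTick ctx v m : ustage v m -> ustage v.+1 (exec UTick ctx m).
Proof.
move=> [h1 h2 h3]; rewrite /UTick exec_SSeq exec_SGrow exec_SWrite ev_One; last by rewrite /=; lia.
rewrite evE (@ev_URead _ _ v) //=; last by rewrite h1; lia.
rewrite ifF; last by rewrite h1; lia.
split=> /= [|x|a x a3]; first by rewrite h1 addnS.
  by rewrite h2 ltnS eqSS; case: ltngtP.
by rewrite -h3 // ifF //; case: (x) a3 => [|x']; rewrite ?andbF ?orbF // => /negbTE ->.
Qed.

Lemma exec_UPow e ctx v m iN N : iN < size ctx -> nth 0 ctx iN = N -> ustage v m ->
  ustage (v + N ^ e) (exec (UPow iN e) ctx m).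
Proof.
elim: e ctx v m => [|e IH] ctx v m ic hN h; first by rewrite addn1; apply: exec_UTick.
rewrite [UPow _ _]/= exec_SFor !evE hN expnS.
apply: (iteri_inv (P := fun i m' => ustage (v + i * N ^ e) m')); first by rewrite addn0.
move=> i m' _ h'; rewrite mulSn addnCA addnC; apply: IH => //.
  by rewrite size_cat ltn_addr.
by rewrite nth_front.
Qed.

End Output.

Definition bound (e p : nat) : nat := p + (ncodes (radix p) + 2) ^ e.

Lemma exec_Bound e p : forall a x, a < narr ->
  (exec (Bound e) [::] (input_memory (nseq p 2))).2 a x.+1 = (a == 1) && (x < bound e p).
Proof.
rewrite /input_memory size_nseq; set A := arr _.
have A0 a x : a != 1 -> A a x = false.
  rewrite /A /=; case: a => [|[|a]] // _; rewrite /= nth_nseq.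
  by case: ifP; rewrite andbF.
have A1 x : A 1 x.+1 = (x < p) by rewrite /A /= nth_nseq; case: ifP.
have A10 : A 1 0 = false by [].
clearbody A.
rewrite /Bound exec_SLet (@ev_URead _ _ p) // exec_SSeq.
have st0 : stage p.+1 A 0 (p.+1, A).
  by split=> //= [|x]; rewrite ?addn0 // A0.
have : stage p.+1 A (radix p) (exec (GrowRadix 1 0) [:: p] (p.+1, A)).
  exact: (@exec_GrowRadix p.+1 A isT 0 [:: p] (p.+1, A) p st0 erefl isT (ltnSn p)).
move: (exec (GrowRadix 1 0) _ _) => m1 st1.
rewrite exec_SLet (@ev_VRead _ _ (radix p)); [|by case: st1 => -> _ _; lia|by case: st1].
rewrite exec_SSeq.
have : stage p.+1 A (ncodes (radix p)) (exec (GrowCodes 2 1) [:: p; radix p] m1).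
  exact: (@exec_GrowCodes p.+1 A isT 1 [:: p; radix p] m1 _ st1 erefl isT).
move: (exec (GrowCodes 2 1) _ _) => m2 st2.
rewrite exec_SLet (@ev_VRead _ _ (ncodes (radix p))); [|by case: st2 => -> _ _; lia|by case: st2].
case: st2 => e1 e2 e3.
rewrite exec_SSeq exec_SGrow exec_SSeq exec_SGrow exec_SLet !evE [(_, _).1]/= [(_, _).2]/= e1.
set N := ncodes (radix p); rewrite [nth _ _ _]/=.
rewrite (_ : (N == (p.+1 + N).+2) = false); last by lia.
rewrite (_ : (N.+1 == (p.+1 + N).+2) = false); last by lia.
rewrite exec_SSeq.
have us0 : ustage (N + 3) m2.2 p ((p.+1 + N).+2, m2.2).
  by split=> //= [|x]; [lia | rewrite e3].
have : ustage (N + 3) m2.2 (p + N.+2 ^ e) (exec (UPow 3 e) [:: p; radix p; N; N.+2] ((p.+1 + N).+2, m2.2)).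
  by apply: exec_UPow => //; lia.
rewrite -[(_ ++ _) ++ _]/[:: p; radix p; N; N.+2].
move: (exec (UPow 3 e) _ _) => m3 [f1 f2 f3].
have main : forall a x, (exec (SFor Cap (SWrite 3 (Var 5) Zero)) [:: p; radix p; N; N.+2] m3).2 a x =
    (if (a == 3) && (x < m3.1) then false else m3.2 a x).
  rewrite exec_SFor !evE.
  apply: (iteri_inv (P := fun i m => forall a x, m.2 a x = if (a == 3) && (x < i) then false else m3.2 a x)).
    by move=> a x; rewrite andbF.
  move=> i m4 im h4 a x; rewrite exec_SWrite !evE /= h4.
  by case: (a == 3) => //=; rewrite ltnS; case: ltngtP.
move=> a x an; rewrite main /bound -addn2 f1.
case: (a =P 1) => [->|/eqP a1] /=; first by rewrite f2 addn2.
case: (a =P 3) => [->|/eqP a3] /=.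
  case: ltnP => // h; rewrite f3 // e2; apply/negbTE; rewrite -leqNgt; lia.
by rewrite f3 ?a1 // e3 // A0.
Qed.

Lemma rep_output NR code tp q L (cf : config (machine NR code)) :
  (forall j, tp j.+1 = if j < L then 2 else 0) -> rep q 1 tp cf ->
  output (machine NR code) cf = nseq L (inord 2).
Proof.
move=> htp [_ _ h3 h4]; rewrite /output.
have h j : nth (blank _) (cf_head (machine NR code) cf :: cf_right (machine NR code) cf) j =
    (if j < L then 2 else 0) :> nat.
  by case: j => [|j] /=; rewrite ?h3 ?h4 -htp ?add1n.
move: (_ :: _) h {h3 h4 htp} => s; elim: L s => [|L IH] [|x s] h //.
- by have /= := h 0; case: eqP => // ne /= e; case: ne; apply: val_inj.
- by have := h 0.
have x2 : x = inord 2 by have /= e := h 0; apply: val_inj; rewrite /= inordK // -e.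
have x0 : x != blank (machine NR code) by rewrite -val_eqE /= (h 0).
rewrite /= (negbTE x0) x2; congr cons; apply: IH => j; exact: (h j.+1).
Qed.

Lemma rep_state NR code q pos tp (cf : config (machine NR code)) (b : bool) :
  q = (if b then 3 else 4) -> rep q pos tp cf ->
  halted (machine NR code) cf /\ (cf_state _ cf = tm_acc (machine NR code) <-> b).
Proof.
move=> -> [h _ _ _]; rewrite /halted -!val_eqE /= !inordK ?h; try by rewrite /nst; lia.
split; first by case: b {h}.
split=> [e|hb]; first by move: h; rewrite e /= inordK; [case: b | rewrite /nst; lia].
by apply: val_inj; rewrite /= inordK ?h ?hb // /nst; lia.
Qed.

Lemma bound_computable e : tm_computable (bound e).
Proof.
have NR2 : 1 < 20 + e.*2 by lia.
have [E hE] := prog_correct NR2 (sfits_Bound e).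
exists (machine (20 + e.*2) (prog (20 + e.*2) (Bound e))) => p.
have wP : all (fun x => 0 < x < 4) (nseq p 2) by rewrite all_nseq orbT.
have [t _ r] := hE _ wP; exists t; split.
  exact: (rep_state (b := (exec (Bound e) [::] (input_memory (nseq p 2))).2 2 0) erefl r).1.
apply: rep_output r => j; rewrite /tape.
rewrite -(@pack_input (20 + e.*2) (if j < bound e p then 2 else 0)); last by case: ifP.
apply: pack_ext => u uT; rewrite /trk; case: ltnP => un.
  rewrite -[arr _ _ _]/((exec (Bound e) [::] (input_memory (nseq p 2))).2 u j.+1) exec_Bound //; case: u {uT} un => [|[|u]] _ //=; case: ifP => //.
by rewrite ltnNge (leq_trans _ un).
Qed.

Theorem theorem4 : FPT_in_p perfect_committee_exists.
Proof.
have [E hE] := prog_correct (isT : 1 < 100) sfits_Main.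
exists (bound (4 * E)), (2 * E), (machine 100 (prog 100 Main)); split; first exact: bound_computable.
move=> I vI; have [t tE r] := hE _ (all_enc I).
have [mW mP] := exec_Main vI.
exists t; split; last first.
  have [h1 h2] := rep_state erefl r; split=> //; exact: iff_trans h2 mP.
apply: leq_trans tE _; rewrite /bound.
set m := exec _ _ _ in mW *; set s := (size _).+1; set N := ncodes _.
apply: leq_trans (_ : (N + 2) ^ (4 * E) * s ^ (2 * E) <= _); last by rewrite leq_mul2r leq_addl orbT.
rewrite !expnM -expnMn; case: (E) => // E'; rewrite leq_exp2r //.
(* Here parameter and input size are separated into factors. The cap after squaring is below (s + N
   + 2)^2, so raising to the power 2E gives the exponents 4E and 2E. *)
have h1 : s + N + 2 <= (N + 2) ^ 2 * s by rewrite expnS expn1; rewrite /s; nia.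
have h2 : m.1 + 2 <= (s + N + 2) ^ 2.
  by move: mW; rewrite -/s -/N expnS expn1; move: m.1 => x; nia.
apply: leq_trans h2 _; apply: leq_trans (_ : ((N + 2) ^ 2 * s) ^ 2 <= _); first by rewrite leq_exp2r.
by rewrite expnMn -expnM.
Qed.
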